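(* Let $K$ be a compact abelian group, dual to a discrete ordered abelian group $\Gamma$, with normalized Haar measure $\sigma$. Let $1\le p\le\infty$, let $\mathcal{M}$ be a closed (weak-star closed if $p=\infty$) subspace of $L^p(d\sigma)$, and let $\tilde{\mathcal{M}}=\mathrm{clos}_p\left[\bigcup_{\lambda\ge 0}\chi_\lambda\mathcal{M}\right]$. If $\tilde{\mathcal{M}}_-\subsetneq\tilde{\mathcal{M}}$ and, for a fixed inner function $I$, $\chi_\lambda I\mathcal{M}\subseteq\mathcal{M}$ for each $\lambda\ge 0$, then $$I\varphi H^p(d\sigma)\subseteq\mathcal{M}\subseteq\varphi H^p(d\sigma),$$ where $\varphi$ is measurable on $K$ and $|\varphi|=1$ $\sigma$-almost everywhere. When $p=2$, there exists a subspace $W\subseteq H^2(d\sigma)$ such that $\mathcal{M}=\varphi\left(W\oplus IH^2(d\sigma)\right)$.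
   Context: For $\lambda\in\Gamma$, $\chi_\lambda$ is the character of $K$ given by $\chi_\lambda(x)=x(\lambda)$. The order on $\Gamma$ is given by a semigroup $\Gamma_+\subseteq\Gamma$ such that $\Gamma$ is the disjoint union $\Gamma_+\cup\{0\}\cup\Gamma_-$ with $\Gamma_-=-\Gamma_+$; $\lambda>0$ means $\lambda\in\Gamma_+$, $\lambda\ge0$ means $\lambda\in\Gamma_+\cup\{0\}$, $\lambda<0$ means $\lambda\in\Gamma_-$. The Fourier coefficients of $f\in L^1(d\sigma)$ are $a_\lambda(f)=\int_K f\,\overline{\chi_\lambda}\,d\sigma$. $H^p(d\sigma)$ is the space of analytic functions in $L^p(d\sigma)$, i.e. those $f\in L^p(d\sigma)$ with $a_\lambda(f)=0$ for all $\lambda<0$. An inner function is a function $I\in H^\infty(d\sigma)$ with $|I|=1$ $\sigma$-a.e. $[\,\cdot\,]$ denotes linear span, and $\mathrm{clos}_p$ denotes closure in the $L^p$ norm (weak-star closure when $p=\infty$). For a subspace $\mathcal{N}$ of $L^p(d\sigma)$, $\mathcal{N}_-=\mathrm{clos}_p\left[\bigcup_{\lambda>0}\chi_\lambda\mathcal{N}\right]$. The symbol $\oplus$ denotes orthogonal direct sum in $L^2(d\sigma)$. *)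

(* Defs.v *)
From HB Require Import structures.
From mathcomp Require Import all_boot all_order all_algebra.
From mathcomp Require Import all_classical all_reals all_analysis.
From mathcomp Require Import complex.

Set Implicit Arguments.
Unset Strict Implicit.
Unset Printing Implicit Defensive.

Import Order.TTheory GRing.Theory Num.Theory.
Import numFieldTopology.Exports numFieldNormedType.Exports.

Local Open Scope classical_set_scope.
Local Open Scope ring_scope.

Section dual_group.
Variables (R : realType) (G : zmodType).

(* Homomorphisms from the discrete group [G] to the unit circle. *)
Definition is_character (x : G -> R[i]) :=
  (forall l, `|x l| = 1) /\ (forall l m, x (l + m) = x l * x m).

Definition dual : Type :=
  set_type [set x : {ptws G -> R[i]^o} | is_character x].

(* The topology of [dual] is that of pointwise convergence on [G]. *)
HB.instance Definition _ := Topological.on dual.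

Definition dual_fun (x : dual) : G -> R[i] := set_val x.

Lemma dual_funP (x : dual) : is_character (dual_fun x).
Proof. by have := set_valP x. Qed.

Lemma dual_inj (x y : dual) : dual_fun x =1 dual_fun y -> x = y.
Proof. by move=> xy; apply: val_inj; apply/funext => l; exact: xy. Qed.

Definition to_dual (x : G -> R[i]) (xP : is_character x) : dual :=
  SigSub (mem_set xP : x \in [set x : {ptws G -> R[i]^o} | is_character x]).

Lemma to_dualE x (xP : is_character x) : dual_fun (to_dual xP) = x.
Proof. by []. Qed.


Lemma dual0P : is_character (fun _ : G => 1 : R[i]).
Proof. by split=> *; rewrite ?normr1 ?mulr1. Qed.

Lemma dual_oppP (x : dual) : is_character (fun l => (dual_fun x l)^-1).
Proof.
have [x1 xD] := dual_funP x.
by split=> [l|l m]; rewrite ?normfV ?x1 ?invr1// xD invfM.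
Qed.

Lemma dual_addP (x y : dual) :
  is_character (fun l => dual_fun x l * dual_fun y l).
Proof.
have [x1 xD] := dual_funP x; have [y1 yD] := dual_funP y.
by split=> [l|l m]; rewrite ?normrM ?x1 ?y1 ?mulr1// xD yD mulrACA.
Qed.

(* The dual group is written additively: [x + y] is the pointwise product. *)
Definition dual0 := to_dual dual0P.
Definition dual_opp x := to_dual (dual_oppP x).
Definition dual_add x y := to_dual (dual_addP x y).

Lemma dual_addA : associative dual_add.
Proof. by move=> x y z; apply: dual_inj => l; rewrite !to_dualE mulrA. Qed.

Lemma dual_addC : commutative dual_add.
Proof. by move=> x y; apply: dual_inj => l; rewrite !to_dualE mulrC. Qed.

Lemma dual_add0 : left_id dual0 dual_add.
Proof. by move=> x; apply: dual_inj => l; rewrite !to_dualE mul1r. Qed.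

Lemma dual_addN : left_inverse dual0 dual_opp dual_add.
Proof.
move=> x; apply: dual_inj => l; rewrite !to_dualE mulVf//.
by rewrite -normr_eq0 (dual_funP x).1 oner_eq0.
Qed.

HB.instance Definition _ :=
  GRing.isZmodule.Build dual dual_addA dual_addC dual_add0 dual_addN.
HB.instance Definition _ := isPointed.Build dual dual0.

Definition chi (l : G) (x : dual) : R[i] := dual_fun x l.

Lemma chi_norm l x : `|chi l x| = 1.
Proof. exact: (dual_funP x).1. Qed.

Lemma chiDl l m x : chi (l + m) x = chi l x * chi m x.
Proof. exact: (dual_funP x).2. Qed.

Lemma chiDr l x y : chi l (x + y) = chi l x * chi l y.
Proof. by []. Qed.

Lemma chiN l x : chi l (- x) = (chi l x)^-1.
Proof. by []. Qed.

Lemma chi_continuous l : continuous (chi l : dual -> R[i]^o).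
Proof.
move=> x; apply: (@continuous_comp dual {ptws G -> R[i]^o} R[i]^o
  (@dual_fun : dual -> {ptws G -> R[i]^o}) (fun f => f l)).
  exact: initial_continuous.
exact: proj_continuous.
Qed.

Lemma dual_cvg (F : set_system dual) (x : dual) : Filter F ->
  (forall l, chi l @ F --> (chi l x : R[i]^o)) -> F --> x.
Proof.
move=> FF cF.
have cvgF : (@dual_fun @ F : set_system {ptws G -> R[i]^o}) -->
    (dual_fun x : {ptws G -> R[i]^o}).
  apply/cvg_sup => l A [B [[C oC <-]] Cx] /filterS; apply.
  by apply: cF; exact: open_nbhs_nbhs.
move=> A [B [[C oC <-]] Cx] /filterS; apply.
by apply: cvgF; exact: open_nbhs_nbhs.
Qed.

Lemma dual_sub_continuous : continuous (fun x : dual * dual => x.1 - x.2).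
Proof.
move=> -[x y]; apply: dual_cvg => l.
have cx : (chi l \o fst) @ nbhs (x, y) --> (chi l x : R[i]^o).
  by apply: cvg_comp; [exact: cvg_fst|exact: chi_continuous].
have cy : (chi l \o snd) @ nbhs (x, y) --> (chi l y : R[i]^o).
  by apply: cvg_comp; [exact: cvg_snd|exact: chi_continuous].
have y0 : chi l y != 0 by rewrite -normr_eq0 chi_norm oner_eq0.
exact: (@cvgM R[i] _ _ _ _ _ _ _ cx (@cvgV R[i] _ _ _ _ _ y0 cy)).
Qed.

HB.instance Definition _ :=
  PreTopologicalNmodule_isTopologicalZmodule.Build dual dual_sub_continuous.


Lemma dual_hausdorff : hausdorff_space dual.
Proof.
move=> x y /= xy; apply: dual_inj => l.
apply: (@norm_hausdorff R[i] R[i]^o) => A B Ax By.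
have [z [Az Bz]] := xy _ _ (chi_continuous Ax) (chi_continuous By).
by exists (chi l z).
Qed.

Definition unit_square : set R[i]^o :=
  [set z | `|complex.Re z| <= 1 /\ `|complex.Im z| <= 1].

Lemma compact_unit_square : compact unit_square.
Proof.
pose f (z : R * R) : R[i]^o := Complex z.1 z.2.
have fc : continuous f.
  move=> z; apply/(@cvgrPdist_lt R[i] R[i]^o) => -[e e'].
  rewrite ltcE/= => /andP[/eqP -> e0].
  have e20 : 0 < e / 2 by rewrite divr_gt0.
  near=> w; rewrite normc_def/= ltcR.
  have w1 : `|z.1 - w.1| < e / 2.
    by near: w; apply: (@cvgr_dist_lt R R^o); [exact: cvg_fst|].
  have w2 : `|z.2 - w.2| < e / 2.
    by near: w; apply: (@cvgr_dist_lt R R^o); [exact: cvg_snd|].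
  apply: (@le_lt_trans _ _ (`|z.1 - w.1| + `|z.2 - w.2|)); last first.
    by rewrite (splitr e) ltrD.
  rewrite -[leRHS]ger0_norm ?addr_ge0// -sqrtr_sqr ler_wsqrtr//.
  by rewrite [leRHS]sqrrD !real_normK ?num_real// lerD2r lerDl mulrn_wge0.
have squareE : unit_square = f @` (`[-1, 1] `*` `[-1, 1]).
  apply/seteqP; split=> [[a b]|_ [[a b] + <-]].
    rewrite /unit_square/= !ler_norml => -[ha hb]; exists (a, b) => //.
  by rewrite /unit_square/= !in_itv/= -!ler_norml.
rewrite squareE; apply: continuous_compact; first exact: continuous_subspaceT.
by apply: compact_setX; exact: segment_compact.
Unshelve. all: by end_near. Qed.

Let sqr_norm_le1 (a : R) : (a ^+ 2 <= 1) = (`|a| <= 1).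
Proof. by rewrite -[in RHS](@ler_sqr R) ?nnegrE// real_normK ?num_real// expr1n. Qed.

Lemma dual_compact : compact [set: dual].
Proof.
pose P := {ptws G -> R[i]^o}.
have evc l : continuous (fun f : P => f l) by exact: proj_continuous.
pose T : set P := [set f | forall l, unit_square (f l)].
have cT : compact T by apply: (@tychonoff G (fun=> R[i]^o) (fun=> unit_square)) => _;
  exact: compact_unit_square.
have C0 : closed [set 0 : R[i]^o].
  by apply: compact_closed (@compact_set1 _ _); exact: norm_hausdorff.
pose N : set P := [set f | forall l, `|f l| - 1 = 0].
pose M : set P := [set f | forall l m, f (l + m) - f l * f m = 0].
have cN : closed N.
  rewrite (_ : N = \bigcap_l [set f | `|f l| - 1 = 0]); last first.
    by apply/seteqP; split=> f h l; [move=> _; exact: h|exact: (h l I)].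
  apply: closed_bigI => l _.
  apply: (@closed_comp P R[i]^o (fun f => `|f l| - 1) [set 0]) => //.
  move=> f _; exact: (@cvgB R[i] R[i]^o _ _ _ _ _ _ _
    (@cvg_norm R[i] R[i]^o _ _ _ _ _ (evc l f)) (@cvg_cst _ _ _ _ _)).
have cM : closed M.
  rewrite (_ : M = \bigcap_l \bigcap_m [set f | f (l + m) - f l * f m = 0]);
    last by apply/seteqP; split=> f h l;
      [move=> _ m _; exact: h|move=> m; exact: (h l I m I)].
  apply: closed_bigI => l _; apply: closed_bigI => m _.
  apply: (@closed_comp P R[i]^o (fun f => f (l + m) - f l * f m) [set 0]) => //.
  move=> f _; exact: (@cvgB R[i] R[i]^o _ _ _ _ _ _ _ (evc (l + m) f)
    (@cvgM R[i] _ _ _ _ _ _ _ (evc l f) (evc m f))).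
have cTNM := compact_closedI (compact_closedI cT cN) cM.
move=> F PF _.
have FT : F [set x : dual | (T `&` N `&` M) (dual_fun x)].
  apply: filterS filterT => x _; have [x1 xD] := dual_funP x.
  split; first split.
  - move=> l; have := x1 l; rewrite normc_def => -[] /(congr1 (fun r => r ^+ 2)).
    rewrite sqr_sqrtr ?addr_ge0 ?sqr_ge0// expr1n => ab.
    by split; rewrite -sqr_norm_le1 -ab ?lerDl ?lerDr sqr_ge0.
  - by move=> l; rewrite x1 subrr.
  - by move=> l m; rewrite xD subrr.
have [f [[[_ fN] fM] Ff]] :=
  cTNM (@dual_fun @ F) (fmap_proper_filter _ _) FT.
have fP : is_character f.
  split=> [l|l m]; first by apply/eqP; rewrite -subr_eq0 fN.
  by apply/eqP; rewrite -subr_eq0 fM.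
exists (to_dual fP); split=> // A B FA [_ [[C oC <-] Cx] CB].
have FA' : F [set x : dual | (@dual_fun @` A) (dual_fun x)].
  by apply: filterS FA => a Aa; exists a.
have [_ [[a Aa <-] Ca]] := Ff _ C FA' (open_nbhs_nbhs (conj oC Cx)).
by exists a; split=> //; exact: CB.
Qed.

End dual_group.

Section lp_spaces.
Variables (R : realType) (G : zmodType).
Local Notation K := (dual R G).
Local Open Scope complex_scope.

Definition borel_dual := g_sigma_algebraType (@open K).

(* [P] is the set of positive elements. *)
Definition group_order (P : set G) :=
  let N := [set - l | l in P] in
  [/\ forall l m, P l -> P m -> P (l + m),
      P `|` [set 0] `|` N = setT,
      P `&` [set 0] = set0, P `&` N = set0 & [set 0] `&` N = set0].

Variable sigma : probability borel_dual R.

(* Normalized Haar measure: the translation-invariant Radon probability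
   measure on the Borel sets of the compact group [K]. *)
Definition is_haar :=
  [/\ forall (x : K) (A : set borel_dual), measurable A ->
        sigma [set x + y | y in (A : set K)] = sigma A,
      forall A : set borel_dual, measurable A ->
        sigma A = ereal_inf [set sigma U | U in [set U : set K |
                                                  open U /\ A `<=` U]]
    & forall U : set K, open U ->
        sigma U = ereal_sup [set sigma C | C in [set C : set K |
                                                  compact C /\ C `<=` U]]].

(* Measurable functions are not identified when they agree almost everywhere:
   a subspace of L^p is represented by a set of functions, and [mulset], [clos]
   and [Lp] are all stable under a.e. equality of measurable functions. *)
Implicit Types (f g h phi : K -> R[i]) (A B M N W : set (K -> R[i])).
Implicit Types (p : \bar R) (P : set G).

Definition cmeasurable f :=
  measurable_fun [set: borel_dual] (fun x => complex.Re (f x)) /\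
  measurable_fun [set: borel_dual] (fun x => complex.Im (f x)).

Definition cintegral f : R[i] :=
  Complex (\int[sigma]_(x in setT) complex.Re (f x))
          (\int[sigma]_(x in setT) complex.Im (f x)).

Definition pnorm p f : \bar R :=
  Lnorm sigma p (fun x => (Normc.normc (f x))%:E).

Definition Lp p : set (K -> R[i]) :=
  [set f | cmeasurable f /\ (pnorm p f < +oo)%E].

Definition fourier f (l : G) : R[i] :=
  cintegral (fun x => f x * (chi l x)^*).

Definition Hp P p : set (K -> R[i]) :=
  [set f | Lp p f /\ forall l, P (- l) -> fourier f l = 0].

Definition unimodular f := \forall x \ae sigma, `|f x| = 1.

Definition inner_function P f := Hp P +oo f /\ unimodular f.

Definition subspace A :=
  A 0 /\ forall (a : R[i]) f g, A f -> A g -> A (fun x => a * f x + g x).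

Definition span A : set (K -> R[i]) := smallest subspace A.

Definition norm_closure p A : set (K -> R[i]) :=
  [set f | Lp p f /\ forall e : R, 0 < e ->
    exists2 g, A g & (pnorm p (fun x => (f x - g x)%R) < e%:E)%E].

(* closure for the topology sigma(L^oo, L^1) *)
Definition weak_star_closure A : set (K -> R[i]) :=
  [set f | Lp +oo f /\
    forall (n : nat) (h : 'I_n -> K -> R[i]) (e : R),
      (forall i, Lp 1 (h i)) -> 0 < e ->
      exists2 g, A g & forall i,
        Normc.normc (cintegral (fun x => (f x - g x) * h i x)) < e].

Definition clos p A :=
  if p == +oo%E then weak_star_closure A else norm_closure p A.

Definition closed_subspace p M :=
  [/\ M `<=` Lp p, subspace M & clos p M `<=` M].

Definition mulset phi A : set (K -> R[i]) :=
  [set g | cmeasurable g /\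
    exists2 f, A f & \forall x \ae sigma, g x = phi x * f x].

Definition nonneg P : set G := P `|` [set 0].

Definition tilde P p M := clos p (span (\bigcup_(l in nonneg P) mulset (chi l) M)).

Definition minus P p N := clos p (span (\bigcup_(l in P) mulset (chi l) N)).

Definition orthogonal A B :=
  forall f g, A f -> B g -> cintegral (fun x => f x * (g x)^*) = 0.

Definition sumset A B : set (K -> R[i]) :=
  [set (fun x => f x + g x) | f in A & g in B].

End lp_spaces.

(* Main.v *)
(* Let [N] be the invariant subspace [tilde M]. For [p = 2], an element [phi] of
   [N] orthogonal to [minus N] satisfies [\int |phi|^2 chi l = 0] for all [l > 0],
   so [|phi|] is constant, and after normalization [N = phi H^2]: this is
   Beurling's theorem for the ordered dual of [K]. General [p] reduces to [p = 2]
   through outer functions. For an integrable [a >= 0] there is [h] in [H^oo] with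
   [|h|^2 = 1 / (1 + a)] and [\|h - 1\|_2^2 <= \int a]; taking [a] to be a small
   multiple of [|f|], multiplication by such [h] makes [f] bounded without leaving
   [N] and while staying close to [f], so that the bounded functions of [N] are
   dense in it, and likewise they are closed under bounded [L^2] limits.
   Finally [I N] is contained in [M], by density of the span of the
   [chi l M], which gives [I phi H^p <= M <= N = phi H^p]; for [p = 2] the space
   [W] is the orthogonal complement of [I H^2] in [M / phi]. *)
From mathcomp Require Import all_boot all_order all_algebra.
From mathcomp Require Import all_classical all_reals all_analysis.
From mathcomp Require Import measurable_realfun ess_sup_inf complex ring lra.
Require Import Defs.

Set Implicit Arguments.
Unset Strict Implicit.
Unset Printing Implicit Defensive.

Import Order.TTheory GRing.Theory Num.Theory.
Import numFieldTopology.Exports numFieldNormedType.Exports.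

Local Open Scope classical_set_scope.
Local Open Scope ring_scope.
Local Open Scope complex_scope.

(** All approximation is by multipliers that are uniformly bounded and small in [L^2]: applied to a
    fixed function of [L^p], they are small in norm for finite [p] and against every [L^1] test
    function for [p = +oo]. One argument thus serves both kinds of closure. This constraint shapes
    the rest. For [H^oo] to act on [N], an analytic function must be approximated by analytic
    polynomials that keep its bound, so positive kernels are required; they are normalized powers of
    products of [|1 + chi l| ^+ 2 / 4], and with the regularity of [sigma] they also give uniqueness
    of Fourier coefficients. In the reduction to [p = 2], the [L^2] approximants of a bounded
    function have no common bound; multiplying by an outer function built from the error itself
    restores one. These outer functions come from the case [p = 2] of Beurling's theorem, and the
    estimate on [h - 1] comes from the mean of [h] having modulus at least
    [1 / \int (1 + a) ^ (1/2)]. *)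

Local Notation nrm := Normc.normc.

(** * Modulus and conjugation of complex numbers *)

Section ComplexNumbers.
Variable R : realType.
Implicit Types z w : R[i].

Lemma nrmE z : `|z| = (nrm z)%:C.
Proof. by []. Qed.

Lemma norm1P z : `|z| = 1 <-> nrm z = 1.
Proof. by rewrite nrmE; split=> [/complexI|->]. Qed.

Lemma nrm_ge0 z : 0 <= nrm z.
Proof. by case: z => a b; exact: sqrtr_ge0. Qed.

Lemma sqr_nrm z : nrm z ^+ 2 = complex.Re z ^+ 2 + complex.Im z ^+ 2.
Proof. by case: z => a b; rewrite /= sqr_sqrtr// addr_ge0// sqr_ge0. Qed.

Lemma nrm_conj z : nrm z^* = nrm z.
Proof. by case: z => a b /=; rewrite sqrrN. Qed.

Lemma nrm_real (r : R) : nrm r%:C = `|r|.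
Proof. by rewrite /= expr0n/= addr0 sqrtr_sqr. Qed.

Lemma nrm_eq0 z : (nrm z == 0) = (z == 0).
Proof.
by apply/eqP/eqP => [|->]; [exact: Normc.eq0_normc|exact: Normc.normc0].
Qed.

Lemma nrmBC z w : nrm (z - w) = nrm (w - z).
Proof. by rewrite -normcN opprB. Qed.

Lemma mulcJ z : z * z^* = (nrm z ^+ 2)%:C.
Proof. by rewrite sqr_nrm; case: z => a b; simpc; congr Complex; ring. Qed.

Lemma conjc_unit z : nrm z = 1 -> z^* = z^-1.
Proof.
move=> z1; have z0 : z != 0 by rewrite -nrm_eq0 z1 oner_eq0.
by apply: (mulfI z0); rewrite mulcJ z1 expr1n divff.
Qed.

Lemma Re_le_nrm z : `|complex.Re z| <= nrm z.
Proof.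
by rewrite -ler_sqr ?nnegrE ?nrm_ge0// sqr_nrm real_normK ?num_real// lerDl sqr_ge0.
Qed.

Lemma Im_le_nrm z : `|complex.Im z| <= nrm z.
Proof.
by rewrite -ler_sqr ?nnegrE ?nrm_ge0// sqr_nrm real_normK ?num_real// lerDr sqr_ge0.
Qed.

Lemma ReD z w : complex.Re (z + w) = complex.Re z + complex.Re w.
Proof. by case: z w => [a b] []. Qed.
Lemma ImD z w : complex.Im (z + w) = complex.Im z + complex.Im w.
Proof. by case: z w => [a b] []. Qed.
Lemma ReN z : complex.Re (- z) = - complex.Re z. Proof. by case: z. Qed.
Lemma ImN z : complex.Im (- z) = - complex.Im z. Proof. by case: z. Qed.
Lemma ReM z w :
  complex.Re (z * w) = complex.Re z * complex.Re w - complex.Im z * complex.Im w.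
Proof. by case: z w => [a b] []. Qed.
Lemma ImM z w :
  complex.Im (z * w) = complex.Re z * complex.Im w + complex.Im z * complex.Re w.
Proof. by case: z w => [a b] []. Qed.
Lemma ReJ z : complex.Re z^* = complex.Re z. Proof. by case: z. Qed.
Lemma ImJ z : complex.Im z^* = - complex.Im z. Proof. by case: z. Qed.

Lemma sqr_nrmD_le z w : nrm (z + w) ^+ 2 <= 2 * nrm z ^+ 2 + 2 * nrm w ^+ 2.
Proof.
rewrite !sqr_nrm ReD ImD.
have := sqr_ge0 (complex.Re z - complex.Re w).
have := sqr_ge0 (complex.Im z - complex.Im w); nra.
Qed.

(** A crude arithmetic-geometric inequality: it serves only to see that a product of two
    square-integrable functions is integrable. *)
Lemma nrm_mul_le z w : nrm (z * w) <= nrm z ^+ 2 + nrm w ^+ 2.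
Proof.
rewrite Normc.normcM; have := nrm_ge0 z; have := nrm_ge0 w; nra.
Qed.

End ComplexNumbers.

(** * Real-valued integrals against the probability [sigma] *)

Section Calculus.
Variables (R : realType) (G : zmodType).
Variable sigma : probability (borel_dual R G) R.
Local Notation K := (dual R G).
Local Notation B := (borel_dual R G).
Implicit Types (f g h : K -> R[i]) (u v : K -> R).

#[global] Instance ae_filter : Filter (nbhs (almost_everywhere sigma)).
Proof. exact: ae_filter_ringOfSetsType. Qed.

Definition rmeas u := measurable_fun [set: B] (u : B -> R).

Definition rint u := sigma.-integrable [set: B] (EFin \o (u : B -> R)).

Definition expect u : R := \int[sigma]_(x in [set: B]) u x.

Definition integ f := cmeasurable f /\ rint (fun x => nrm (f x)).

Lemma rmeas_cst (r : R) : rmeas (fun=> r).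
Proof. exact: measurable_cst. Qed.

Lemma rmeasD u v : rmeas u -> rmeas v -> rmeas (fun x => u x + v x).
Proof. exact: measurable_funD. Qed.

Lemma rmeasM u v : rmeas u -> rmeas v -> rmeas (fun x => u x * v x).
Proof. exact: measurable_funM. Qed.

Lemma rmeasN u : rmeas u -> rmeas (fun x => - u x).
Proof. exact: measurable_funN. Qed.

Lemma rmeasB u v : rmeas u -> rmeas v -> rmeas (fun x => u x - v x).
Proof. exact: measurable_funB. Qed.

Lemma rmeas_sqrt u : rmeas u -> rmeas (fun x => Num.sqrt (u x)).
Proof.
move=> mu; apply: (@measurableT_comp _ _ _ _ _ _ (@Num.sqrt R)) => //.
exact: continuous_measurable_fun (@sqrt_continuous R).
Qed.

Lemma rmeasX u n : rmeas u -> rmeas (fun x => u x ^+ n).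
Proof. by move=> mu; exact: measurable_funX. Qed.

Lemma rmeasV u : (forall x, u x != 0) -> rmeas u -> rmeas (fun x => (u x)^-1).
Proof.
move=> u0 mu.
have mV : measurable_fun [set y : R | y != 0] (@GRing.inv R).
  apply: open_continuous_measurable_fun; first exact: open_neq.
  by move=> x; rewrite inE => x0; exact: inv_continuous.
apply: (measurable_comp _ _ mV mu); last by move=> _ [x _ <-] /=; exact: u0.
by apply: open_measurable; exact: open_neq.
Qed.

Lemma cmeas_cst (c : R[i]) : cmeasurable (fun _ : K => c).
Proof. by split; exact: rmeas_cst. Qed.

Lemma cmeas_eq f g : f =1 g -> cmeasurable f -> cmeasurable g.
Proof. by move=> /funext ->. Qed.

Lemma cmeasD f g : cmeasurable f -> cmeasurable g ->
  cmeasurable (fun x => f x + g x).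
Proof.
move=> [f1 f2] [g1 g2]; split.
  by under eq_fun do rewrite ReD; exact: rmeasD.
by under eq_fun do rewrite ImD; exact: rmeasD.
Qed.

Lemma cmeasM f g : cmeasurable f -> cmeasurable g ->
  cmeasurable (fun x => f x * g x).
Proof.
move=> [f1 f2] [g1 g2]; split.
  by under eq_fun do rewrite ReM; apply: rmeasB; exact: rmeasM.
by under eq_fun do rewrite ImM; apply: rmeasD; exact: rmeasM.
Qed.

Lemma cmeasZ (a : R[i]) f : cmeasurable f -> cmeasurable (fun x => a * f x).
Proof. by move=> mf; apply: cmeasM => //; exact: cmeas_cst. Qed.

Lemma cmeasN f : cmeasurable f -> cmeasurable (fun x => - f x).
Proof.
move=> mf; apply: cmeas_eq (cmeasZ (-1) mf) => x; by rewrite mulN1r.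
Qed.

Lemma cmeasB f g : cmeasurable f -> cmeasurable g ->
  cmeasurable (fun x => f x - g x).
Proof. by move=> mf mg; apply: cmeasD => //; exact: cmeasN. Qed.

Lemma cmeasJ f : cmeasurable f -> cmeasurable (fun x => (f x)^*).
Proof.
move=> [f1 f2]; split; first by under eq_fun do rewrite ReJ.
by under eq_fun do rewrite ImJ; exact: rmeasN.
Qed.

Lemma cmeas_real u : rmeas u -> cmeasurable (fun x => (u x)%:C).
Proof. by move=> mu; split => //=; exact: rmeas_cst. Qed.

Lemma rmeas_nrm f : cmeasurable f -> rmeas (fun x => nrm (f x)).
Proof.
move=> [f1 f2].
rewrite (_ : (fun x => _) =
   fun x => Num.sqrt (complex.Re (f x) ^+ 2 + complex.Im (f x) ^+ 2)).
  by apply: rmeas_sqrt; apply: rmeasD; exact: rmeasX.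
by apply/funext => x; case: (f x).
Qed.

Lemma rmeas_nrm2 f : cmeasurable f -> rmeas (fun x => nrm (f x) ^+ 2).
Proof. by move=> /rmeas_nrm; exact: rmeasX. Qed.

Lemma rint_meas u : rint u -> rmeas u.
Proof. by move=> /measurable_int /measurable_EFinP. Qed.

Lemma rint_le u v : rmeas u -> (forall x, `|u x| <= v x) -> rint v -> rint u.
Proof.
move=> mu uv; apply: le_integrable => //; first exact/measurable_EFinP.
by move=> x _ /=; rewrite lee_fin (le_trans (uv x))// ler_norm.
Qed.

Lemma rint_cst (r : R) : rint (fun=> r).
Proof. exact: finite_measure_integrable_cst. Qed.

Lemma rint_bounded u (M : R) : rmeas u -> (forall x, `|u x| <= M) -> rint u.
Proof. by move=> mu uM; apply: rint_le (rint_cst M). Qed.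

Lemma rintD u v : rint u -> rint v -> rint (fun x => u x + v x).
Proof. by move=> iu iv; exact: (integrableD _ iu iv). Qed.

Lemma rintZ (r : R) u : rint u -> rint (fun x => r * u x).
Proof. by move=> iu; exact: (integrableZl _ _ iu). Qed.

Lemma rintN u : rint u -> rint (fun x => - u x).
Proof. by move/(rintZ (-1)); under eq_fun do rewrite mulN1r. Qed.

Lemma rintB u v : rint u -> rint v -> rint (fun x => u x - v x).
Proof. by move=> iu iv; apply: rintD => //; exact: rintN. Qed.

Lemma rint_norm u : rint u -> rint (fun x => `|u x|).
Proof. exact: integrable_norm. Qed.

Lemma expectD u v : rint u -> rint v ->
  expect (fun x => u x + v x) = expect u + expect v.
Proof. by move=> iu iv; exact: RintegralD. Qed.

Lemma expectB u v : rint u -> rint v ->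
  expect (fun x => u x - v x) = expect u - expect v.
Proof. by move=> iu iv; exact: RintegralB. Qed.

Lemma expectZ (r : R) u : rint u -> expect (fun x => r * u x) = r * expect u.
Proof. by move=> iu; exact: RintegralZl. Qed.

Lemma expect_cst (r : R) : expect (fun=> r) = r.
Proof.
rewrite /expect Rintegral_cst//= -[RHS]mulr1; congr (_ * _).
by rewrite (_ : sigma _ = 1%E)//; exact: probability_setT.
Qed.

Lemma expectN u : rint u -> expect (fun x => - u x) = - expect u.
Proof.
move=> iu; rewrite -mulN1r -expectZ//; congr expect; apply/funext => x.
by rewrite mulN1r.
Qed.

Lemma le_expect u v : rint u -> rint v -> (forall x, u x <= v x) ->
  expect u <= expect v.
Proof. by move=> iu iv uv; apply: le_Rintegral. Qed.

Lemma expect_ge0 u : (forall x, 0 <= u x) -> 0 <= expect u.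
Proof. by move=> u0; apply: Rintegral_ge0. Qed.

Lemma eq_expect u v : u =1 v -> expect u = expect v.
Proof. by move=> /funext ->. Qed.

Lemma ae_expect u v : rmeas u -> rmeas v -> (\forall x \ae sigma, u x = v x) ->
  expect u = expect v.
Proof.
move=> mu mv uv; rewrite /expect /Rintegral; congr fine.
apply: ae_eq_integral => //; [exact/measurable_EFinP|exact/measurable_EFinP|].
by apply: filterS uv => x -> _.
Qed.

Lemma ae_rint u v : rmeas v -> (\forall x \ae sigma, u x = v x) ->
  rint u -> rint v.
Proof.
move=> mv uv iu; have mu := rint_meas iu.
have [_ fu] := integrableP _ _ _ iu.
apply/integrableP; split; first exact/measurable_EFinP.
rewrite (_ : integral _ _ _ = \int[sigma]_(x in [set: B]) `|(EFin \o (u : B -> R)) x|)%E//.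
apply: ae_eq_integral => //; try by do 2 apply: measurableT_comp => //.
by apply: filterS uv => x /= -> _.
Qed.

(** The clipping of [u] between [- |v|] and [|v|] agrees with [u] almost everywhere and is dominated
    at every point, so the everywhere version applies to it. *)
Lemma ae_le_rint u v : rmeas u -> (\forall x \ae sigma, `|u x| <= v x) ->
  rint v -> rint u.
Proof.
move=> mu uv iv; have mv := rint_meas iv.
apply: (@ae_rint (fun x => Num.max (- `|v x|) (Num.min (u x) `|v x|))) => //.
  apply: filterS uv => x /(le_trans)/(_ (ler_norm _)).
  by rewrite ler_norml => /andP[h1 h2]; rewrite min_l// max_r.
apply: rint_le (rint_norm iv); last first.
  move=> x; rewrite ler_norml; apply/andP; split; first by rewrite le_max lexx.
  rewrite ge_max ge_min lexx orbT andbT.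
  by rewrite (@le_trans _ _ 0)// oppr_le0.
apply: measurable_maxr; first by apply: rmeasN; exact: measurableT_comp.
by apply: measurable_minr => //; exact: measurableT_comp.
Qed.

Lemma ae_le_expect u v : rint u -> rint v -> (\forall x \ae sigma, u x <= v x) ->
  expect u <= expect v.
Proof.
move=> iu iv uv; have mu := rint_meas iu; have mv := rint_meas iv.
have mm : rmeas (fun x => Num.min (u x) (v x)) by exact: measurable_minr.
have e : \forall x \ae sigma, u x = Num.min (u x) (v x).
  by apply: filterS uv => x uvx; rewrite min_l.
rewrite (ae_expect mu mm e); apply: le_expect => //.
  exact: ae_rint e iu.
by move=> x; rewrite ge_min lexx orbT.
Qed.

End Calculus.

(** * Integrals of complex-valued functions *)

Section ComplexIntegral.
Variables (R : realType) (G : zmodType).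
Variable sigma : probability (borel_dual R G) R.
Local Notation K := (dual R G).
Local Notation B := (borel_dual R G).
Local Notation rint := (rint sigma).
Local Notation expect := (expect sigma).
Local Notation integ := (integ sigma).
Local Notation cint := (cintegral sigma).
Implicit Types (f g h : K -> R[i]) (u v : K -> R).

Lemma integ_le f v : cmeasurable f -> rint v -> (forall x, nrm (f x) <= v x) ->
  integ f.
Proof.
move=> mf iv fv; split=> //; apply: rint_le iv; first exact: rmeas_nrm.
by move=> x; rewrite ger0_norm ?nrm_ge0.
Qed.

Lemma integ_Re f : integ f -> rint (fun x => complex.Re (f x)).
Proof.
by move=> [mf fi]; apply: rint_le fi => [|x]; [exact: mf.1|exact: Re_le_nrm].
Qed.

Lemma integ_Im f : integ f -> rint (fun x => complex.Im (f x)).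
Proof.
by move=> [mf fi]; apply: rint_le fi => [|x]; [exact: mf.2|exact: Im_le_nrm].
Qed.

Lemma integD f g : integ f -> integ g -> integ (fun x => f x + g x).
Proof.
move=> [mf fi] [mg gi]; apply: integ_le (rintD fi gi) _; first exact: cmeasD.
by move=> x; exact: le_normcD.
Qed.

Lemma integZ (a : R[i]) f : integ f -> integ (fun x => a * f x).
Proof.
move=> [mf fi]; apply: integ_le (rintZ (nrm a) fi) _; first exact: cmeasZ.
by move=> x; rewrite Normc.normcM.
Qed.

Lemma integN f : integ f -> integ (fun x => - f x).
Proof. by move=> /(integZ (-1)); under eq_fun do rewrite mulN1r. Qed.

Lemma integB f g : integ f -> integ g -> integ (fun x => f x - g x).
Proof. by move=> fi gi; apply: integD => //; exact: integN. Qed.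

Lemma integ_bounded f (M : R) : cmeasurable f -> (forall x, nrm (f x) <= M) ->
  integ f.
Proof. by move=> mf; apply: integ_le => //; exact: rint_cst. Qed.

Lemma integ_cst (c : R[i]) : integ (fun=> c).
Proof. by apply: (@integ_bounded _ (nrm c)) => //; exact: cmeas_cst. Qed.

Lemma integM_bounded f g (M : R) : integ f -> cmeasurable g ->
  (forall x, nrm (g x) <= M) -> integ (fun x => f x * g x).
Proof.
move=> [mf fi] mg gM; apply: integ_le (rintZ M fi) _; first exact: cmeasM.
by move=> x; rewrite Normc.normcM mulrC ler_wpM2r ?nrm_ge0.
Qed.

Lemma integ_real u : rint u -> integ (fun x => (u x)%:C).
Proof.
move=> iu; apply: integ_le (rint_norm iu) _.
  exact: cmeas_real (rint_meas iu).
by move=> x; rewrite nrm_real.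
Qed.

Lemma integ_sum (I : Type) (s : seq I) (F : I -> K -> R[i]) :
  (forall i, integ (F i)) -> integ (fun x => \sum_(i <- s) F i x).
Proof.
move=> iF; elim: s => [|i s ih].
  by under eq_fun do rewrite big_nil; exact: integ_cst.
by under eq_fun do rewrite big_cons; exact: integD.
Qed.

Lemma eq_cint f g : f =1 g -> cint f = cint g.
Proof. by move=> /funext ->. Qed.

Lemma ae_cint f g : cmeasurable f -> cmeasurable g ->
  (\forall x \ae sigma, f x = g x) -> cint f = cint g.
Proof.
move=> [f1 f2] [g1 g2] fg; congr Complex.
  by apply: ae_expect => //; apply: filterS fg => x ->.
by apply: ae_expect => //; apply: filterS fg => x ->.
Qed.

Lemma cintD f g : integ f -> integ g ->
  cint (fun x => f x + g x) = cint f + cint g.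
Proof.
move=> fi gi; rewrite /cintegral; simpc; congr Complex.
  under [LHS]eq_Rintegral do rewrite ReD.
  by apply: expectD; exact: integ_Re.
under [LHS]eq_Rintegral do rewrite ImD.
by apply: expectD; exact: integ_Im.
Qed.

Lemma cintZ (a : R[i]) f : integ f -> cint (fun x => a * f x) = a * cint f.
Proof.
move=> fi; have iR := integ_Re fi; have iI := integ_Im fi.
rewrite /cintegral; case: a => a b; simpc; congr Complex.
  under [LHS]eq_Rintegral do rewrite ReM.
  rewrite -(expectZ a iR) -(expectZ b iI) -expectB //; exact: rintZ.
under [LHS]eq_Rintegral do rewrite ImM.
rewrite -(expectZ b iR) -(expectZ a iI) -expectD //; exact: rintZ.
Qed.

Lemma cintN f : integ f -> cint (fun x => - f x) = - cint f.
Proof.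
by move=> fi; rewrite -mulN1r -cintZ//; apply: eq_cint => x; rewrite mulN1r.
Qed.

Lemma cintB f g : integ f -> integ g ->
  cint (fun x => f x - g x) = cint f - cint g.
Proof. by move=> fi gi; rewrite cintD ?cintN//; exact: integN. Qed.

Lemma cintJ f : integ f -> cint (fun x => (f x)^*) = (cint f)^*.
Proof.
move=> fi; rewrite /cintegral; simpc; congr Complex.
  by apply: eq_Rintegral => x _; rewrite ReJ.
under [LHS]eq_Rintegral do rewrite ImJ.
by apply: expectN; exact: integ_Im.
Qed.

Lemma cint_real u : cint (fun x => (u x)%:C) = (expect u)%:C.
Proof. by congr Complex; exact: expect_cst. Qed.

Lemma cint_cst (c : R[i]) : cint (fun=> c) = c.
Proof. by case: c => a b; congr Complex; exact: expect_cst. Qed.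

Lemma cint_sum (I : Type) (s : seq I) (F : I -> K -> R[i]) :
  (forall i, integ (F i)) ->
  cint (fun x => \sum_(i <- s) F i x) = \sum_(i <- s) cint (F i).
Proof.
move=> iF; elim: s => [|i s ih].
  by under eq_cint do rewrite big_nil; rewrite big_nil cint_cst.
under eq_cint do rewrite big_cons.
by rewrite cintD ?ih ?big_cons//; exact: integ_sum.
Qed.

(** Rotation: the unit number [c], conjugate to the direction of the integral, makes the real part
    of [c * cint f] equal to the modulus of [cint f]; it is also the integral of the real part of
    [c * f], which is at most [nrm f] pointwise. *)
Lemma nrm_cint f : integ f -> nrm (cint f) <= expect (fun x => nrm (f x)).
Proof.
move=> fi; have [z0|z0] := eqVneq (cint f) 0.
  by rewrite z0 Normc.normc0; apply: expect_ge0 => x; exact: nrm_ge0.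
set z := cint f in z0 *; set n := nrm z.
have n0 : n != 0 by rewrite nrm_eq0.
pose c : R[i] := z^* * (n^-1)%:C.
have c1 : nrm c = 1.
  rewrite Normc.normcM nrm_conj nrm_real ger0_norm ?invr_ge0 ?nrm_ge0//.
  by rewrite mulfV.
have cz : complex.Re (c * z) = n.
  rewrite /c mulrAC [_ * z]mulrC mulcJ -rmorphM/= expr2 -mulrA mulfV ?mulr1//.
rewrite -cz /z -cintZ//; apply: le_expect.
- by apply: integ_Re; exact: integZ.
- exact: fi.2.
- move=> x; rewrite (le_trans (ler_norm _))// (le_trans (Re_le_nrm _))//.
  by rewrite Normc.normcM c1 mul1r.
Qed.

Lemma cint_ge0_eq0 u : rint u -> (forall x, 0 <= u x) -> expect u = 0 ->
  \forall x \ae sigma, u x = 0.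
Proof.
move=> iu u0 eu; have mu := rint_meas iu.
have /(_ _)/= := ae_eq_integral_abs sigma measurableT (f := EFin \o (u : B -> R)).
move=> /(_ (measurable_int _ iu))[+ _].
have -> : (\int[sigma]_(x in [set: B]) `|(u x)%:E| = 0)%E.
  rewrite -[RHS]/((0 : R)%:E) -eu /expect /Rintegral fineK//.
    by apply: eq_integral => x _; rewrite gee0_abs// lee_fin.
  exact: integrable_fin_num.
by move=> /(_ erefl); apply: filterS => x /(_ Logic.I)[].
Qed.

End ComplexIntegral.

(** * The Hermitian geometry of [L^2] *)

Section SquareIntegrable.
Variables (R : realType) (G : zmodType).
Variable sigma : probability (borel_dual R G) R.
Local Notation K := (dual R G).
Local Notation rint := (rint sigma).
Local Notation expect := (expect sigma).
Local Notation integ := (integ sigma).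
Local Notation cint := (cintegral sigma).
Implicit Types (f g h : K -> R[i]) (u v : K -> R).

Definition sqint f := cmeasurable f /\ rint (fun x => nrm (f x) ^+ 2).

Definition ip f g : R[i] := cint (fun x => f x * (g x)^*).

(** The square of the [L^2] norm. Leaving it squared keeps the estimates polynomial, at the price of
    the factor 2 of [n2D_le] in place of the triangle inequality. *)
Definition n2 f : R := expect (fun x => nrm (f x) ^+ 2).

Lemma sqint_le f v : cmeasurable f -> rint v ->
  (forall x, nrm (f x) ^+ 2 <= v x) -> sqint f.
Proof.
move=> mf iv fv; split=> //; apply: rint_le iv; first exact: rmeas_nrm2.
by move=> x; rewrite ger0_norm ?sqr_ge0.
Qed.

Lemma sqintD f g : sqint f -> sqint g -> sqint (fun x => f x + g x).
Proof.
move=> [mf fi] [mg gi].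
apply: sqint_le (rintD (rintZ 2 fi) (rintZ 2 gi)) _; first exact: cmeasD.
by move=> x; exact: sqr_nrmD_le.
Qed.

Lemma sqintM_bounded f g (M : R) : sqint f -> cmeasurable g ->
  (forall x, nrm (g x) <= M) -> sqint (fun x => g x * f x).
Proof.
move=> [mf fi] mg gM; apply: sqint_le (rintZ (M ^+ 2) fi) _; first exact: cmeasM.
move=> x; rewrite Normc.normcM exprMn ler_wpM2r ?sqr_ge0//.
by rewrite ler_sqr ?nnegrE ?nrm_ge0// (le_trans _ (gM x))// nrm_ge0.
Qed.

Lemma sqintZ (a : R[i]) f : sqint f -> sqint (fun x => a * f x).
Proof.
by move=> fi; apply: (@sqintM_bounded f (fun=> a) (nrm a)) => //; exact: cmeas_cst.
Qed.

Lemma sqintN f : sqint f -> sqint (fun x => - f x).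
Proof. by move=> /(sqintZ (-1)); under eq_fun do rewrite mulN1r. Qed.

Lemma sqintB f g : sqint f -> sqint g -> sqint (fun x => f x - g x).
Proof. by move=> fi gi; apply: sqintD => //; exact: sqintN. Qed.

Lemma sqintJ f : sqint f -> sqint (fun x => (f x)^*).
Proof.
move=> [mf fi]; apply: sqint_le fi _; first exact: cmeasJ.
by move=> x; rewrite nrm_conj.
Qed.

Lemma sqint_bounded f (M : R) : cmeasurable f -> (forall x, nrm (f x) <= M) ->
  sqint f.
Proof.
move=> mf fM; apply: sqint_le (rint_cst sigma (M ^+ 2)) _ => // x.
by rewrite ler_sqr ?nnegrE ?nrm_ge0// (le_trans _ (fM x))// nrm_ge0.
Qed.

Lemma sqint_cst (c : R[i]) : sqint (fun=> c).
Proof. by apply: (@sqint_bounded _ (nrm c)) => //; exact: cmeas_cst. Qed.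

Lemma sqint0 : sqint 0.
Proof. exact: sqint_cst. Qed.

Lemma ae_sqint f g : cmeasurable g -> (\forall x \ae sigma, f x = g x) ->
  sqint f -> sqint g.
Proof.
move=> mg fg [mf fi]; split=> //; apply: ae_rint fi; first exact: rmeas_nrm2.
by apply: filterS fg => x ->.
Qed.

Lemma sqint_ae_le f v : cmeasurable f -> rint v ->
  (\forall x \ae sigma, nrm (f x) ^+ 2 <= v x) -> sqint f.
Proof.
move=> mf iv fv; split=> //; apply: ae_le_rint iv; first exact: rmeas_nrm2.
by apply: filterS fv => x; rewrite ger0_norm ?sqr_ge0.
Qed.

Lemma sqintM_ae_bounded f g (M : R) : sqint f -> cmeasurable g ->
  (\forall x \ae sigma, nrm (g x) <= M) -> sqint (fun x => g x * f x).
Proof.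
move=> [mf fi] mg gM; apply: sqint_ae_le (rintZ (M ^+ 2) fi) _; first exact: cmeasM.
apply: filterS gM => x gM; rewrite Normc.normcM exprMn ler_wpM2r ?sqr_ge0//.
by rewrite ler_sqr ?nnegrE ?nrm_ge0// (le_trans _ gM)// nrm_ge0.
Qed.

Lemma sqint_mul f g : sqint f -> sqint g -> integ (fun x => f x * g x).
Proof.
move=> [mf fi] [mg gi]; apply: integ_le (rintD fi gi) _; first exact: cmeasM.
by move=> x; exact: nrm_mul_le.
Qed.

Lemma sqint_mulJ f g : sqint f -> sqint g -> integ (fun x => f x * (g x)^*).
Proof. by move=> fi gi; apply: sqint_mul => //; exact: sqintJ. Qed.

Lemma sqint_integ f : sqint f -> integ f.
Proof.
move=> fi; have := sqint_mul fi (sqint_cst 1).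
by under eq_fun do rewrite mulr1.
Qed.

Lemma ipDl f g h : sqint f -> sqint g -> sqint h ->
  ip (fun x => f x + g x) h = ip f h + ip g h.
Proof.
move=> fi gi hi; rewrite /ip -cintD; [|exact: sqint_mulJ|exact: sqint_mulJ].
by apply: eq_cint => x; rewrite mulrDl.
Qed.

Lemma ipZl (a : R[i]) f h : sqint f -> sqint h ->
  ip (fun x => a * f x) h = a * ip f h.
Proof.
move=> fi hi; rewrite /ip -cintZ; last exact: sqint_mulJ.
by apply: eq_cint => x; rewrite mulrA.
Qed.

Lemma ipC f g : sqint f -> sqint g -> ip g f = (ip f g)^*.
Proof.
move=> fi gi; rewrite /ip -cintJ; last exact: sqint_mulJ.
by apply: eq_cint => x; rewrite rmorphM/= conjcK mulrC.
Qed.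

Lemma ipff f : ip f f = (n2 f)%:C.
Proof. by rewrite /ip -cint_real; apply: eq_cint => x; rewrite mulcJ. Qed.

Lemma n2_ge0 f : 0 <= n2 f.
Proof. by apply: expect_ge0 => x; exact: sqr_ge0. Qed.

Lemma ipBl f g h : sqint f -> sqint g -> sqint h ->
  ip (fun x => f x - g x) h = ip f h - ip g h.
Proof.
move=> fi gi hi; rewrite ipDl//; last exact: sqintN.
congr (_ + _); rewrite -mulN1r -ipZl//.
by apply: eq_cint => x; rewrite mulN1r.
Qed.

Lemma ipZr (a : R[i]) f h : sqint f -> sqint h ->
  ip h (fun x => a * f x) = a^* * ip h f.
Proof.
move=> fi hi; by rewrite (ipC (sqintZ a fi) hi) ipZl// rmorphM/= (ipC fi hi).
Qed.

Lemma ipBr f g h : sqint f -> sqint g -> sqint h ->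
  ip h (fun x => f x - g x) = ip h f - ip h g.
Proof.
move=> fi gi hi; rewrite (ipC (sqintB fi gi) hi) ipBl// rmorphB/=.
by rewrite (ipC fi hi) (ipC gi hi).
Qed.

Lemma n2_subZ (c : R[i]) f g : sqint f -> sqint g ->
  n2 (fun x => f x - c * g x) =
  n2 f - 2 * complex.Re (c^* * ip f g) + nrm c ^+ 2 * n2 g.
Proof.
move=> fi gi; apply: complexI; have cgi := sqintZ c gi.
rewrite -ipff ipBl ?ipBr ?ipZl ?ipZr//; try exact: sqintB.
rewrite (ipC fi gi) !ipff.
have -> : c * (c^* * (n2 g)%:C) = (nrm c ^+ 2 * n2 g)%:C.
  by rewrite mulrA mulcJ -rmorphM.
case: (ip f g) => p q; case: c {cgi} => a b; simpc.
by congr Complex => /=; ring.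
Qed.

Lemma n2Z (c : R[i]) f : sqint f -> n2 (fun x => c * f x) = nrm c ^+ 2 * n2 f.
Proof.
move=> [_ fi]; rewrite -expectZ//; apply: eq_expect => x.
by rewrite Normc.normcM exprMn.
Qed.

Lemma n2D_le f g : sqint f -> sqint g ->
  n2 (fun x => f x + g x) <= 2 * n2 f + 2 * n2 g.
Proof.
move=> fi gi; rewrite /n2 -!expectZ ?fi.2 ?gi.2// -expectD; last 2 first.
- by apply: rintZ; exact: fi.2.
- by apply: rintZ; exact: gi.2.
apply: le_expect; first exact: (sqintD fi gi).2.
  by apply: rintD; apply: rintZ; [exact: fi.2|exact: gi.2].
by move=> x; exact: sqr_nrmD_le.
Qed.

Lemma n2BC f g : n2 (fun x => f x - g x) = n2 (fun x => g x - f x).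
Proof. by apply: eq_expect => x; rewrite nrmBC. Qed.

Lemma parallelogram f g : sqint f -> sqint g ->
  n2 (fun x => f x + g x) + n2 (fun x => f x - g x) = 2 * n2 f + 2 * n2 g.
Proof.
move=> fi gi; rewrite /n2 -!expectZ ?fi.2 ?gi.2//.
rewrite -expectD ?(sqintD fi gi).2 ?(sqintB fi gi).2//.
rewrite -expectD; last 2 first.
- by apply: rintZ; exact: fi.2.
- by apply: rintZ; exact: gi.2.
by apply: eq_expect => x; rewrite !sqr_nrm !ReD !ImD ReN ImN; ring.
Qed.

Lemma cauchy_schwarz f g : sqint f -> sqint g ->
  nrm (ip f g) ^+ 2 <= n2 f * n2 g.
Proof.
move=> fi gi; set z := ip f g.
have H (t : R) : 0 <= n2 f - 2 * t * nrm z ^+ 2 + t ^+ 2 * nrm z ^+ 2 * n2 g.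
  have := n2_ge0 (fun x => f x - (t%:C * z) * g x).
  rewrite n2_subZ// Normc.normcM nrm_real exprMn real_normK ?num_real//.
  have -> : complex.Re ((t%:C * z)^* * z) = t * nrm z ^+ 2.
    by rewrite sqr_nrm; case: z => p q; simpc; rewrite /=; ring.
  by rewrite !mulrA.
have n0 := n2_ge0 g; have f0 := n2_ge0 f.
have [g0|g0] := eqVneq (n2 g) 0.
  rewrite g0 mulr0 leNgt; apply/negP => z0.
  (* When [n2 g = 0] the quadratic in [t] is affine; this [t] would give it the value
     [- n2 f - 2]. *)
  have := H ((n2 f + 1) / nrm z ^+ 2); rewrite g0 mulr0 addr0.
  by rewrite -mulrA divfK ?gt_eqF//; lra.
have gp : 0 < n2 g by rewrite lt_def g0.
have := H (n2 g)^-1; rewrite exprVn expr2 invfM.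
rewrite [X in _ + X](_ : _ = (n2 g)^-1 * nrm z ^+ 2); last by field.
rewrite -ler_pdivrMr// [_ / n2 g]mulrC; lra.
Qed.

Lemma n2_eq0 f : sqint f -> n2 f = 0 -> \forall x \ae sigma, f x = 0.
Proof.
move=> fi n0; have := cint_ge0_eq0 fi.2 (fun=> sqr_ge0 _) n0.
by apply: filterS => x /eqP; rewrite sqrf_eq0 nrm_eq0 => /eqP.
Qed.

(** Pointwise [2 n <= t + n ^+ 2 / t]. With [t] the square root of [n2 f] this would be
    Cauchy-Schwarz against 1; the free parameter avoids the root and the case [n2 f = 0]. *)
Lemma expect_nrm_le f (t : R) : sqint f -> 0 < t ->
  expect (fun x => nrm (f x)) <= (t + t^-1 * n2 f) / 2.
Proof.
move=> fi t0; rewrite mulrC -[t in t + _](expect_cst sigma) -expectZ ?fi.2//.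
rewrite -expectD; [|exact: rint_cst|exact: rintZ fi.2].
rewrite -expectZ; last by apply: rintD; [exact: rint_cst|exact: rintZ fi.2].
apply: le_expect; first exact: (sqint_integ fi).2.
  by apply: rintZ; apply: rintD; [exact: rint_cst|exact: rintZ fi.2].
move=> x; set n := nrm _; rewrite -subr_ge0.
rewrite (_ : _ - _ = (2 * t)^-1 * (n - t) ^+ 2).
  by rewrite mulr_ge0 ?sqr_ge0// invr_ge0 mulr_ge0 ?ltW.
by field; rewrite gt_eqF.
Qed.

End SquareIntegrable.

(** * [L^p] norms and their comparison *)

Section LpSpaces.
Variables (R : realType) (G : zmodType).
Variable sigma : probability (borel_dual R G) R.
Local Notation K := (dual R G).
Local Notation B := (borel_dual R G).
Local Notation rmeas := (@rmeas R G).
Local Notation rint := (rint sigma).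
Local Notation expect := (expect sigma).
Local Notation integ := (integ sigma).
Local Notation sqint := (sqint sigma).
Local Notation n2 := (n2 sigma).
Local Notation pnorm := (pnorm sigma).
Local Notation Lp := (Lp sigma).
Implicit Types (f g h : K -> R[i]) (u v : K -> R) (p : \bar R).

Lemma sigmaT : sigma [set: B] = 1%E.
Proof. exact: probability_setT. Qed.

Lemma sigmaT_gt0 : (0 < (sigma : {measure set B -> \bar R}) [set: B])%E.
Proof. by rewrite (_ : _ [set: B] = 1%E)//; exact: sigmaT. Qed.

Lemma measurable_nrmE f : cmeasurable f ->
  measurable_fun [set: B] (fun x : B => (nrm (f x))%:E).
Proof. by move=> mf; apply/measurable_EFinP; exact: rmeas_nrm. Qed.

Lemma EFin_expect u : rint u -> (\int[sigma]_(x in [set: B]) (u x)%:E)%E = (expect u)%:E.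
Proof. by move=> iu; rewrite /expect /Rintegral fineK//; exact: integrable_fin_num. Qed.

Lemma rint_lty u : rmeas u -> (forall x, 0 <= u x) ->
  (\int[sigma]_(x in [set: B]) (u x)%:E < +oo)%E -> rint u.
Proof.
move=> mu u0 ui; apply/integrableP; split; first exact/measurable_EFinP.
by under eq_integral do rewrite /= ger0_norm//.
Qed.

Lemma ltey_expect u : rint u -> (\int[sigma]_(x in [set: B]) (u x)%:E < +oo)%E.
Proof. by move=> iu; rewrite EFin_expect// ltry. Qed.

Lemma pnormE (r : R) f :
  pnorm r%:E f = ((\int[sigma]_(x in [set: B]) (nrm (f x) `^ r)%:E) `^ r^-1)%E.
Proof.
rewrite /Defs.pnorm unlock; congr (_ `^ _)%E; apply: eq_integral => x _.
by rewrite /= ger0_norm ?nrm_ge0// poweR_EFin.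
Qed.

Lemma pnorm1E f : pnorm 1 f = (\int[sigma]_(x in [set: B]) (nrm (f x))%:E)%E.
Proof.
rewrite /Defs.pnorm Lnorm1; apply: eq_integral => x _.
by rewrite gee0_abs// lee_fin nrm_ge0.
Qed.

Lemma pnormyE f : pnorm +oo f = ess_sup sigma (fun x : B => (nrm (f x))%:E).
Proof.
rewrite /Defs.pnorm unlock sigmaT_gt0; congr ess_sup.
by apply/funext => x /=; rewrite ger0_norm ?nrm_ge0.
Qed.

Lemma Lp1P f : Lp 1 f <-> integ f.
Proof.
split=> [[mf]|[mf fi]].
  by rewrite pnorm1E => fi; split=> //; apply: rint_lty => //;
    [exact: rmeas_nrm|move=> x; exact: nrm_ge0].
by split=> //; rewrite pnorm1E; exact: ltey_expect.
Qed.

Lemma powRn_rmeas (r : R) f : cmeasurable f -> rmeas (fun x => nrm (f x) `^ r).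
Proof.
by move=> mf; apply: (@measurableT_comp _ _ _ _ _ _ (fun y : R => y `^ r));
  [exact: measurable_powR|exact: rmeas_nrm].
Qed.

Lemma LprP (r : R) f : 0 < r ->
  Lp r%:E f <-> cmeasurable f /\ rint (fun x => nrm (f x) `^ r).
Proof.
move=> r0; split=> [[mf]|[mf fi]].
  rewrite pnormE => /lty_poweRy fi; split=> //; apply: rint_lty.
  - exact: powRn_rmeas.
  - by move=> x; exact: powR_ge0.
  - by apply: fi; rewrite invr_eq0 gt_eqF.
by split=> //; rewrite pnormE poweR_lty// ltey_expect.
Qed.

Lemma Lp2P f : Lp 2%:E f <-> sqint f.
Proof.
rewrite LprP//; split=> -[mf fi]; split=> //.
  by move: fi; under eq_fun do rewrite powR_mulrn ?nrm_ge0//.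
by under eq_fun do rewrite powR_mulrn ?nrm_ge0//.
Qed.

Lemma pnorm_lt (r e : R) f : 0 < r -> 0 < e -> rint (fun x => nrm (f x) `^ r) ->
  (pnorm r%:E f < e%:E)%E = (expect (fun x => nrm (f x) `^ r) < e `^ r).
Proof.
move=> r0 e0 fi; rewrite pnormE EFin_expect//=.
have f0 : 0 <= expect (fun x => nrm (f x) `^ r).
  by apply: expect_ge0 => x; exact: powR_ge0.
rewrite lte_fin; apply/idP/idP => h.
  rewrite -[ltLHS]powRr1// -(mulVf (lt0r_neq0 r0)) powRrM.
  by rewrite gt0_ltr_powR// ?nnegrE ?powR_ge0// ltW.
rewrite -[ltRHS]powRr1 ?ltW// -(mulfV (lt0r_neq0 r0)) powRrM.
by rewrite gt0_ltr_powR ?invr_gt0// ?nnegrE ?powR_ge0.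
Qed.

Lemma pnorm2_lt (e : R) f : 0 < e -> sqint f ->
  (pnorm 2%:E f < e%:E)%E = (n2 f < e ^+ 2).
Proof.
move=> e0 [mf fi]; have e2 : (fun x => nrm (f x) `^ 2) = (fun x => nrm (f x) ^+ 2).
  by apply/funext => x; rewrite powR_mulrn ?nrm_ge0.
by rewrite pnorm_lt// ?e2// powR_mulrn// ltW.
Qed.

Lemma LpyP f : Lp +oo f <->
  cmeasurable f /\ exists M : R, \forall x \ae sigma, nrm (f x) <= M.
Proof.
split=> -[mf]; rewrite ?pnormyE.
  move=> fi; split=> //.
  have : (0 <= ess_sup sigma (fun x : B => (nrm (f x))%:E))%E.
    apply: ess_sup_gee; first exact: sigmaT_gt0.
    by apply: nearW => x; rewrite lee_fin nrm_ge0.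
  have := ess_sup_ge sigma (fun x : B => (nrm (f x))%:E).
  case: ess_sup fi => // r _ h _; exists r.
  by apply: filterS h => x; rewrite lee_fin.
move=> [M fM]; split=> //; rewrite pnormyE (@le_lt_trans _ _ M%:E) ?ltry//.
by apply/ess_supP; apply: filterS fM => x; rewrite lee_fin.
Qed.

Lemma pnorm_le f g p : (1 <= p)%E -> cmeasurable f -> cmeasurable g ->
  (\forall x \ae sigma, nrm (f x) <= nrm (g x)) -> (pnorm p f <= pnorm p g)%E.
Proof.
case: p => [r|_|//]; last first.
  move=> mf mg fg; rewrite !pnormyE; apply: le_ess_sup.
  by apply: filterS fg => x; rewrite lee_fin.
rewrite lee_fin => r1 mf mg fg; have r0 : 0 < r by rewrite (lt_le_trans _ r1).
rewrite !pnormE gt0_ler_poweR ?invr_ge0 ?(ltW r0)//.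
- rewrite in_itv/= leey andbT; apply: integral_ge0 => x _.
  by rewrite lee_fin powR_ge0.
- rewrite in_itv/= leey andbT; apply: integral_ge0 => x _.
  by rewrite lee_fin powR_ge0.
apply: ae_ge0_le_integral => //.
- by move=> x _; rewrite lee_fin powR_ge0.
- by apply/measurable_EFinP; exact: powRn_rmeas.
- by move=> x _; rewrite lee_fin powR_ge0.
- by apply/measurable_EFinP; exact: powRn_rmeas.
apply: filterS fg => x fg _; rewrite lee_fin ge0_ler_powR ?nnegrE ?nrm_ge0//.
exact: ltW.
Qed.

Lemma pnormD f g p : (1 <= p)%E -> cmeasurable f -> cmeasurable g ->
  (pnorm p (fun x => (f x + g x)%R) <= pnorm p f + pnorm p g)%E.
Proof.
move=> p1 mf mg.
have m1 := rmeas_nrm mf; have m2 := rmeas_nrm mg.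
apply: le_trans (eminkowski sigma m1 m2 p1).
apply: (@le_trans _ _ (pnorm p (fun x => (nrm (f x) + nrm (g x))%:C))).
  apply: pnorm_le => //; [exact: cmeasD|exact: cmeas_real (rmeasD m1 m2)|].
  apply: nearW => x; rewrite nrm_real ger0_norm ?addr_ge0 ?nrm_ge0//.
  exact: le_normcD.
rewrite le_eqVlt; apply/orP; left; apply/eqP; apply: eq_Lnorm => x /=.
by rewrite expr0n/= addr0 sqrtr_sqr ger0_norm ?addr_ge0 ?nrm_ge0.
Qed.

Lemma pnormZ (c : R) f p : (1 <= p)%E -> 0 <= c -> cmeasurable f ->
  pnorm p (fun x => c%:C * f x) = (c%:E * pnorm p f)%E.
Proof.
case: p => [r|_|//]; last first.
  move=> c0 mf; rewrite !pnormyE -ess_supZl//; last exact: sigmaT_gt0.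
  by congr ess_sup; apply/funext => x; rewrite Normc.normcM nrm_real ger0_norm.
rewrite lee_fin => r1 c0 mf; have r0 : 0 < r by rewrite (lt_le_trans _ r1).
rewrite !pnormE; under eq_integral do
  rewrite Normc.normcM nrm_real ger0_norm// powRM ?nrm_ge0// EFinM.
rewrite ge0_integralZl_EFin//.
- rewrite poweRM ?lee_fin ?powR_ge0//; last first.
    by apply: integral_ge0 => x _; rewrite lee_fin powR_ge0.
  by rewrite poweR_EFin -powRrM mulfV ?gt_eqF// powRr1.
- by move=> x _; rewrite lee_fin powR_ge0.
- by apply/measurable_EFinP; exact: powRn_rmeas.
- exact: powR_ge0.
Qed.

Lemma pnormM_le (c : R) f g p : (1 <= p)%E -> 0 <= c ->
  cmeasurable f -> cmeasurable g -> (\forall x \ae sigma, nrm (g x) <= c) ->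
  (pnorm p (fun x => (g x * f x)%R) <= c%:E * pnorm p f)%E.
Proof.
move=> p1 c0 mf mg gc; rewrite -pnormZ//; apply: pnorm_le => //.
- exact: cmeasM.
- exact: cmeasZ.
apply: filterS gc => x gc; rewrite !Normc.normcM nrm_real ger0_norm//.
by rewrite ler_wpM2r ?nrm_ge0.
Qed.

Lemma pnorm_ge0 p f : (0 <= pnorm p f)%E.
Proof. exact: Lnorm_ge0. Qed.

(** Total mass 1 is what counts: for finite [p] this is Hoelder's inequality against the constant 1,
    for [p = +oo] it is the integral of the essential supremum. *)
Lemma pnorm1_le f p : (1 <= p)%E -> cmeasurable f -> (pnorm 1 f <= pnorm p f)%E.
Proof.
case: p => [r|_|//]; last first.
  move=> mf; rewrite pnorm1E pnormyE.
  set s := ess_sup _ _.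
  have s0 : (0 <= s)%E.
    apply: ess_sup_gee; first exact: sigmaT_gt0.
    by apply: nearW => x; rewrite lee_fin nrm_ge0.
  apply: (@le_trans _ _ (\int[sigma]_(x in [set: B]) s)%E); last first.
    by rewrite integral_cst//= [X in (_ * X)%E]sigmaT mule1.
  apply: ae_ge0_le_integral => //.
  - by move=> x _; rewrite lee_fin nrm_ge0.
  - exact: measurable_nrmE.
  - by apply: filterS (ess_sup_ge sigma _) => x h _; exact: h.
rewrite lee_fin le_eqVlt => /predU1P[<-//|r1] mf.
have r0 : 0 < r by rewrite (lt_trans _ r1).
have q0 : 0 < 1 - r^-1 by rewrite subr_gt0 invf_lt1.
have mn := rmeas_nrm mf.
have := @hoelder _ _ _ sigma _ _ r (1 - r^-1)^-1 mn (@rmeas_cst R G 1) r0.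
rewrite invr_gt0 q0 invrK addrC subrK => /(_ isT erefl).
rewrite (_ : ((_ : B -> R) \* _)%R = fun x : B => nrm (f x)); last first.
  by apply/funext => x /=; rewrite mulr1.
move=> /le_trans; apply.
rewrite (_ : Lnorm _ _ (EFin \o (fun=> 1)) = 1%E) ?mule1//.
by rewrite (Lnorm_cst1 sigma) [X in (X `^ _)%E]sigmaT poweR_EFin powR1.
Qed.

Lemma Lp_integ f p : (1 <= p)%E -> Lp p f -> integ f.
Proof.
by move=> p1 [mf fp]; apply/Lp1P; split=> //; exact: le_lt_trans (pnorm1_le p1 mf) fp.
Qed.

Lemma LpD f g p : (1 <= p)%E -> Lp p f -> Lp p g -> Lp p (fun x => f x + g x).
Proof.
move=> p1 [mf fp] [mg gp]; split; first exact: cmeasD.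
by apply: le_lt_trans (pnormD p1 mf mg) _; rewrite lte_add_pinfty.
Qed.

Lemma LpM f g (c : R) p : (1 <= p)%E -> Lp p f -> cmeasurable g ->
  (\forall x \ae sigma, nrm (g x) <= c) -> Lp p (fun x => g x * f x).
Proof.
move=> p1 [mf fp] mg gc; split; first exact: cmeasM.
have gc' : \forall x \ae sigma, nrm (g x) <= `|c|.
  by apply: filterS gc => x /le_trans; apply; exact: ler_norm.
apply: le_lt_trans (pnormM_le p1 _ mf mg gc') _ => //.
by rewrite lte_mul_pinfty// lee_fin.
Qed.

Lemma LpZ (a : R[i]) f p : (1 <= p)%E -> Lp p f -> Lp p (fun x => a * f x).
Proof.
by move=> p1 fp; apply: (LpM (c := nrm a) p1 fp (cmeas_cst G a)); exact: nearW.
Qed.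

Lemma LpB f g p : (1 <= p)%E -> Lp p f -> Lp p g -> Lp p (fun x => f x - g x).
Proof.
move=> p1 fp gp; apply: LpD => //.
by have := LpZ (-1) p1 gp; under eq_fun do rewrite mulN1r.
Qed.

Lemma Lp_le f g p : (1 <= p)%E -> cmeasurable f -> Lp p g ->
  (\forall x \ae sigma, nrm (f x) <= nrm (g x)) -> Lp p f.
Proof.
by move=> p1 mf [mg gp] fg; split=> //; exact: le_lt_trans (pnorm_le p1 mf mg fg) gp.
Qed.

Lemma Lp_ae f g p : (1 <= p)%E -> cmeasurable g -> Lp p f ->
  (\forall x \ae sigma, f x = g x) -> Lp p g.
Proof. by move=> p1 mg fp fg; apply: Lp_le fp _ => //; apply: filterS fg => x ->. Qed.

Lemma Lp_cst (a : R[i]) p : (1 <= p)%E -> Lp p (fun=> a).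
Proof.
case: p => [r|_|//].
  rewrite lee_fin => r1; have r0 : 0 < r by rewrite (lt_le_trans _ r1).
  by apply/LprP => //; split; [exact: cmeas_cst|exact: rint_cst].
by apply/LpyP; split; [exact: cmeas_cst|exists (nrm a); apply: nearW].
Qed.

Lemma Lpy_Lp f p : (1 <= p)%E -> Lp +oo f -> Lp p f.
Proof.
move=> p1 /LpyP[mf [M fM]]; have := LpM p1 (Lp_cst 1 p1) mf fM.
by under eq_fun do rewrite mulr1.
Qed.

Lemma Lpy_sqint f : Lp +oo f -> sqint f.
Proof. by move=> fy; apply/Lp2P; apply: Lpy_Lp => //; rewrite lee1n. Qed.

(* Truncating [u] at height [n] and using [r] bounded on the remainder. *)
Lemma expect_mul_small u (C e : R) : rint u -> (forall x, 0 <= u x) -> 0 < e ->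
  exists2 d : R, 0 < d & forall f, cmeasurable f ->
    (\forall x \ae sigma, nrm (f x) <= C) -> n2 f <= d ->
    expect (fun x => nrm (f x) * u x) < e.
Proof.
move=> iu u0 e0; have mu := rint_meas iu.
wlog C0 : C / 0 < C => [H|].
  have [|d d0 Hd] := H (`|C| + 1); first by rewrite ltr_wpDl.
  exists d => // f mf fC; apply: Hd => //; apply: filterS fC => x /le_trans; apply.
  by rewrite (le_trans (ler_norm _))// lerDl.
pose v n x := u x - Num.min (u x) n%:R.
have mv n : rmeas (v n) by apply: rmeasB => //; exact: measurable_minr.
have v0 n x : 0 <= v n x by rewrite subr_ge0 ge_min lexx.
have vu n x : v n x <= u x by rewrite gerBl le_min u0/=.
have iv n : rint (v n) by apply: rint_le iu => // x; rewrite ger0_norm.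
have cv : expect (v n) @[n --> \oo] --> (0 : R).
  have /(_ sigma _ measurableT (fun n => EFin \o (v n : B -> R)) (cst 0%E)
     (EFin \o (u : B -> R)))[] := @dominated_convergence _ B R.
  - by move=> n; apply/measurable_EFinP; exact: mv.
  - exact: measurable_cst.
  - apply: nearW => x _; apply: cvg_near_cst.
    near=> n; rewrite /= /v min_l ?subrr//.
    near: n; exact: nbhs_infty_ger.
  - exact: iu.
  - by apply: nearW => x n _ /=; rewrite lee_fin ger0_norm.
  move=> _ _; rewrite integral0 => /fine_cvgP[_].
  by apply: cvg_trans.
have [n vn] : exists n, expect (v n) < e / (2 * C).
  have : 0 < e / (2 * C) by rewrite divr_gt0// mulr_gt0.
  move=> /(cvgr_lt _ cv)[n _ /(_ n (leqnn n))] ?; by exists n.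
(* With [d = t ^+ 2], [expect_nrm_le] at this [t] bounds the mean of [nrm f] by [t]. The truncated
   part then contributes at most [n.+1 * t = e / 4], and the remainder less than [e / 2] by the
   choice of [n]. *)
pose t := e / (4 * (n.+1)%:R).
have t0 : 0 < t by rewrite divr_gt0// mulr_gt0.
exists (t ^+ 2); first by rewrite exprn_gt0.
move=> f mf fC fd.
have sf : sqint f.
  by apply/Lpy_sqint/LpyP; split=> //; exists C.
have mfu : rmeas (fun x => nrm (f x) * u x) by apply: rmeasM => //; exact: rmeas_nrm.
have inf : rint (fun x => n.+1%:R * nrm (f x) + C * v n x).
  apply: rintD; apply: rintZ => //; exact: (sqint_integ sf).2.
have le : \forall x \ae sigma,
    nrm (f x) * u x <= n.+1%:R * nrm (f x) + C * v n x.
  apply: filterS fC => x fC.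
  rewrite -[u x](subrK (Num.min (u x) n%:R)) -/(v n x) mulrDr addrC.
  apply: lerD; last by rewrite ler_wpM2r.
  rewrite mulrC ler_wpM2r ?nrm_ge0// (@le_trans _ _ n%:R) ?ler_nat//.
  by rewrite ge_min lexx orbT.
have ifu : rint (fun x => nrm (f x) * u x).
  apply: ae_le_rint inf => //; apply: filterS le => x.
  by rewrite ger0_norm// mulr_ge0 ?nrm_ge0.
apply: le_lt_trans (ae_le_expect ifu inf le) _.
rewrite expectD ?expectZ//; [|exact: (sqint_integ sf).2|
  by apply: rintZ; exact: (sqint_integ sf).2|exact: rintZ].
have : expect (fun x => nrm (f x)) <= t.
  apply: le_trans (expect_nrm_le sf t0) _.
  suff : t^-1 * n2 f <= t by lra.
  by rewrite mulrC ler_pdivrMr// -expr2.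
move=> ft.
rewrite [ltRHS](splitr e) ltr_leD//; last first.
  by move: vn; rewrite ltr_pdivlMr ?mulr_gt0// => vn; lra.
apply: le_lt_trans (_ : n.+1%:R * t < _); first by rewrite ler_wpM2l.
rewrite /t mulrC invfM mulrA divfK ?pnatr_eq0//.
by rewrite ltr_pM2l// ltf_pV2 ?posrE// ltr_nat.
Unshelve. all: by end_near. Qed.

End LpSpaces.

(** * Norm and weak-star closures, treated uniformly *)

Section Closure.
Variables (R : realType) (G : zmodType).
Variable sigma : probability (borel_dual R G) R.
Local Notation K := (dual R G).
Local Notation expect := (expect sigma).
Local Notation integ := (integ sigma).
Local Notation cint := (cintegral sigma).
Local Notation n2 := (n2 sigma).
Local Notation pnorm := (pnorm sigma).
Local Notation Lp := (Lp sigma).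
Implicit Types (f g h : K -> R[i]) (A E : set (K -> R[i])).

(* Both the norm topology and the weak-star topology of [Lp p] are given by
   seminorms; the closure properties below are uniform in [p]. *)
Definition seminorm (p : \bar R) (nu : (K -> R[i]) -> R) :=
  if p == +oo%E then
    exists n (h : 'I_n -> K -> R[i]), (forall i, Lp 1 (h i)) /\
      nu = fun f => \sum_i nrm (cint (fun x => f x * h i x))
  else nu = fun f => fine (pnorm p f).

(** A basic weak-star neighbourhood involves finitely many functionals at once; summing them into
    one seminorm keeps a single witness [g] for all of them. The bound [e / n.+1] on each term,
    rather than [e / n], also covers the empty family. *)
Lemma closP p A f : A `<=` Lp p -> (1 <= p)%E ->
  clos sigma p A f <-> Lp p f /\ forall nu, seminorm p nu ->
    forall e, 0 < e -> exists2 g, A g & nu (fun x => f x - g x) < e.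
Proof.
move=> AL p1; rewrite /clos /seminorm; have [py|py] := eqVneq p +oo%E.
  rewrite py; split=> -[fy H]; split=> //.
    move=> nu [n [h [hi ->]]] e e0.
    have [|g Ag gh] := H n h (e / n.+1%:R) hi; first by rewrite divr_gt0.
    exists g => //; apply: (@le_lt_trans _ _ (\sum_(i < n) (e / n.+1%:R))).
      by apply: ler_sum => i _; exact/ltW/gh.
    rewrite sumr_const card_ord -[ltLHS]mulr_natr -mulrA gtr_pMr//.
    by rewrite mulrC ltr_pdivrMr// mul1r ltr_nat.
  move=> n h e hi e0.
  have [g Ag gh] := H _ (ex_intro _ n (ex_intro _ h (conj hi erefl))) _ e0.
  exists g => // i; apply: le_lt_trans gh.
  by rewrite (bigD1 i)//= lerDl sumr_ge0// => j _; exact: nrm_ge0.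
split=> -[fy H]; split=> //.
  move=> nu -> e e0; have [g Ag gh] := H _ e0; exists g => //.
  rewrite -lte_fin fineK// ge0_fin_numE ?pnorm_ge0//.
  by rewrite (lt_trans gh)// ltry.
move=> e e0; have [g Ag gh] := H _ erefl _ e0; exists g => //.
rewrite -lte_fin fineK// in gh; rewrite ge0_fin_numE ?pnorm_ge0//.
exact: (LpB p1 fy (AL _ Ag)).2.
Qed.

Lemma neqy_fin (p : \bar R) : (1 <= p)%E -> p != +oo%E ->
  exists2 r : R, p = r%:E & 1 <= r.
Proof. by case: p => [r||]//; exists r. Qed.

Lemma fine_pnorm_le p f (c : R) : Lp p f -> (pnorm p f <= c%:E)%E ->
  fine (pnorm p f) <= c.
Proof. by move=> [_ fp]; rewrite -lee_fin fineK// ge0_fin_numE ?pnorm_ge0. Qed.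

Lemma fineK_pnorm p f : Lp p f -> (fine (pnorm p f))%:E = pnorm p f.
Proof. by move=> [_ fp]; rewrite fineK// ge0_fin_numE ?pnorm_ge0. Qed.

Lemma LpyM_integ f h : Lp +oo f -> Lp 1 h -> integ (fun x => f x * h x).
Proof. by move=> /LpyP[mf [M fM]] hi; apply/Lp1P; exact: (LpM _ hi mf fM). Qed.

Section SeminormTheory.
Variables (p : \bar R) (nu : (K -> R[i]) -> R).
Hypotheses (p1 : (1 <= p)%E) (nuP : seminorm p nu).

Lemma seminormD f g : Lp p f -> Lp p g ->
  nu (fun x => f x + g x) <= nu f + nu g.
Proof.
move: nuP; rewrite /seminorm; case: eqP => [py|_] nuE fp gp.
  have [n [h [hi ->]]] := nuE; rewrite -big_split; apply: ler_sum => i _; cbn beta.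
  rewrite py in fp gp; apply: le_trans (le_normcD _ _).
  rewrite -cintD; [|exact: LpyM_integ|exact: LpyM_integ].
  by rewrite le_eqVlt; apply/orP; left; apply/eqP; congr nrm; apply: eq_cint => x;
    rewrite mulrDl.
rewrite nuE; apply: fine_pnorm_le; first exact: LpD.
by rewrite EFinD !fineK_pnorm// pnormD//; [exact: fp.1|exact: gp.1].
Qed.

(** For [p = +oo] the factor [u] is moved onto the test functions, which changes the seminorm; hence
    the existential [nu']. For finite [p] the seminorm stays the same and [|c| + 1] is a positive
    constant above [c]. *)
Lemma seminormM (u : K -> R[i]) (c : R) : cmeasurable u ->
  (\forall x \ae sigma, nrm (u x) <= c) ->
  exists nu' c', [/\ seminorm p nu', 0 < c' &
    forall f, Lp p f -> nu (fun x => u x * f x) <= c' * nu' f].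
Proof.
move=> mu uc; move: nuP; rewrite /seminorm; case: eqP => [py|_] nuE.
  have [n [h [hi ->]]] := nuE.
  exists (fun f => \sum_i nrm (cint (fun x => f x * (u x * h i x)))), 1.
  split=> //; first by exists n, (fun i x => u x * h i x); split=> // i;
    exact: (LpM _ (hi i) mu uc).
  move=> f _; rewrite mul1r; apply: ler_sum => i _.
  rewrite le_eqVlt; apply/orP; left; apply/eqP; congr nrm; apply: eq_cint => x.
  by rewrite mulrCA mulrA.
exists nu, (`|c| + 1); split; [exact: nuE|by rewrite ltr_wpDl|].
move=> f fp; rewrite nuE; apply: fine_pnorm_le; first exact: (LpM _ fp mu uc).
rewrite EFinM fineK_pnorm//; apply: pnormM_le => //; first exact: fp.1.
apply: filterS uc => x /le_trans; apply.
by rewrite (le_trans (ler_norm _))// lerDl.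
Qed.

(** Everything reduces to [expect_mul_small] with the right integrable weight: for [p = +oo] it is
    the sum of the [|F h_i|] over the test functions, for finite [p = r] it is [|F| ^ r], because a
    multiplier [s] bounded by [C] satisfies [|s F| ^ r <= C ^ (r - 1) |s| |F| ^ r]. *)
Lemma seminorm_small (F : K -> R[i]) (C e : R) : Lp p F -> 0 < e ->
  exists2 d : R, 0 < d & forall r, cmeasurable r ->
    (\forall x \ae sigma, nrm (r x) <= C) -> n2 r <= d ->
    nu (fun x => r x * F x) < e.
Proof.
move=> Fp e0; move: nuP; rewrite /seminorm; case: eqP => [py|/eqP py] nuE.
  have [n [h [hi ->]]] := nuE; rewrite py in Fp.
  have iu i := LpyM_integ Fp (hi i).
  pose u x := \sum_i nrm (F x * h i x).
  have ru : rint sigma u.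
    rewrite /u; elim: (index_enum _) => [|i s ih].
      by under eq_fun do rewrite big_nil; exact: rint_cst.
    by under eq_fun do rewrite big_cons; apply: rintD => //; exact: (iu i).2.
  have u0 x : 0 <= u x by apply: sumr_ge0 => i _; exact: nrm_ge0.
  have [|d d0 Hd] := expect_mul_small C (e := e / n.+1%:R) ru u0.
    by rewrite divr_gt0.
  exists d => // r mr rC rd.
  have rF i : integ (fun x => r x * F x * h i x).
    have := LpM (lexx _) (iffRL (Lp1P _ _) (iu i)) mr rC.
    by under eq_fun do rewrite mulrA; move/Lp1P.
  have le i : nrm (cint (fun x => r x * F x * h i x)) <= e / n.+1%:R.
    apply: le_trans (nrm_cint (rF i)) _.
    apply/ltW; apply: le_lt_trans (Hd r mr rC rd); apply: le_expect.
    - exact: (rF i).2.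
    - have ruC : rint sigma (fun x => C * u x) by exact: rintZ.
      apply: ae_le_rint ruC; first exact: rmeasM (rmeas_nrm mr) (rint_meas ru).
      apply: filterS rC => x rC; rewrite ger0_norm ?mulr_ge0 ?nrm_ge0//.
      by rewrite ler_wpM2r.
    - move=> x; rewrite -mulrA Normc.normcM ler_wpM2l ?nrm_ge0//.
      by rewrite /u (bigD1 i)//= lerDl sumr_ge0// => j _; exact: nrm_ge0.
  apply: (@le_lt_trans _ _ (\sum_(i < n) (e / n.+1%:R))); first exact: ler_sum.
  rewrite sumr_const card_ord -[ltLHS]mulr_natr -mulrA gtr_pMr//.
  by rewrite mulrC ltr_pdivrMr// mul1r ltr_nat.
have [r pr r1] := neqy_fin p1 py; have r0 : 0 < r by rewrite (lt_le_trans _ r1).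
rewrite nuE pr {nuE}; rewrite pr in Fp; have [mF iF] := iffLR (LprP _ _ r0) Fp.
wlog C0 : C / 0 < C => [H|].
  have [|d d0 Hd] := H (`|C| + 1); first by rewrite ltr_wpDl.
  exists d => // f mf fC; apply: Hd => //; apply: filterS fC => x /le_trans; apply.
  by rewrite (le_trans (ler_norm _))// lerDl.
have Cr : 0 < C `^ (r - 1) by rewrite powR_gt0.
have [|d d0 Hd] := expect_mul_small C (e := e `^ r / C `^ (r - 1))
    iF (fun=> powR_ge0 _ _); first by rewrite divr_gt0// powR_gt0.
exists d => // s ms sC sd.
have p1' : (1 <= r%:E)%E by rewrite lee_fin.
have sF : Lp r%:E (fun x => s x * F x) := LpM p1' Fp ms sC.
have [msF isF] := iffLR (LprP _ _ r0) sF.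
rewrite -lte_fin fineK_pnorm// pnorm_lt//.
have irhs : rint sigma (fun x => nrm (s x) * nrm (F x) `^ r).
  have ruC := rintZ C iF.
  apply: ae_le_rint ruC.
    by apply: rmeasM; [exact: rmeas_nrm|exact: powRn_rmeas].
  apply: filterS sC => x sC; rewrite ger0_norm ?mulr_ge0 ?nrm_ge0 ?powR_ge0//.
  by rewrite ler_wpM2r ?powR_ge0.
apply: (@le_lt_trans _ _
    (C `^ (r - 1) * expect (fun x => nrm (s x) * nrm (F x) `^ r))); last first.
  by rewrite mulrC -ltr_pdivlMr//; exact: Hd.
rewrite -expectZ//; apply: ae_le_expect => //; first exact: rintZ.
apply: filterS sC => x sC; rewrite Normc.normcM powRM ?nrm_ge0// mulrA.
rewrite ler_wpM2r ?powR_ge0// -mulr_powRB1 ?nrm_ge0// mulrC ler_wpM2r ?nrm_ge0//.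
by rewrite ge0_ler_powR ?nnegrE ?nrm_ge0 ?subr_ge0// ltW.
Qed.

End SeminormTheory.

(** Integration against a bounded function is continuous for every [p]: it gives one of the
    seminorms when [p = +oo], and otherwise is dominated by the [L^1] norm, hence by [pnorm p]. *)
Lemma seminorm_functional p (w : K -> R[i]) (c : R) : (1 <= p)%E ->
  cmeasurable w -> (\forall x \ae sigma, nrm (w x) <= c) ->
  exists nu c', [/\ seminorm p nu, 0 < c' &
    forall f, Lp p f -> nrm (cint (fun x => f x * w x)) <= c' * nu f].
Proof.
move=> p1 mw wc; rewrite /seminorm; have [py|py] := eqVneq p +oo%E.
  exists (fun f => \sum_(i < 1) nrm (cint (fun x => f x * w x))), 1; split=> //.
    exists 1%N, (fun=> w); split=> // _.
    by have := LpM (lexx _) (Lp_cst sigma 1 (lexx _)) mw wc;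
      under eq_fun do rewrite mulr1.
  by move=> f _; rewrite mul1r big_ord1.
exists (fun f => fine (pnorm p f)), (`|c| + 1).
split; [by []|by rewrite ltr_wpDl|].
move=> f fp.
have i1 : Lp 1 (fun x => w x * f x).
  by apply: (LpM _ _ mw wc) => //; apply/Lp1P; exact: Lp_integ fp.
have i2 := iffLR (Lp1P _ _) i1.
have -> : cint (fun x => f x * w x) = cint (fun x => w x * f x).
  by apply: eq_cint => x; rewrite mulrC.
apply: le_trans (nrm_cint i2) _; rewrite -lee_fin EFinM fineK_pnorm//.
rewrite -EFin_expect; last exact: i2.2.
rewrite -pnorm1E; apply: (@le_trans _ _ ((`|c| + 1)%:E * pnorm 1 f)%E).
  apply: pnormM_le => //; first exact: fp.1.
  apply: filterS wc => x /le_trans; apply.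
  by rewrite (le_trans (ler_norm _))// lerDl.
by rewrite lee_wpmul2l ?lee_fin ?addr_ge0//; apply: pnorm1_le => //; exact: fp.1.
Qed.

Section ClosTheory.
Variable p : \bar R.
Hypothesis p1 : (1 <= p)%E.
Local Notation clos := (clos sigma p).

Lemma clos_Lp A f : clos A f -> Lp p f.
Proof. by rewrite /Defs.clos; case: eqP => [->|_] []. Qed.

Lemma clos_sub A E : A `<=` E -> clos A `<=` clos E.
Proof.
move=> AE f; rewrite /Defs.clos; case: ifP => _ [fp H]; split=> //.
  by move=> n h e hi e0; have [g Ag gh] := H n h e hi e0; exists g => //; exact: AE.
by move=> e e0; have [g Ag gh] := H e e0; exists g => //; exact: AE.
Qed.

(* The error may have a factor [F] which is only in [Lp p], as long as it is
   multiplied by a bounded function which is small in [L2]. *)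
Lemma clos_small A f (F : K -> R[i]) (C : R) : A `<=` Lp p -> Lp p f -> Lp p F ->
  (forall d, 0 < d -> exists r, [/\ cmeasurable r,
     \forall x \ae sigma, nrm (r x) <= C, n2 r <= d &
     A (fun x => f x + r x * F x)]) ->
  clos A f.
Proof.
move=> AL fp Fp H; apply/closP => //; split=> // nu nuP e e0.
have [d d0 Hd] := seminorm_small p1 nuP C Fp e0.
have [r [mr rC rd Ar]] := H _ d0; exists (fun x => f x + r x * F x) => //.
rewrite (_ : (fun x => _) = fun x => - r x * F x); last first.
  by apply/funext => x; rewrite opprD addNKr mulNr.
apply: Hd (cmeasN mr) _ _; first by apply: filterS rC => x; rewrite normcN.
by rewrite /n2; under eq_fun do rewrite normcN.
Qed.

Lemma sub_clos A : A `<=` Lp p -> A `<=` clos A.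
Proof.
move=> AL f Af; apply: (@clos_small _ _ 0 0) => //; first exact: AL.
  exact: Lp_cst.
move=> d d0; exists (fun=> 0); split.
- exact: cmeas_cst.
- by apply: nearW => x; rewrite Normc.normc0.
- by rewrite /n2 Normc.normc0 expr0n/= expect_cst ltW.
- by under eq_fun do rewrite mulr0 addr0.
Qed.

Lemma clos_idem A : A `<=` Lp p -> clos (clos A) `<=` clos A.
Proof.
move=> AL f /(closP _ (@clos_Lp A) p1)[fp H]; apply/closP => //; split=> //.
move=> nu nuP e e0; have e20 : 0 < e / 2 by rewrite divr_gt0.
have [g cg fg] := H _ nuP _ e20.
have [gp Hg] := iffLR (closP _ AL p1) cg.
have [h Ah gh] := Hg _ nuP _ e20; exists h => //.
rewrite (splitr e); apply: le_lt_trans (ltrD fg gh).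
rewrite -[leLHS]/(nu _) (_ : (fun x => f x - h x) =
    fun x => (f x - g x) + (g x - h x)); last first.
  by apply/funext => x; rewrite addrA subrK.
by apply: (seminormD p1 nuP) => //; apply: LpB => //; exact: AL.
Qed.

Lemma clos_bounded_mul A E (u : K -> R[i]) (c : R) f : A `<=` Lp p -> E `<=` Lp p ->
  cmeasurable u -> (\forall x \ae sigma, nrm (u x) <= c) ->
  (forall g, A g -> E (fun x => u x * g x)) ->
  clos A f -> clos E (fun x => u x * f x).
Proof.
move=> AL EL mu uc AE /(closP _ AL p1)[fp H]; apply/closP => //; split=> //.
  exact: LpM fp mu uc.
move=> nu nuP e e0; have [nu' [c' [nuP' c0 le]]] := seminormM p1 nuP mu uc.
have [|g Ag fg] := H _ nuP' (e / c'); first by rewrite divr_gt0.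
exists (fun x => u x * g x); first exact: AE.
under eq_fun do rewrite -mulrBr.
apply: le_lt_trans (le _ _) _; first by apply: LpB => //; exact: AL.
by rewrite mulrC -ltr_pdivlMr.
Qed.

Lemma clos_subspace A : A `<=` Lp p -> subspace A -> subspace (clos A).
Proof.
move=> AL [A0 AD]; split; first by apply: sub_clos.
move=> a f g cf cg.
have caf : clos A (fun x => a * f x).
  apply: (clos_bounded_mul (c := nrm a) AL AL (cmeas_cst G a) _ _ cf).
    exact: nearW.
  move=> h Ah; have := AD a _ _ Ah A0.
  by rewrite (_ : (fun x => _) = fun x => a * h x)//; apply/funext => x; rewrite addr0.
have [afp Hf] := iffLR (closP _ AL p1) caf.
have [gp Hg] := iffLR (closP _ AL p1) cg.
apply/closP => //; split; first exact: LpD.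
move=> nu nuP e e0; have e20 : 0 < e / 2 by rewrite divr_gt0.
have [f' Af ff] := Hf _ nuP _ e20.
have [g' Ag gg] := Hg _ nuP _ e20.
exists (fun x => 1 * f' x + g' x); first exact: AD.
rewrite (splitr e); apply: le_lt_trans (ltrD ff gg).
rewrite (_ : (fun x => _) = fun x => (a * f x - f' x) + (g x - g' x)); last first.
  by apply/funext => x; rewrite mul1r; ring.
by apply: (seminormD p1 nuP) => //; apply: LpB => //; exact: AL.
Qed.

Lemma clos_functional A (w : K -> R[i]) (c : R) f : A `<=` Lp p ->
  cmeasurable w -> (\forall x \ae sigma, nrm (w x) <= c) ->
  (forall g, A g -> cint (fun x => g x * w x) = 0) ->
  clos A f -> cint (fun x => f x * w x) = 0.
Proof.
move=> AL mw wc A0 /(closP _ AL p1)[fp H].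
have [nu [c' [nuP c0 le]]] := seminorm_functional p1 mw wc.
apply/eqP; rewrite -nrm_eq0 eq_le nrm_ge0 andbT; apply/ler_addgt0Pr => e e0.
have [|g Ag fg] := H _ nuP (e / c'); first by rewrite divr_gt0.
have i h : Lp p h -> integ (fun x => h x * w x).
  move=> hp; have := LpM p1 hp mw wc; under eq_fun do rewrite mulrC.
  exact: Lp_integ.
have := le _ (LpB p1 fp (AL _ Ag)); under eq_cint do rewrite mulrBl.
rewrite cintB; [|exact: i|by apply: i; exact: AL].
rewrite (A0 _ Ag) subr0 add0r => /le_trans; apply.
by rewrite mulrC -ler_pdivlMr// ltW.
Qed.

(** The seminorms do not see null sets: [g - f] is treated as a multiplier of the constant 1 with
    bound [C = 0], and [seminorm_small] applies to it whatever [d] is. *)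
Lemma clos_ae A f g : A `<=` Lp p -> clos A f -> cmeasurable g ->
  (\forall x \ae sigma, f x = g x) -> clos A g.
Proof.
move=> AL cf mg fg; have fp := clos_Lp cf.
have [_ H] := iffLR (closP _ AL p1) cf.
have gp := Lp_ae p1 mg fp fg; apply/closP => //; split=> // nu nuP e e0.
have e20 : 0 < e / 2 by rewrite divr_gt0.
have [h Ah fh] := H _ nuP _ e20; exists h => //.
have [d d0 /(_ (fun x => g x - f x))] := seminorm_small p1 nuP 0 (Lp_cst sigma 1 p1) e20.
have gf0 : \forall x \ae sigma, g x - f x = 0.
  by apply: filterS fg => x ->; rewrite subrr.
rewrite (_ : (fun x => (g x - f x) * 1) = fun x => g x - f x); last first.
  by apply/funext => x; rewrite mulr1.
move=> Hd; rewrite (splitr e).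
rewrite (_ : (fun x => _) = fun x => (f x - h x) + (g x - f x)); last first.
  by apply/funext => x; ring.
apply: le_lt_trans (seminormD p1 nuP _ _) _; [|exact: LpB|apply: ltrD => //].
  by apply: LpB => //; exact: AL.
apply: Hd; first by apply: cmeasB => //; exact: fp.1.
  by apply: filterS gf0 => x ->; rewrite Normc.normc0.
rewrite /n2 (@ae_expect _ _ _ _ (fun=> 0)) ?expect_cst ?ltW//.
- by apply: rmeas_nrm2; apply: cmeasB => //; exact: fp.1.
- exact: rmeas_cst.
- by apply: filterS gf0 => x ->; rewrite Normc.normc0 expr0n.
Qed.

End ClosTheory.

End Closure.

(** * Completeness of [L^2] and orthogonal projection *)

Section HilbertSpace.
Variables (R : realType) (G : zmodType).
Variable sigma : probability (borel_dual R G) R.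
Local Notation K := (dual R G).
Local Notation B := (borel_dual R G).
Local Notation rmeas := (@rmeas R G).
Local Notation rint := (rint sigma).
Local Notation expect := (expect sigma).
Local Notation sqint := (sqint sigma).
Local Notation n2 := (n2 sigma).
Local Notation ip := (ip sigma).
Local Notation clos2 := (clos sigma 2%:E).
Implicit Types (f g h : K -> R[i]) (A : set (K -> R[i])).

Lemma le0_geom (x c : R) : (forall n, x <= c / 4 ^+ n) -> x <= 0.
Proof.
move=> H; rewrite leNgt; apply/negP => x0.
have c0 : 0 < c by have := lt_le_trans x0 (H 0%N); rewrite expr0 divr1.
have [n] : exists n : nat, c / x < n%:R.
  exists (Num.truncn (c / x)).+1; apply: (lt_le_trans (truncnS_gt _)).
  by rewrite ler_nat.
rewrite ltr_pdivrMr// ltNge => /negP; apply.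
have := H n; rewrite ler_pdivlMr ?exprn_gt0// => /(le_trans _); apply.
rewrite mulrC ler_wpM2l ?(ltW x0)// -natrX ler_nat ltnW//.
by rewrite (leq_trans (ltn_expl n (isT : 1 < 4)%N)).
Qed.

Lemma fatou_expect (F_ : nat -> K -> R) (F : K -> R) (c : R) :
  (forall n, rint (F_ n)) -> (forall n x, 0 <= F_ n x) ->
  (forall n, expect (F_ n) <= c) -> rmeas F -> (forall x, 0 <= F x) ->
  (\forall x \ae sigma, F_ n x @[n --> \oo] --> F x) ->
  rint F /\ expect F <= c.
Proof.
move=> iF F0 Fc mF FF0 cF.
have mF_ n : measurable_fun [set: B] (fun x : B => (F_ n x)%:E).
  by apply/measurable_EFinP; exact: rint_meas (iF n).
have le : (\int[sigma]_(x in [set: B]) (F x)%:E <= c%:E)%E.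
  rewrite (@ae_eq_integral _ _ _ sigma _
    (fun x : B => limn_einf (fun n => (F_ n x)%:E)))//; first last.
  - apply: filterS cF => x cF _; apply/esym.
    by apply: (cvg_limn_einf_sup _).1; apply: cvg_EFin => //; exact: nearW.
  - rewrite /limn_einf; apply: measurableT_comp => //.
    by apply: measurable_fun_limn_esup => n; exact: measurableT_comp.
  - exact/measurable_EFinP.
  apply: le_trans (fatou sigma measurableT mF_ _) _.
    by move=> n x _; rewrite lee_fin.
  rewrite limn_einf_lim; apply: lime_le; first exact: is_cvg_einfs.
  apply: nearW => n; apply: (@le_trans _ _ (\int[sigma]_(x in [set: B]) (F_ n x)%:E)%E).
    by apply: ereal_inf_lbound; exists n => /=.
  by rewrite EFin_expect// lee_fin.
have iFF : rint F by apply: rint_lty => //; rewrite (le_lt_trans le)// ltry.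
by split=> //; move: le; rewrite EFin_expect// lee_fin.
Qed.

(* An [L2] rapidly Cauchy sequence converges a.e. since the sum of the absolute
   increments is integrable. *)
Lemma rapidly_cauchy_cvg (f_ : nat -> K -> R[i]) (T : R[i] -> R) :
  (forall n, sqint (f_ n)) ->
  (forall n, n2 (fun x => f_ n.+1 x - f_ n x) <= (4 ^+ n)^-1) ->
  (forall z w, T (z - w) = T z - T w) -> (forall z, `|T z| <= nrm z) ->
  \forall x \ae sigma, cvgn (fun n => T (f_ n x)).
Proof.
move=> sf fS TB Tn.
pose d n x := nrm (f_ n.+1 x - f_ n x).
have sd n : sqint (fun x => f_ n.+1 x - f_ n x) by exact: sqintB.
have id n : rint (d n) := (sqint_integ (sd n)).2.
(* [expect_nrm_le] at [t = 2 ^ (-n)] turns the bound [4 ^ (-n)] on the squared [L^2] norm into a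
   summable bound on the [L^1] norm. *)
have dn n : expect (d n) <= (2 ^+ n)^-1.
  have t0 : 0 < (2 ^+ n)^-1 :> R by rewrite invr_gt0 exprn_gt0.
  apply: le_trans (expect_nrm_le (sd n) t0) _.
  rewrite ler_pdivrMr// invrK; have := fS n.
  have -> : 4 ^+ n = 2 ^+ n * 2 ^+ n :> R.
    by rewrite -exprMn; congr (_ ^+ n); rewrite -natrM.
  rewrite invfM ler_pdivlMr ?exprn_gt0// mulrC; lra.
pose S x := (\sum_(0 <= n <oo) (d n x)%:E)%E.
have mS : measurable_fun [set: B] (S : B -> \bar R).
  apply: ge0_emeasurable_sum => //.
    by move=> n x _ _; rewrite lee_fin; exact: nrm_ge0.
  by move=> n _; apply/measurable_EFinP; exact: rint_meas (id n).
have S0 x : (0 <= S x)%E.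
  by apply: nneseries_ge0 => n _ _; rewrite lee_fin; exact: nrm_ge0.
have iS : sigma.-integrable [set: B] (S : B -> \bar R).
  apply/integrableP; split=> //; under eq_integral do rewrite gee0_abs//.
  rewrite integral_nneseries//; last 2 first.
    by move=> n; apply/measurable_EFinP; exact: rint_meas (id n).
    by move=> n x _; rewrite lee_fin; exact: nrm_ge0.
  apply: (@le_lt_trans _ _ 2%:E); last exact: ltry.
  have h k : (0 <= k)%N -> true -> (0 <= \int[sigma]_(x in [set: B]) (d k x)%:E)%E.
    by move=> _ _; apply: integral_ge0 => x _; rewrite lee_fin; exact: nrm_ge0.
  apply: (lime_le (is_cvg_nneseries h)).
  apply: nearW => n; rewrite (eq_bigr (fun k => (expect (d k))%:E)); last first.
    by move=> k _; rewrite EFin_expect.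
  rewrite sumEFin lee_fin (@le_trans _ _ (\sum_(0 <= k < n) (2 ^+ k)^-1))//.
    exact: ler_sum.
  have -> : \sum_(0 <= k < n) (2 ^+ k)^-1 = 2 - 2 * (2 ^+ n)^-1 :> R.
    elim: n => [|n ih]; first by rewrite big_nil expr0 invr1; lra.
    rewrite big_nat_recr//= ih exprS invfM; lra.
  by rewrite gerBl mulr_ge0// invr_ge0 exprn_ge0.
apply: filterS (integrable_ae measurableT iS) => x /(_ Logic.I) Sx.
suff /normed_cvg : cvgn [normed series (telescope (fun n => T (f_ n x)))].
  rewrite telescopeK => cT.
  have -> : (fun n => T (f_ n x)) =
      (fun=> T (f_ 0%N x)) \+ [sequence T (f_ n x) - T (f_ 0%N x)]_n.
    by apply/funext => n /=; rewrite addrC subrK.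
  by apply: is_cvgD => //; exact: is_cvg_cst.
apply: nondecreasing_is_cvgn.
  apply/nondecreasing_seqP => n; rewrite /= /series/= big_nat_recr//= lerDl.
  exact: normr_ge0.
exists (fine (S x)) => _ [n _ <-]; rewrite -lee_fin fineK//.
apply: le_trans (nneseries_lim_ge n _); last first.
  by move=> k _ _; rewrite lee_fin; exact: nrm_ge0.
rewrite sumEFin lee_fin /series/=; apply: ler_sum => k _.
by rewrite /telescope/= -TB; exact: Tn.
Qed.

Lemma L2_complete (f_ : nat -> K -> R[i]) : (forall n, sqint (f_ n)) ->
  (forall n, n2 (fun x => f_ n.+1 x - f_ n x) <= (4 ^+ n)^-1) ->
  exists2 f, sqint f & forall n, n2 (fun x => f x - f_ n x) <= 4 / 4 ^+ n.
Proof.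
move=> sf fS.
have ReB (z w : R[i]) : complex.Re (z - w) = complex.Re z - complex.Re w.
  by rewrite ReD ReN.
have ImB (z w : R[i]) : complex.Im (z - w) = complex.Im z - complex.Im w.
  by rewrite ImD ImN.
have cRe := rapidly_cauchy_cvg sf fS ReB (@Re_le_nrm R).
have cIm := rapidly_cauchy_cvg sf fS ImB (@Im_le_nrm R).
(* The upper limit is measurable without any convergence and equals the limit wherever there is one,
   so [f] is defined without an exceptional set. *)
pose lim_ (T : R[i] -> R) x := fine (limn_esup (fun n => (T (f_ n x))%:E)).
have lim_E T x : cvgn (fun n => T (f_ n x)) -> T (f_ n x) @[n --> \oo] --> lim_ T x.
  move=> cT; have -> : lim_ T x = limn (fun n => T (f_ n x)); last exact: cT.
  rewrite /lim_ (_ : limn_esup _ = (limn (fun n => T (f_ n x)))%:E)//.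
  by apply: (cvg_limn_einf_sup _).2; apply: cvg_EFin => //; exact: nearW.
have mlim T : (forall n, rmeas (fun x => T (f_ n x))) -> rmeas (lim_ T).
  move=> mT; apply: (@measurableT_comp _ _ _ _ _ _ (@fine R)) => //.
  by apply: measurable_fun_limn_esup => n; apply/measurable_EFinP; exact: mT.
pose f x := Complex (lim_ (@complex.Re R) x) (lim_ (@complex.Im R) x).
have mf : cmeasurable f.
  by split; apply: mlim => n; [exact: (sf n).1.1|exact: (sf n).1.2].
(* The bound [4 / 4 ^ n] reproduces itself under [n2D_le], since [2 * (4 / 4 ^ n.+1) + 2 / 4 ^ n = 4
   / 4 ^ n]. Fatou's lemma in [k] then hands it over to the limit. *)
have tail k n : n2 (fun x => f_ (n + k)%N x - f_ n x) <= 4 / 4 ^+ n.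
  elim: k n => [|k ih] n.
    rewrite addn0 /n2 (_ : (fun x => _) = fun=> 0) ?expect_cst.
      by rewrite divr_ge0// exprn_ge0.
    by apply/funext => x; rewrite subrr Normc.normc0 expr0n.
  rewrite (_ : (fun x => _) =
    fun x => (f_ (n.+1 + k)%N x - f_ n.+1 x) + (f_ n.+1 x - f_ n x)); last first.
    by apply/funext => x; rewrite addrA subrK addnS.
  apply: le_trans (n2D_le _ _) _; [exact: sqintB|exact: sqintB|].
  have := ih n.+1; have := fS n; rewrite exprS invfM.
  set a := (4 ^+ n)^-1; lra.
have lim2 n : rint (fun x => nrm (f x - f_ n x) ^+ 2) /\
    expect (fun x => nrm (f x - f_ n x) ^+ 2) <= 4 / 4 ^+ n.
  apply: (@fatou_expect (fun k x => nrm (f_ (n + k)%N x - f_ n x) ^+ 2)).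
  - by move=> k; exact: (sqintB (sf _) (sf _)).2.
  - by move=> k x; exact: sqr_ge0.
  - by move=> k; exact: tail.
  - by apply: rmeas_nrm2; apply: cmeasB => //; exact: (sf n).1.
  - by move=> x; exact: sqr_ge0.
  move: cRe cIm; apply: filterS2 => x /lim_E cR /lim_E cI.
  under eq_fun do rewrite sqr_nrm ReB ImB.
  rewrite sqr_nrm ReB ImB.
  have sq (u : nat -> R) (l c : R) : u m @[m --> \oo] --> l ->
      (u (n + k)%N - c) ^+ 2 @[k --> \oo] --> (l - c) ^+ 2.
    move=> ul; have ul' : u (n + k)%N @[k --> \oo] --> l.
      rewrite (_ : (fun k => u (n + k)%N) = [sequence u (k + n)%N]_k) ?cvg_shiftn//.
      by apply/funext => k /=; rewrite addnC.
    have h : u (n + k)%N - c @[k --> \oo] --> l - c.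
      by apply: cvgB => //; exact: cvg_cst.
    rewrite expr2 (_ : (fun k => _) =
      fun k => (u (n + k)%N - c) * (u (n + k)%N - c)); first exact: cvgM.
    by apply/funext => k; rewrite expr2.
  exact: cvgD (sq _ _ _ cR) (sq _ _ _ cI).
exists f => [|n]; last exact: (lim2 n).2.
have s0 : sqint (fun x => f x - f_ 0%N x).
  by split; [apply: cmeasB => //; exact: (sf _).1|exact: (lim2 0%N).1].
by have := sqintD s0 (sf 0%N); under eq_fun do rewrite subrK.
Qed.

Lemma clos2P A f : A `<=` sqint ->
  clos2 A f <-> sqint f /\ forall e, 0 < e -> exists2 g, A g &
    n2 (fun x => f x - g x) < e.
Proof.
move=> AL; rewrite /clos/=; split=> [[/Lp2P sf H]|[sf H]].
  split=> // e e0; have s0 : 0 < Num.sqrt e by rewrite sqrtr_gt0.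
  have [g Ag] := H _ s0; rewrite pnorm2_lt ?sqr_sqrtr ?ltW//; first by move=> fg; exists g.
  by apply: sqintB => //; exact: AL.
split; first exact/Lp2P.
move=> e e0; have e20 : 0 < e ^+ 2 by rewrite exprn_gt0.
have [g Ag fg] := H _ e20; exists g => //; rewrite pnorm2_lt//.
by apply: sqintB => //; exact: AL.
Qed.

(** The constant 10 is any number above [2 * (1 / 4 + 4)], which is what [L2_projection] gets from
    its two error terms. *)
Lemma ip_eq0_ler f g : sqint f -> sqint g ->
  (forall n, nrm (ip f g) ^+ 2 <= 10 * n2 g / 4 ^+ n) -> ip f g = 0.
Proof.
move=> sf sg /le0_geom; rewrite le_eqVlt ltNge sqr_ge0 orbF sqrf_eq0 nrm_eq0.
by move/eqP.
Qed.

Lemma L2_projection A f : A `<=` sqint -> subspace A -> clos2 A `<=` A ->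
  sqint f -> exists2 a, A a & forall g, A g -> ip (fun x => f x - a x) g = 0.
Proof.
move=> AL [A0 AD] Ac sf.
pose D := [set n2 (fun x => f x - a x) | a in A].
have hD : has_inf D.
  split; first by exists (n2 (fun x => f x - (0 : K -> R[i]) x)), 0.
  by exists 0 => _ [a _ <-]; exact: n2_ge0.
pose d := inf D.
have dle a : A a -> d <= n2 (fun x => f x - a x).
  by move=> Aa; apply: ge_inf; [exact: hD.2|exists a].
have AZ (c : R[i]) a : A a -> A (fun x => c * a x).
  move=> Aa; have := AD c _ _ Aa A0.
  by rewrite (_ : (fun x => _) = fun x => c * a x)//; apply/funext => x; rewrite addr0.
have ADD a b : A a -> A b -> A (fun x => a x + b x).
  move=> Aa Ab; have := AD 1 _ _ Aa Ab.
  by rewrite (_ : (fun x => _) = fun x => a x + b x)//; apply/funext => x; rewrite mul1r.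
(* The excess [4 ^ (-n) / 4] over the infimum is such that the parallelogram law bounds the squared
   increments of [a_] by [4 ^ (-n)], the rate required by [L2_complete]. *)
have ex n : {a | A a /\ n2 (fun x => f x - a x) < d + (4 ^+ n)^-1 / 4}.
  apply: cid; have e0 : 0 < (4 ^+ n)^-1 / 4 :> R.
    by rewrite divr_gt0// invr_gt0 exprn_gt0.
  have [_ [a Aa <-] ?] := inf_adherent e0 hD; by exists a.
pose a_ n := sval (ex n).
have Aa n : A (a_ n) := (svalP (ex n)).1.
have da n : n2 (fun x => f x - a_ n x) < d + (4 ^+ n)^-1 / 4 := (svalP (ex n)).2.
have sa n : sqint (a_ n) := AL _ (Aa n).
have sfa n : sqint (fun x => f x - a_ n x) by exact: sqintB.
have aS n : n2 (fun x => a_ n.+1 x - a_ n x) <= (4 ^+ n)^-1.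
  have := parallelogram (sfa n) (sfa n.+1).
  rewrite (_ : (fun x => f x - a_ n x - _) = fun x => a_ n.+1 x - a_ n x); last first.
    by apply/funext => x; ring.
  rewrite (_ : (fun x => f x - a_ n x + _) =
    fun x => 2 * (f x - 2^-1 * (a_ n x + a_ n.+1 x))); last first.
    by apply/funext => x; field.
  have Am : A (fun x => 2^-1 * (a_ n x + a_ n.+1 x)) by apply/AZ/ADD.
  rewrite n2Z; last by apply: sqintB => //; exact: AL.
  have -> : nrm (2 : R[i]) ^+ 2 = 4.
    rewrite -(rmorph_nat (real_complex R) 2) nrm_real ger0_norm//.
    by rewrite -natrX.
  have := dle _ Am; have := da n; have := da n.+1; rewrite exprS invfM.
  have : 0 < (4 ^+ n)^-1 :> R by rewrite invr_gt0 exprn_gt0.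
  set a := (4 ^+ n)^-1; lra.
have [a sqa lim] := L2_complete sa aS.
exists a.
  apply: Ac; apply/clos2P => //; split=> // e e0.
  have [n] : exists n, ~ (e <= 4 / 4 ^+ n).
    by apply: contrapT => H; move: e0; rewrite ltNge => /negP; apply;
      apply: (@le0_geom _ 4) => n; apply: contrapT => h; apply: H; exists n.
  move=> /negP; rewrite -ltNge => ne; exists (a_ n) => //.
  exact: le_lt_trans (lim n) ne.
move=> g Ag; have sg := AL _ Ag; apply: ip_eq0_ler => //; first exact: sqintB.
move=> n.
have sag : sqint (fun x => a_ n x - a x) by exact: sqintB.
have h1 : nrm (ip (fun x => f x - a_ n x) g) ^+ 2 <= ((4 ^+ n)^-1 / 4) * n2 g.
  have [g0|g0] := eqVneq (n2 g) 0.
    by rewrite g0 mulr0 -[leRHS](mulr0 (n2 (fun x => f x - a_ n x))) -g0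
      cauchy_schwarz.
  have gp : 0 < n2 g by rewrite lt_def g0 n2_ge0.
  (* [a_ n + c g] also lies in [A], so it improves on [a_ n] by less than the excess; for this
     optimal [c] the improvement is [|z| ^+ 2 / n2 g]. *)
  set z := ip _ g; pose c : R[i] := ((n2 g)^-1)%:C * z.
  have := dle _ (ADD _ _ (Aa n) (AZ c _ Ag)).
  rewrite (_ : (fun x => _) = fun x => (f x - a_ n x) - c * g x); last first.
    by apply/funext => x; rewrite opprD addrA.
  rewrite n2_subZ// -/z Normc.normcM nrm_real exprMn real_normK ?num_real//.
  have -> : complex.Re (c^* * z) = (n2 g)^-1 * nrm z ^+ 2.
    by rewrite /c sqr_nrm; case: (z) => p q; simpc; rewrite /=; ring.
  rewrite [X in _ + X](_ : _ = (n2 g)^-1 * nrm z ^+ 2); last by field.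
  have := da n; rewrite -ler_pdivrMr// [_ / n2 g]mulrC.
  set w := _^-1 * nrm z ^+ 2; lra.
have h2 : nrm (ip (fun x => a_ n x - a x) g) ^+ 2 <= (4 / 4 ^+ n) * n2 g.
  apply: le_trans (cauchy_schwarz sag sg) _; rewrite ler_wpM2r ?n2_ge0//.
  by rewrite n2BC.
rewrite (_ : (fun x => f x - a x) = fun x => (f x - a_ n x) + (a_ n x - a x)); last first.
  by apply/funext => x; rewrite addrA subrK.
rewrite ipDl//; apply: le_trans (sqr_nrmD_le _ _) _.
have : 0 <= n2 g / 4 ^+ n by rewrite divr_ge0 ?n2_ge0// exprn_ge0.
move: h1 h2; rewrite -!mulrA [_ * n2 g]mulrC; set b := (4 ^+ n)^-1.
set u := n2 g; nra.
Qed.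

End HilbertSpace.

(** * Characters and trigonometric polynomials *)

Section Translation.
Variables (R : realType) (G : zmodType).
Local Notation K := (dual R G).
Local Notation B := (borel_dual R G).
Local Notation rmeas := (@rmeas R G).
Implicit Types (l m : G) (x y z t : K) (s : seq (R[i] * G)).

Lemma continuous_rmeas (u : K -> R) : continuous u -> rmeas u.
Proof.
move=> cu; apply: (measurability _ (RGenOpens.measurableE R)).
move=> _ [_ [a [b ->] <-]]; rewrite setTI; apply: sub_sigma_algebra.
by apply: (@open_comp K R); [move=> x _; exact: cu|exact: itv_open].
Qed.

Lemma cmeas_chi l : cmeasurable (chi l : K -> R[i]).
Proof.
have H (T : R[i] -> R) : (forall a b, T (a - b) = T a - T b) ->
    (forall a, `|T a| <= nrm a) -> rmeas (fun x => T (chi l x)).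
  move=> TB Tn; apply: continuous_rmeas => x.
  have Fx : Filter (nbhs x) := nbhs_filter x.
  apply/(@cvgrPdist_lt R R^o) => e e0.
  have := @chi_continuous R G l x.
  move=> /(@cvgrPdist_lt R[i] R[i]^o)/(_ e%:C); rewrite ltcR => /(_ e0).
  apply: filterS => y; rewrite nrmE ltcR => /(le_lt_trans _); apply.
  by rewrite -TB.
split; apply: H => z.
- by move=> w; rewrite ReD ReN.
- exact: Re_le_nrm.
- by move=> w; rewrite ImD ImN.
- exact: Im_le_nrm.
Qed.

Lemma nrm_chi l x : nrm (chi l x) = 1.
Proof. by apply/norm1P; exact: chi_norm. Qed.

Lemma chi0l x : chi 0 x = 1.
Proof.
have c0 : chi 0 x != 0 by rewrite -nrm_eq0 nrm_chi oner_eq0.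
by apply: (mulfI c0); rewrite mulr1 -chiDl addr0.
Qed.

Lemma chiNl l x : chi (- l) x = (chi l x)^*.
Proof.
have c0 : chi l x != 0 by rewrite -nrm_eq0 nrm_chi oner_eq0.
apply: (mulfI c0); rewrite -chiDl subrr chi0l mulcJ nrm_chi expr1n//.
Qed.

Lemma chiNr l x : chi l (- x) = (chi l x)^*.
Proof. by rewrite chiN conjc_unit// nrm_chi. Qed.

Lemma chi0r l : chi l (0 : K) = 1.
Proof. by []. Qed.

Lemma shift_continuous x : continuous (fun y : K => x + y).
Proof.
move=> y; have Fy : Filter (nbhs y) := nbhs_filter y.
apply: dual_cvg => l; rewrite chiDr.
have cx : (fun=> chi l x : R[i]^o) @ nbhs y --> (chi l x : R[i]^o) by exact: cvg_cst.
exact: (@cvgM R[i] _ _ _ _ _ _ _ cx (@chi_continuous R G l y)).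
Qed.

Definition shift x (y : B) : B := x + (y : K).

Lemma measurable_shift x : measurable_fun [set: B] (shift x).
Proof.
apply: (@measurability _ _ B B _ _ (@open K)) => //.
move=> _ [A oA <-]; rewrite setTI; apply: sub_sigma_algebra.
by apply: (@open_comp K K (fun y => x + y)) => // y _; exact: shift_continuous.
Qed.

(** The list holds pairs of a coefficient and a frequency, repetitions allowed, so that sums and
    products are operations on lists with no normal form to maintain. *)
Definition tpoly s x : R[i] := \sum_(a <- s) a.1 * chi a.2 x.

Lemma tpoly_cst (c : R[i]) : tpoly [:: (c, 0)] = fun=> c.
Proof. by apply/funext => x; rewrite /tpoly big_seq1 chi0l mulr1. Qed.

Lemma tpoly_chi l : tpoly [:: (1, l)] = chi l.
Proof. by apply/funext => x; rewrite /tpoly big_seq1 mul1r. Qed.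

Lemma tpolyD s s' x : tpoly (s ++ s') x = tpoly s x + tpoly s' x.
Proof. by rewrite /tpoly big_cat. Qed.

Lemma tpolyZ (c : R[i]) s x :
  tpoly [seq (c * a.1, a.2) | a <- s] x = c * tpoly s x.
Proof.
by rewrite /tpoly big_map mulr_sumr; apply: eq_bigr => a _; rewrite mulrA.
Qed.

Lemma tpoly_mulchi l s x :
  tpoly [seq (a.1, l + a.2) | a <- s] x = chi l x * tpoly s x.
Proof.
by rewrite /tpoly big_map mulr_sumr; apply: eq_bigr => a _; rewrite chiDl mulrCA.
Qed.

Lemma tpolyM s s' : exists s'', tpoly s'' = fun x => tpoly s x * tpoly s' x.
Proof.
elim: s => [|a s [s'' ih]].
  by exists [::]; apply/funext => x; rewrite /tpoly !big_nil mul0r.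
exists ([seq (a.1 * b.1, b.2) | b <- [seq (b.1, a.2 + b.2) | b <- s']] ++ s'').
apply/funext => x; rewrite tpolyD tpolyZ tpoly_mulchi ih.
by rewrite [in RHS]/tpoly big_cons mulrDl mulrA.
Qed.

Lemma tpolyX s n : exists s', tpoly s' = fun x => tpoly s x ^+ n.
Proof.
elim: n => [|n [s' ih]].
  by exists [:: (1, 0)]; rewrite tpoly_cst.
have [s'' e] := tpolyM s s'; exists s''; rewrite e ih.
by apply/funext => x; rewrite exprS.
Qed.

Lemma cmeas_tpoly s : cmeasurable (tpoly s).
Proof.
rewrite /tpoly; elim: s => [|a s ih].
  by under eq_fun do rewrite big_nil; exact: cmeas_cst.
by under eq_fun do rewrite big_cons; apply/cmeasD/ih/cmeasZ/cmeas_chi.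
Qed.

Lemma tpoly_bounded s x : nrm (tpoly s x) <= \sum_(a <- s) nrm a.1.
Proof.
rewrite /tpoly; elim: s => [|a s ih]; first by rewrite !big_nil Normc.normc0.
rewrite !big_cons (le_trans (le_normcD _ _))// lerD// Normc.normcM nrm_chi.
by rewrite mulr1.
Qed.

End Translation.

(** * Haar measure: translations and mean values of characters *)

Section Haar.
Variables (R : realType) (G : zmodType).
Variable sigma : probability (borel_dual R G) R.
Hypothesis haar : is_haar sigma.
Local Notation K := (dual R G).
Local Notation B := (borel_dual R G).
Local Notation rmeas := (@rmeas R G).
Local Notation rint := (rint sigma).
Local Notation expect := (expect sigma).
Local Notation integ := (integ sigma).
Local Notation cint := (cintegral sigma).
Implicit Types (l m : G) (x y z t : K) (s : seq (R[i] * G)).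
Implicit Types (f g h : K -> R[i]) (u v : K -> R).

Lemma haar_shift x (A : set B) : measurable A ->
  sigma ((shift x) @^-1` A) = sigma A.
Proof.
move=> mA; have [H _ _] := haar; rewrite -(H (- x) A mA); congr (sigma _).
apply/seteqP; split=> y /= Ay; first by exists (x + y) => //; rewrite /shift addKr.
by case: Ay => z Az <-; rewrite /shift addNKr.
Qed.

Lemma rmeas_shift x u : rmeas u -> rmeas (fun y => u (x + y)).
Proof. by move=> mu; exact: (measurableT_comp mu (measurable_shift x)). Qed.

Lemma rint_shift x u : rint u -> rint (fun y => u (x + y)).
Proof.
move=> iu; have mu := rint_meas iu.
apply/integrableP; split; first by apply/measurable_EFinP; exact: rmeas_shift.
have [_] := integrableP _ _ _ iu; congr (_ < _)%E.
have mE : measurable_fun [set: B] (fun y : B => `|(u y)%:E|)%E.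
  by apply: measurableT_comp => //; exact/measurable_EFinP.
have E0 : {in [set: B], forall y, 0 <= `|(u y)%:E|}%E by [].
apply: etrans (ge0_integral_pushforward (measurable_shift x) sigma measurableT mE E0).
by apply/esym; apply: eq_measure_integral => [|mS A mA _];
  [exact: measurable_shift|exact: haar_shift].
Qed.

Lemma expect_shift x u : rint u -> expect (fun y => u (x + y)) = expect u.
Proof.
move=> iu; have mu := rint_meas iu.
have mE : measurable_fun [set: B] (EFin \o (u : B -> R)) by exact/measurable_EFinP.
congr fine; apply: etrans (esym (integral_pushforward (measurable_shift x) mE
  (rint_shift x iu) measurableT)) _.
by apply: eq_measure_integral => [|mS A mA _];
  [exact: measurable_shift|exact: haar_shift].
Qed.

Lemma cint_shift x f : integ f -> cint (fun y => f (x + y)) = cint f.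
Proof.
move=> fi; congr Complex.
  exact: (expect_shift x (integ_Re fi)).
exact: (expect_shift x (integ_Im fi)).
Qed.

Lemma integ_chi l : integ (chi l).
Proof.
by apply: (@integ_bounded _ _ _ _ 1) => [|x]; rewrite ?nrm_chi//; exact: cmeas_chi.
Qed.

(** Translation by [x] multiplies the integral by [chi l x], which differs from 1. *)
Lemma cint_chi l : (exists x : K, chi l x <> 1) -> cint (chi l) = 0.
Proof.
move=> [x x1]; have := cint_shift x (integ_chi l).
under eq_cint do rewrite chiDr; rewrite cintZ; last exact: integ_chi.
move/eqP; rewrite -subr_eq0 -[X in _ - X]mul1r -mulrBl mulf_eq0 subr_eq0.
by case/orP => /eqP.
Qed.

(* Otherwise the filter of conull sets would have no cluster point, since [K]
   is covered by the null sets [x + U]. *)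
Lemma haar_open_gt0 (U : set K) : open U -> U 0 -> (0 < sigma U)%E.
Proof.
move=> oU U0; rewrite lt0e measure_ge0 andbT; apply/eqP => sU0.
have PF : ProperFilter (almost_everywhere sigma : set_system K).
  exact: (ae_properfilter_algebraOfSetsType (sigmaT_gt0 sigma)).
have [x [_ xcl]] := @dual_compact R G _ PF (@filterT _ _ _).
pose V : set K := (fun y => - x + y) @^-1` U.
have oV : open V.
  by apply: (@open_comp K K (fun y => - x + y)) => // y _; exact: shift_continuous.
have V0 : sigma V = 0%E.
  by rewrite -sU0; apply: haar_shift; exact: sub_sigma_algebra.
have Vx : V x by rewrite /V/= addNr.
have nV : almost_everywhere sigma (~` V).
  by exists V; split=> //; [exact: sub_sigma_algebra|rewrite setCK].
by have [y []] := xcl _ _ nV (open_nbhs_nbhs (conj oV Vx)).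
Qed.

End Haar.

(** * Positive trigonometric kernels *)

Section Kernel.
Variables (R : realType) (G : zmodType).
Variable sigma : probability (borel_dual R G) R.
Hypothesis haar : is_haar sigma.
Local Notation K := (dual R G).
Local Notation B := (borel_dual R G).
Local Notation rmeas := (@rmeas R G).
Local Notation rint := (rint sigma).
Local Notation expect := (expect sigma).
Local Notation integ := (integ sigma).
Local Notation cint := (cintegral sigma).
Local Notation fourier := (fourier sigma).
Implicit Types (l m : G) (x y z t : K) (s : seq (R[i] * G)).
Implicit Types (f g h : K -> R[i]) (u v : K -> R).

Lemma tpoly_continuous s : continuous (tpoly s : K -> R[i]^o).
Proof.
move=> x; have Fx : Filter (nbhs x) := nbhs_filter x.
rewrite /tpoly; elim: s => [|a s ih].
  rewrite (_ : (fun x => _) = fun=> 0); first by exact: cvg_cst.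
  by apply/funext => y; rewrite big_nil.
rewrite (_ : (fun x => _) = fun x : K =>
    (a.1 * chi a.2 x) + \sum_(a <- s) a.1 * chi a.2 x); last first.
  by apply/funext => y; rewrite big_cons.
have ca : (fun=> a.1 : R[i]^o) @ nbhs x --> (a.1 : R[i]^o) by exact: cvg_cst.
have cb := @cvgM R[i] _ _ _ _ _ _ _ ca (@chi_continuous R G a.2 x).
by apply: (@cvgD R[i] R[i]^o); [exact: cb|exact: ih].
Qed.

Lemma Re_tpoly_continuous s : continuous (fun x : K => complex.Re (tpoly s x)).
Proof.
move=> x; have Fx : Filter (nbhs x) := nbhs_filter x.
apply/(@cvgrPdist_lt R R^o) => e e0; have := @tpoly_continuous s x.
move=> /(@cvgrPdist_lt R[i] R[i]^o)/(_ e%:C); rewrite ltcR => /(_ e0).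
apply: filterS => y; rewrite nrmE ltcR => /(le_lt_trans _); apply.
by rewrite -ReN -ReD; exact: Re_le_nrm.
Qed.

(** Each factor is the squared cosine of half the argument of [chi l x]: a trigonometric polynomial
    with values in [[0, 1]], equal to 1 exactly where [chi l x = 1]. High powers of the product
    therefore concentrate where all these characters are 1. *)
Definition peak (L : seq G) x : R := \prod_(l <- L) (nrm (1 + chi l x) / 2) ^+ 2.

Lemma nrm1Dchi l x :
  (nrm (1 + chi l x) / 2) ^+ 2 = 1 - nrm (1 - chi l x) ^+ 2 / 4.
Proof.
have := sqr_nrm (chi l x); rewrite nrm_chi expr1n expr_div_n !sqr_nrm.
by case: (chi l x) => a b /= ab; rewrite -natrX; lra.
Qed.

Lemma peak_tpoly L : exists s, tpoly s = fun x => (peak L x)%:C.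
Proof.
elim: L => [|l L [s ih]].
  by exists [:: (1, 0)]; rewrite tpoly_cst; apply/funext => x; rewrite /peak big_nil.
have [s' e] := tpolyM [:: ((2^-1)%:C, 0); ((4^-1)%:C, l); ((4^-1)%:C, - l)] s.
exists s'; rewrite e ih; apply/funext => x; rewrite /peak big_cons rmorphM.
congr (_ * _); rewrite /tpoly !big_cons big_nil chi0l chiNl.
rewrite expr_div_n sqr_nrm.
have := sqr_nrm (chi l x); rewrite nrm_chi expr1n.
by case: (chi l x) => a b /= ab; simpc; congr Complex; rewrite -?natrX; lra.
Qed.

Lemma peak_ge0 L x : 0 <= peak L x.
Proof. by apply: prodr_ge0 => l _; exact: sqr_ge0. Qed.

Lemma peak_le1 L x : peak L x <= 1.
Proof.
rewrite /peak; elim: L => [|l L ih]; first by rewrite big_nil.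
rewrite big_cons; apply: mulr_ile1 => //; first exact: sqr_ge0.
  by apply: prodr_ge0 => i _; exact: sqr_ge0.
by rewrite nrm1Dchi gerBl divr_ge0// sqr_ge0.
Qed.

Lemma peak_le L x l : l \in L -> nrm (1 - chi l x) ^+ 2 <= 4 * (1 - peak L x).
Proof.
move=> lL; suff : peak L x <= 1 - nrm (1 - chi l x) ^+ 2 / 4 by lra.
rewrite -nrm1Dchi /peak (big_rem l)//= ler_piMr ?sqr_ge0//.
exact: peak_le1.
Qed.

Lemma peak_even L x : peak L (- x) = peak L x.
Proof.
apply: eq_bigr => l _; rewrite chiNr; congr ((_ / _) ^+ _).
by rewrite -[RHS]nrm_conj rmorphD rmorph1.
Qed.

Lemma peak0 L : peak L 0 = 1.
Proof.
rewrite /peak big1// => l _; rewrite nrm1Dchi chi0r subrr Normc.normc0.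
by rewrite expr0n/= mul0r subr0.
Qed.

Lemma rmeas_peak L : rmeas (peak L).
Proof.
have [s e] := peak_tpoly L; have := (cmeas_tpoly s).1.
by rewrite e.
Qed.

Lemma rint_peakX L n : rint (fun x => peak L x ^+ n).
Proof.
apply: (@rint_bounded _ _ _ _ 1); first exact: rmeasX (rmeas_peak L).
move=> x; rewrite ger0_norm ?exprn_ge0 ?peak_ge0// exprn_ile1 ?peak_ge0//.
exact: peak_le1.
Qed.

Lemma le0_geomr (q c M : R) : 1 < q -> (forall n, q ^+ n * c <= M) -> c <= 0.
Proof.
move=> q1 H; rewrite leNgt; apply/negP => c0; have q0 : 0 < q by rewrite (lt_trans _ q1).
have qi : `|q^-1| < 1 by rewrite ger0_norm ?invr_ge0 ?ltW// invf_lt1.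
have M0 : 0 < M by rewrite (lt_le_trans _ (H 0%N))// expr0 mul1r.
have cM0 : 0 < c / M by rewrite divr_gt0.
have [n _ /(_ n (leqnn n))/=] := cvgr_lt _ (cvg_expr qi) _ cM0.
rewrite ltr_pdivlMr// exprVn mulrC ltr_pdivrMr ?exprn_gt0// mulrC => h.
by have := lt_le_trans h (H n); rewrite ltxx.
Qed.

(** If it failed for all [n], the moments would satisfy [m n.+1 <= (1 - d) * m n] and decay like
    [(1 - d) ^ n]. But [peak L > 1 - d / 2] on an open neighbourhood of 0, which has positive
    measure, and this keeps them above a positive constant times [(1 - d / 2) ^ n]. *)
Lemma peak_ratio L (d : R) : 0 < d -> d < 1 -> exists n,
  0 < expect (fun x => peak L x ^+ n) /\
  expect (fun x => peak L x ^+ n * (1 - peak L x)) <=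
    d * expect (fun x => peak L x ^+ n).
Proof.
move=> d0 d1; pose m n := expect (fun x => peak L x ^+ n).
pose U := [set x : K | 1 - d / 2 < peak L x].
have oU : open U.
  have [s e] := peak_tpoly L.
  have -> : U = (fun x : K => complex.Re (tpoly s x)) @^-1` [set r : R | 1 - d / 2 < r].
    by apply/seteqP; split => x /=; rewrite e.
  by apply: open_comp => [x _|]; [exact: Re_tpoly_continuous|exact: open_gt].
have U0 : U 0 by rewrite /U/= peak0; lra.
have mU : measurable (U : set B) by exact: sub_sigma_algebra.
pose c := fine (sigma U).
have cgt0 : 0 < c.
  by rewrite fine_gt0// (haar_open_gt0 haar oU U0)/= ltey_eq fin_num_measure.
have mU1 : rmeas (\1_U : K -> R) by exact: measurable_indic.
have iU : rint (\1_U : K -> R).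
  apply: (@rint_bounded _ _ _ _ 1) => // x.
  by rewrite indicE; case: (_ \in _); rewrite ?normr1 ?normr0.
have cE : expect (\1_U : K -> R) = c.
  by rewrite /expect /Rintegral integral_indic// setIT.
have mle n : (1 - d / 2) ^+ n * c <= m n.
  rewrite -cE -expectZ//; apply: le_expect; [exact: rintZ|exact: rint_peakX|].
  move=> x; rewrite indicE; case: (boolP (x \in U)) => xU.
    rewrite mulr1 lerXn2r ?nnegrE ?peak_ge0//; first by lra.
    by move: xU; rewrite inE => /ltW.
  by rewrite mulr0 exprn_ge0// peak_ge0.
have m0 n : 0 < m n by apply: lt_le_trans (mle n); rewrite mulr_gt0// exprn_gt0//; lra.
have mS n : expect (fun x => peak L x ^+ n * (1 - peak L x)) = m n - m n.+1.
  rewrite -expectB; [|exact: rint_peakX|exact: rint_peakX].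
  by apply: eq_expect => x; rewrite mulrBr mulr1 exprSr.
apply: contrapT => H.
have mlt n : m n.+1 <= (1 - d) * m n.
  rewrite leNgt; apply/negP => h; apply: H; exists n; split; first exact: m0.
  by rewrite mS -/(m n); lra.
have mn n : m n <= (1 - d) ^+ n.
  elim: n => [|n ih]; first by rewrite /m expr0 (eq_expect _ (v := fun=> 1)) ?expect_cst.
  by apply: le_trans (mlt n) _; rewrite exprS ler_wpM2l//; lra.
have : c <= 0; last by rewrite leNgt cgt0.
have d1' : 0 < 1 - d by lra.
apply: (@le0_geomr ((1 - d / 2) / (1 - d)) c 1); first by rewrite ltr_pdivlMr//; lra.
move=> n; rewrite expr_div_n mulrAC ler_pdivrMr ?exprn_gt0// mul1r.
exact: le_trans (mle n) (mn n).
Qed.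

(* A Fejer-like kernel: a normalized high power of the trigonometric polynomial
   [peak L], which concentrates near the kernel of the characters in [L]. *)
Lemma trig_kernel (L : seq G) (e : R) : 0 < e -> exists s (tau : K -> R),
  [/\ forall x, tpoly s x = (tau x)%:C, forall x, 0 <= tau x,
      forall x, tau (- x) = tau x, expect tau = 1 &
      expect (fun x => tau x * \sum_(l <- L) nrm (1 - chi l x) ^+ 2) <= e].
Proof.
move=> e0; pose k : R := 4 * (size L)%:R.
have k0 : 0 <= k by rewrite mulr_ge0.
(* Summing [peak_le] over [L] bounds the quantity to control by [k * (1 - peak L)]. The denominator
   [k + 1] is nonzero even for empty [L], and [1 / 2] ensures [d < 1]. *)
pose d := Num.min (1 / 2) (e / (k + 1)).
have d0 : 0 < d by rewrite lt_min !divr_gt0// ltr_wpDl.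
have d1 : d < 1 by rewrite (@le_lt_trans _ _ (1 / 2))// ?ge_min ?lexx//; lra.
have [n [m0 mle]] := peak_ratio L d0 d1; set m := expect _ in m0 mle.
have [s es] := peak_tpoly L; have [s' es'] := tpolyX s n.
have ip0 := rint_peakX L n.
have ip1 : rint (fun x => peak L x ^+ n * (1 - peak L x)).
  have := rintB (rint_peakX L n) (rint_peakX L n.+1).
  by under eq_fun do rewrite exprSr -[X in X - _]mulr1 -mulrBr.
have t0 x : 0 <= m^-1 * peak L x ^+ n.
  by apply: mulr_ge0; [rewrite invr_ge0 ltW|apply: exprn_ge0; exact: peak_ge0].
exists [seq ((m^-1)%:C * a.1, a.2) | a <- s'], (fun x => m^-1 * peak L x ^+ n).
split.
- by move=> x; rewrite tpolyZ es' es rmorphM rmorphXn.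
- by move=> x; exact: t0.
- by move=> x; rewrite peak_even.
- by rewrite expectZ// mulVf// gt_eqF.
apply: (@le_trans _ _
    (expect (fun x => (m^-1 * k) * (peak L x ^+ n * (1 - peak L x))))).
  have le x : m^-1 * peak L x ^+ n * \sum_(l <- L) nrm (1 - chi l x) ^+ 2 <=
      m^-1 * k * (peak L x ^+ n * (1 - peak L x)).
    have h : \sum_(l <- L) nrm (1 - chi l x) ^+ 2 <= k * (1 - peak L x).
      apply: (@le_trans _ _ (\sum_(l <- L) 4 * (1 - peak L x))).
        by rewrite !big_seq; apply: ler_sum => l lL; exact: peak_le.
      by rewrite big_const_seq count_predT iter_addr_0 -[leLHS]mulr_natl mulrA [_ * 4]mulrC.
    apply: le_trans (ler_wpM2l (t0 x) h) _.
    by rewrite le_eqVlt; apply/orP; left; apply/eqP; ring.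
  apply: le_expect => //; last exact: rintZ.
  apply: rint_le (rintZ (m^-1 * k) ip1).
    apply: rmeasM; first by apply: rmeasM; [exact: rmeas_cst|exact: rint_meas ip0].
    elim: (L) => [|l L' ih]; first by under eq_fun do rewrite big_nil; exact: rmeas_cst.
    under eq_fun do rewrite big_cons; apply: rmeasD => //; apply: rmeas_nrm2.
    by apply: cmeasB; [exact: cmeas_cst|exact: cmeas_chi].
  move=> x; rewrite ger0_norm//; apply: mulr_ge0; first exact: t0.
  by apply: sumr_ge0 => l _; exact: sqr_ge0.
rewrite expectZ// -mulrA mulrCA; apply: (@le_trans _ _ (k * (m^-1 * (d * m)))).
  by rewrite !ler_wpM2l// invr_ge0 ltW.
have -> : k * (m^-1 * (d * m)) = k * d by field; rewrite gt_eqF.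
apply: (@le_trans _ _ ((k + 1) * (e / (k + 1)))).
  by rewrite ler_pM ?(ltW d0) ?lerDl// ge_min lexx orbT.
by rewrite mulrC divfK// gt_eqF// ltr_wpDl.
Qed.

(** The convolution of [tpoly s] with [f], given by its coefficients: it is a trigonometric
    polynomial by construction, and [convsE] recovers the integral form. *)
Definition convs s f := [seq (a.1 * fourier f a.2, a.2) | a <- s].

Lemma tpoly_sub s x y :
  tpoly s (x - y) = \sum_(a <- s) (a.1 * chi a.2 x) * conjc (chi a.2 y).
Proof. by apply: eq_bigr => a _; rewrite chiDr chiNr mulrA. Qed.

Lemma integ_mulchi f l : integ f -> integ (fun x => f x * (chi l x)^*).
Proof.
move=> fi; apply: (integM_bounded (M := 1)) fi _ _; first exact/cmeasJ/cmeas_chi.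
by move=> x; rewrite nrm_conj nrm_chi.
Qed.

Lemma convsE s f x : integ f ->
  tpoly (convs s f) x = cint (fun y => tpoly s (x - y) * f y).
Proof.
move=> fi; rewrite (eq_cint _ (g := fun y =>
    \sum_(a <- s) (a.1 * chi a.2 x) * (f y * conjc (chi a.2 y)))); last first.
  move=> y; rewrite tpoly_sub mulr_suml; apply: eq_bigr => a _.
  by rewrite -mulrA [conjc _ * _]mulrC.
rewrite cint_sum => [|a]; last by apply: integZ; exact: integ_mulchi.
rewrite /tpoly big_map; apply: eq_bigr => a _ /=.
by rewrite (cintZ _ (integ_mulchi a.2 fi)); exact: mulrAC.
Qed.

End Kernel.

(** * Approximation of indicators of open sets *)

Section Approximation.
Variables (R : realType) (G : zmodType).
Variable sigma : probability (borel_dual R G) R.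
Hypothesis haar : is_haar sigma.
Local Notation K := (dual R G).
Local Notation B := (borel_dual R G).
Local Notation rmeas := (@rmeas R G).
Local Notation rint := (rint sigma).
Local Notation expect := (expect sigma).
Local Notation integ := (integ sigma).
Local Notation sqint := (sqint sigma).
Local Notation n2 := (n2 sigma).
Local Notation cint := (cintegral sigma).
Local Notation fourier := (fourier sigma).
Local Notation convs := (convs sigma).
Implicit Types (l m : G) (x y z t : K) (s : seq (R[i] * G)).
Implicit Types (f g h : K -> R[i]) (u v : K -> R) (A C U : set K).

Section WithKernel.
Variables (s : seq (R[i] * G)) (tau : K -> R).
Hypotheses (sE : forall x, tpoly s x = (tau x)%:C) (tau0 : forall x, 0 <= tau x).
Hypotheses (tau_even : forall x, tau (- x) = tau x) (tau1 : expect tau = 1).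

Lemma rmeas_tau : rmeas tau.
Proof.
rewrite (_ : tau = fun x => complex.Re (tpoly s x)); first exact: (cmeas_tpoly s).1.
by apply/funext => x; rewrite sE.
Qed.

Lemma tau_bounded x : tau x <= \sum_(a <- s) nrm a.1.
Proof.
have := tpoly_bounded s x; rewrite sE nrm_real; apply: le_trans.
exact: ler_norm.
Qed.

Lemma rint_tau : rint tau.
Proof.
by apply: rint_bounded rmeas_tau _ => x; rewrite ger0_norm//; exact: tau_bounded.
Qed.

(** Evenness of the kernel turns the reflection [y |-> x - y] into a translation, the symmetry of
    [sigma] that [is_haar] provides. *)
Lemma tau_subC x y : tau (x - y) = tau (- x + y).
Proof. by rewrite -tau_even opprB addrC. Qed.

Lemma rmeas_tau_sub x : rmeas (fun y => tau (x - y)).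
Proof. by under eq_fun do rewrite tau_subC; exact: rmeas_shift rmeas_tau. Qed.

Lemma rint_tau_sub x : rint (fun y => tau (x - y)).
Proof. by under eq_fun do rewrite tau_subC; exact: rint_shift rint_tau. Qed.

Lemma expect_tau_sub x : expect (fun y => tau (x - y)) = 1.
Proof.
rewrite (eq_expect _ (v := fun y => tau (- x + y))) => [|y]; last exact: tau_subC.
by rewrite expect_shift// rint_tau.
Qed.

Lemma rint_tauM x u : rint u -> rint (fun y => tau (x - y) * u y).
Proof.
move=> iu; apply: rint_le (rintZ (\sum_(a <- s) nrm a.1) (rint_norm iu)).
  by apply: rmeasM; [exact: rmeas_tau_sub|exact: rint_meas iu].
by move=> y; rewrite normrM ler_wpM2r// ger0_norm//; exact: tau_bounded.
Qed.

Lemma integ_tauM x f : integ f -> integ (fun y => (tau (x - y))%:C * f y).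
Proof.
move=> [mf fi]; apply: integ_le (rint_tauM x fi) _.
  by apply: cmeasM => //; apply: cmeas_real; exact: rmeas_tau_sub.
by move=> y; rewrite Normc.normcM nrm_real ger0_norm.
Qed.

Lemma convs_tau f x : integ f ->
  tpoly (convs s f) x = cint (fun y => (tau (x - y))%:C * f y).
Proof. by move=> fi; rewrite convsE//; apply: eq_cint => y; rewrite sE. Qed.

Lemma convs_shift f x : integ f ->
  tpoly (convs s f) x = cint (fun t => (tau t)%:C * f (x + t)).
Proof.
move=> fi; rewrite convs_tau// -(cint_shift haar x)//; last exact: integ_tauM.
by apply: eq_cint => t; rewrite tau_subC addKr.
Qed.

Lemma convs_bounded f (C : R) x : cmeasurable f ->
  (\forall y \ae sigma, nrm (f y) <= C) -> nrm (tpoly (convs s f) x) <= C.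
Proof.
move=> mf fC; have fi : integ f.
  apply: (@Lp_integ _ _ _ _ +oo%E); first exact: leey.
  by apply/LpyP; split=> //; exists C.
rewrite convs_tau//; apply: le_trans (nrm_cint (integ_tauM x fi)) _.
rewrite -[leRHS]mulr1 -(expect_tau_sub x) -expectZ; last exact: rint_tau_sub.
apply: ae_le_expect; first exact: (integ_tauM x fi).2.
  by apply: rintZ; exact: rint_tau_sub.
apply: filterS fC => y fC; rewrite Normc.normcM nrm_real ger0_norm// mulrC.
by rewrite ler_wpM2r.
Qed.

Lemma convs_chi l x : tpoly (convs s (chi l)) x =
  chi l x * cint (fun t => (tau t)%:C * chi l t).
Proof.
rewrite convs_shift; last exact: integ_chi.
rewrite -cintZ; last first.
  by apply: (integM_bounded (M := 1)) (integ_real rint_tau) (@cmeas_chi R G l) _ => t;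
    rewrite nrm_chi.
by apply: eq_cint => t; rewrite chiDr mulrCA.
Qed.

Lemma tau_chi_near1 l : nrm (1 - cint (fun t => (tau t)%:C * chi l t)) <=
  expect (fun t => tau t * nrm (1 - chi l t)).
Proof.
have i1 := integ_real rint_tau.
have i2 : integ (fun t => (tau t)%:C * chi l t).
  by apply: (integM_bounded (M := 1)) i1 (@cmeas_chi R G l) _ => t; rewrite nrm_chi.
rewrite -[X in X - _](_ : cint (fun t => (tau t)%:C) = 1); last first.
  by rewrite cint_real tau1.
rewrite -cintB//; apply: le_trans (nrm_cint (integB i1 i2)) _.
rewrite le_eqVlt; apply/orP; left; apply/eqP; apply: eq_expect => t.
by rewrite -[X in X - _]mulr1 -mulrBr Normc.normcM nrm_real ger0_norm.
Qed.

(* Jensen's inequality for the probability [tau (x - y) dy], integrated in [x];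
   no Fubini is needed, since [tau (x - y)] is a sum of products. *)
Lemma convs_contract f : sqint f -> n2 (tpoly (convs s f)) <= n2 f.
Proof.
move=> sf; have fi := sqint_integ sf.
pose F x : R[i] := (nrm (f x) ^+ 2)%:C.
have Fi : integ F by exact: integ_real sf.2.
have FE x : complex.Re (tpoly (convs s F) x) =
    expect (fun y => tau (x - y) * nrm (f y) ^+ 2).
  rewrite convs_tau// (eq_cint _ (g := fun y => (tau (x - y) * nrm (f y) ^+ 2)%:C)).
    by rewrite cint_real.
  by move=> y; rewrite rmorphM.
have le x : nrm (tpoly (convs s f) x) ^+ 2 <= complex.Re (tpoly (convs s F) x).
  rewrite FE; set z := tpoly _ x.
  have zE : z = cint (fun y => (tau (x - y))%:C * f y) by exact: convs_tau.
  have i1 := rint_tauM x sf.2.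
  have i2 := integ_tauM x fi; have i3 := integ_Re (integZ (z^*) i2).
  (* The variance of [f] under the probability [tau (x - y) dy], whose mean is [z]; expanding it
     bounds [|z| ^+ 2] by the mean of [|f| ^+ 2]. *)
  have : 0 <= expect (fun y => tau (x - y) * nrm (f y - z) ^+ 2).
    by apply: expect_ge0 => y; rewrite mulr_ge0// sqr_ge0.
  rewrite (eq_expect _ (v := fun y => (tau (x - y) * nrm (f y) ^+ 2 -
      2 * complex.Re (z^* * ((tau (x - y))%:C * f y))) +
      nrm z ^+ 2 * tau (x - y))); last first.
    move=> y; rewrite !sqr_nrm; case: (f y) => a b; case: (z) => c d; simpc.
    by rewrite /=; ring.
  rewrite expectD; [|by apply: rintB => //; exact: rintZ|
    by apply: rintZ; exact: rint_tau_sub].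
  rewrite expectB//; last exact: rintZ.
  rewrite !expectZ ?expect_tau_sub//; last exact: rint_tau_sub.
  have -> : expect (fun y => complex.Re (z^* * ((tau (x - y))%:C * f y))) =
      complex.Re (cint (fun y => z^* * ((tau (x - y))%:C * f y))) by [].
  rewrite cintZ// -zE [z^* * z]mulrC mulcJ /=; lra.
have ti g : integ (tpoly (convs s g)).
  apply: (@integ_bounded _ _ _ _ (\sum_(a <- convs s g) nrm a.1)).
    exact: cmeas_tpoly.
  exact: tpoly_bounded.
apply: (@le_trans _ _ (expect (fun x => complex.Re (tpoly (convs s F) x)))).
  apply: le_expect => //; last exact: integ_Re.
  apply: (proj2 (@sqint_bounded _ _ _ _ (\sum_(a <- convs s f) nrm a.1) _ _)).
    exact: cmeas_tpoly.
  exact: tpoly_bounded.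
have -> : expect (fun x => complex.Re (tpoly (convs s F) x)) =
  complex.Re (cint (tpoly (convs s F))) by [].
(* Either [chi l] has mean 0, or it is identically 1 and the coefficient at [l] is the mean of [F].
   In the integral of the convolution every coefficient of [F] may thus be replaced by the one at 0,
   and the integral is the mean of [F] times that of [tau]. *)
have chi_int l : fourier F l * cint (chi l) = fourier F 0 * cint (chi l).
  have [H|H] := pselect (exists x : K, chi l x <> 1).
    by rewrite (cint_chi haar H) !mulr0.
  congr (_ * _); apply: eq_cint => x; congr (_ * _^*); rewrite chi0l.
  by apply: contrapT => h; apply: H; exists x.
have ci (g : G -> R[i]) r : cint (fun x => \sum_(a <- r) (a.1 * g a.2) * chi a.2 x) =
    \sum_(a <- r) (a.1 * g a.2) * cint (chi a.2).
  rewrite cint_sum => [|a]; last exact: integZ (integ_chi _ _).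
  by apply: eq_bigr => a _; rewrite cintZ//; exact: integ_chi.
have -> : cint (tpoly (convs s F)) = fourier F 0 * cint (tpoly s).
  rewrite (eq_cint _ (g := fun x => \sum_(a <- s) (a.1 * fourier F a.2) * chi a.2 x)).
    rewrite ci (eq_cint _ (g := fun x => \sum_(a <- s) (a.1 * 1) * chi a.2 x)).
      rewrite (ci (fun=> 1)) mulr_sumr; apply: eq_bigr => a _.
      by rewrite -mulrA chi_int mulr1 mulrCA.
    by move=> x; apply: eq_bigr => a _; rewrite mulr1.
  by move=> x; rewrite /tpoly big_map.
have -> : cint (tpoly s) = 1.
  by under eq_cint do rewrite sE; rewrite cint_real tau1.
rewrite mulr1 /fourier (eq_cint _ (g := F)).
  by rewrite /F cint_real.
by move=> x; rewrite chi0l -[RHS]mulr1; congr (_ * _); exact: conjc1.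
Qed.

End WithKernel.

(** The sets cut out by finitely many characters form a filter base; along its filter every [chi l]
    converges to [chi l x], so the filter converges to [x] by [dual_cvg]. *)
Lemma nbhs_chi U x : open U -> U x -> exists (L : seq G) (r : R), 0 < r /\
  forall y, (forall l, l \in L -> nrm (chi l y - chi l x) < r) -> U y.
Proof.
move=> oU Ux.
pose F := filter_from [set Lr : seq G * R | 0 < Lr.2]
  (fun Lr => [set y : K | forall l, l \in Lr.1 -> nrm (chi l y - chi l x) < Lr.2]).
have FF : Filter F.
  apply: filter_from_filter; first by exists ([::], 1) => /=.
  move=> [L r] [L' r'] /= r0 r0'; exists (L ++ L', Num.min r r') => /=.
    by rewrite lt_min r0.
  move=> y /= H; split=> l lL.
    by have := H l; rewrite mem_cat lL lt_min => /(_ isT)/andP[].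
  by have := H l; rewrite mem_cat lL orbT lt_min => /(_ isT)/andP[].
have Fx : F --> x.
  apply: dual_cvg => l; apply/(@cvgrPdist_lt R[i] R[i]^o) => -[e e'].
  rewrite ltcE/= => /andP[/eqP -> e0]; exists ([:: l], e) => //= y /(_ l).
  by rewrite mem_head nrmBC => /(_ isT); rewrite nrmE ltcR.
have [[L r] /= r0 H] := Fx _ (open_nbhs_nbhs (conj oU Ux)).
by exists L, r.
Qed.

(** A Lebesgue number for [C] inside [U]. If there were none, the points of [C] violating the
    conclusion for [(L, r)] would generate a proper filter; at a cluster point of it in [C], two
    steps of size [r / 2] contradict [nbhs_chi] with radius [r]. *)
Lemma lebesgue_chi C U : compact C -> open U -> C `<=` U ->
  exists (L : seq G) (r : R), 0 < r /\ forall x y, C x ->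
    (forall l, l \in L -> nrm (chi l y - chi l x) < r) -> U y.
Proof.
move=> cC oU CU; apply: contrapT => H.
pose F := filter_from [set Lr : seq G * R | 0 < Lr.2]
  (fun Lr => [set x : K | C x /\ exists2 y, ~ U y &
     forall l, l \in Lr.1 -> nrm (chi l y - chi l x) < Lr.2]).
have PF : ProperFilter F.
  apply: filter_from_proper; first apply: filter_from_filter.
  - by exists ([::], 1) => /=.
  - move=> [L r] [L' r'] /= r0 r0'; exists (L ++ L', Num.min r r') => /=.
      by rewrite lt_min r0.
    move=> x /= [Cx [y Uy Hy]]; split; split=> //; exists y => // l lL.
      by have := Hy l; rewrite mem_cat lL lt_min => /(_ isT)/andP[].
    by have := Hy l; rewrite mem_cat lL orbT lt_min => /(_ isT)/andP[].
  - move=> [L r] /= r0; apply: contrapT => H'; apply: H; exists L, r; split=> //.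
    move=> x y Cx Hy; apply: contrapT => Uy; apply: H'; exists x; split=> //.
    by exists y.
have FC : F C by exists ([::], 1) => //= x [].
have [x [Cx xcl]] := cC F PF FC.
have [L [r [r0 Hx]]] := nbhs_chi oU (CU _ Cx).
have r20 : 0 < r / 2 by rewrite divr_gt0.
pose V := [set z : K | forall l, l \in L -> nrm (chi l z - chi l x) < r / 2].
have nV : nbhs x V.
  have Fx : Filter (nbhs x) := nbhs_filter x.
  have : \forall z \near x, forall l, l \in L -> nrm (chi l z - chi l x) < r / 2.
    elim: (L) => [|l L' ih]; first by apply: (@filterE _ _ Fx) => z l; rewrite in_nil.
    have := @chi_continuous R G l x.
    move=> /(@cvgrPdist_lt R[i] R[i]^o)/(_ (r / 2)%:C); rewrite ltcR => /(_ r20).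
    move: ih; apply: filterS2 => z Hz; rewrite nrmE ltcR nrmBC => hz m.
    by rewrite inE => /orP[/eqP ->//|/Hz].
  exact.
have FE : F [set z : K | C z /\ exists2 y, ~ U y &
     forall l, l \in L -> nrm (chi l y - chi l z) < r / 2] by exists (L, r / 2).
have [z [[Cz [y Uy Hy]] Vz]] := xcl _ _ FE nV.
apply: Uy; apply: Hx => l lL.
rewrite -(subrK (chi l z) (chi l y)) -addrA (splitr r).
by apply: le_lt_trans (le_normcD _ _) _; rewrite ltrD//; [exact: Hy|exact: Vz].
Qed.

Lemma open_chi_ball C (L : seq G) (r : R) :
  open [set y : K | exists2 x, C x & forall l, l \in L -> nrm (chi l y - chi l x) < r].
Proof.
rewrite openE => y [x Cx Hy]; rewrite /interior.
have Fy : Filter (nbhs y) := nbhs_filter y.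
suff : \forall z \near y, forall l, l \in L -> nrm (chi l z - chi l x) < r.
  by apply: filterS => z Hz; exists x.
elim: L Hy => [|l L ih] Hy; first by apply: (@filterE _ _ Fy) => z l; rewrite in_nil.
have {}ih : \forall z \near y, forall l, l \in L -> nrm (chi l z - chi l x) < r.
  by apply: ih => m mL; apply: Hy; rewrite inE mL orbT.
have lr : 0 < r - nrm (chi l y - chi l x) by rewrite subr_gt0 Hy// mem_head.
have := @chi_continuous R G l y.
move=> /(@cvgrPdist_lt R[i] R[i]^o)/(_ (r - nrm (chi l y - chi l x))%:C).
rewrite ltcR => /(_ lr); move: ih; apply: filterS2 => z Hz.
rewrite nrmE ltcR ltrBrDr [nrm (_ - chi l z)]nrmBC => hz m; rewrite inE => /orP[/eqP ->|/Hz//].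
rewrite -(subrK (chi l y) (chi l z)) -addrA.
exact: le_lt_trans (le_normcD _ _) hz.
Qed.

Lemma n2_indic A : measurable (A : set B) -> n2 (fun x => (\1_A x)%:C) = fine (sigma A).
Proof.
move=> mA; have -> : sigma A = (\int[sigma]_(x in [set: B]) (\1_(A : set B) x)%:E)%E.
  by rewrite integral_indic// setIT.
apply: eq_expect => x; rewrite nrm_real indicE.
by case: (_ \in _); rewrite ?normr1 ?normr0 ?expr1n ?expr0n.
Qed.

Lemma rmeas_indic A : measurable (A : set B) -> rmeas (\1_A : K -> R).
Proof. by move=> mA; exact: measurable_indic. Qed.

Lemma indic_01 A x : 0 <= (\1_A x : R) /\ (\1_A x : R) <= 1.
Proof. by rewrite indicE; case: (_ \in _). Qed.

(** Convolve the indicator of [E], a neighbourhood of a compact [C] filling most of [U], with a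
    kernel concentrated near 0. The result lies in [[0, 1]] and is within [d'] of 1 on [C] and of 0
    off [U]. The error is then at most 1 everywhere, and its square at most [d'] plus the indicator
    of the part of [U] off [C], of total mean at most [d / 2 + d / 2]. *)
Lemma open_approx U (d : R) : open U -> 0 < d -> exists s,
  (forall x, nrm ((\1_U x)%:C - tpoly s x) <= 1) /\
  n2 (fun x => (\1_U x)%:C - tpoly s x) <= d.
Proof.
move=> oU d0; have mU : measurable (U : set B) by exact: sub_sigma_algebra.
have [_ _ /(_ U oU) innerU] := haar.
have [C [cC CU sC]] : exists C, [/\ compact C, C `<=` U &
    measurable (C : set B) /\ fine (sigma (U `\` C)) <= d / 2].
  have d20 : 0 < d / 2 by rewrite divr_gt0.
  have : ((fine (sigma U))%:E - (d / 2)%:E < ereal_sup [set sigma C | C in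
      [set C : set K | compact C /\ C `<=` U]])%E.
    rewrite -innerU -[ltRHS]fineK ?fin_num_measure//.
    by rewrite -EFinB lte_fin ltrBlDr ltrDl.
  move=> /ereal_sup_gt[_ [C [cC CU] <-]] h; exists C; split=> //.
  have mC : measurable (C : set B).
    rewrite -[C]setCK; apply: measurableC; apply: sub_sigma_algebra.
    by apply: closed_openC; apply: compact_closed cC; exact: dual_hausdorff.
  split=> //; rewrite (measureD (mu := sigma))//; last first.
    by rewrite ltey_eq fin_num_measure.
  rewrite (_ : (U : set B) `&` C = C); last exact/setIidPr.
  rewrite fineB ?fin_num_measure//; move: h.
  rewrite -[X in (_ < X)%E -> _]fineK ?fin_num_measure// -EFinB lte_fin; lra.
have [L [r [r0 HL]]] := lebesgue_chi cC oU CU.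
pose r2 := r / 2; have r20 : 0 < r2 by rewrite divr_gt0.
(* Half the radius on each side: a translation moving the characters of [L] by less than [r / 2]
   keeps a point of [C] inside [E], and cannot bring a point off [U] into [E]. *)
pose E := [set y : K | exists2 x, C x & forall l, l \in L -> nrm (chi l y - chi l x) < r2].
have oE : open E by exact: open_chi_ball.
have mE : measurable (E : set B) by exact: sub_sigma_algebra.
pose d' := Num.min 1 (d / 2).
have d'0 : 0 < d' by rewrite lt_min ltr01 divr_gt0.
have d'1 : d' <= 1 by rewrite ge_min lexx.
have d'd : d' <= d / 2 by rewrite ge_min lexx orbT.
have e0 : 0 < d' * r2 ^+ 2 by rewrite mulr_gt0// exprn_gt0.
have [s [tau [sE tau0 tau_even tau1 tauL]]] := trig_kernel haar L e0.
have itau := rint_tau sE tau0.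
pose Q t := \sum_(l <- L) nrm (1 - chi l t) ^+ 2.
have Q0 t : 0 <= Q t by apply: sumr_ge0 => l _; exact: sqr_ge0.
have mQ : rmeas Q.
  rewrite /Q; elim: (L) => [|l L' ih].
    by under eq_fun do rewrite big_nil; exact: rmeas_cst.
  under eq_fun do rewrite big_cons; apply: rmeasD => //; apply: rmeas_nrm2.
  by apply: cmeasB; [exact: cmeas_cst|exact: cmeas_chi].
(* Chebyshev's inequality: a translation [t] that is not small costs at least [r2 ^+ 2] in [Q],
   which is why the kernel was requested with the bound [d' * r2 ^+ 2]. *)
have QL t : (exists2 l, l \in L & r2 <= nrm (1 - chi l t)) -> 1 <= r2 ^- 2 * Q t.
  move=> [l lL hl]; rewrite mulrC ler_pdivlMr ?exprn_gt0// mul1r.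
  rewrite /Q (big_rem l)//=; apply: ler_wpDr.
    by apply: sumr_ge0 => m _; exact: sqr_ge0.
  by rewrite ler_sqr ?nnegrE ?nrm_ge0// ltW.
have iE : integ (fun x => (\1_E x)%:C).
  apply: integ_real; apply: (@rint_bounded _ _ _ _ 1); first exact: rmeas_indic.
  by move=> x; have [? ?] := indic_01 E x; rewrite ger0_norm.
have iQ : rint (fun t => tau t * Q t).
  apply: (@rint_bounded _ _ _ _ ((\sum_(a <- s) nrm a.1) * (\sum_(l <- L) 4))).
    by apply: rmeasM => //; exact: rint_meas itau.
  move=> t; rewrite ger0_norm ?mulr_ge0// ler_pM//.
    exact: (tau_bounded sE).
  apply: ler_sum => l _; have -> : 4 = 2 ^+ 2 :> R by rewrite -natrX.
  rewrite ler_sqr ?nnegrE ?nrm_ge0// (le_trans (le_normcD _ _))//.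
  by rewrite normcN nrm_chi Normc.normc1.
pose g x := expect (fun t => tau t * \1_E (x + t)).
have itE x : rint (fun t => tau t * \1_E (x + t)).
  apply: (rint_le _ _ itau).
    apply: rmeasM; first exact: rint_meas itau.
    by apply: (rmeas_shift x); exact: rmeas_indic.
  move=> t; have [h0 h1] := indic_01 E (x + t).
  by rewrite ger0_norm ?mulr_ge0// ler_piMr.
have gE x : tpoly (convs s (fun x => (\1_E x)%:C)) x = (g x)%:C.
  rewrite (convs_shift sE tau0 tau_even)// -cint_real.
  by apply: eq_cint => t; rewrite rmorphM.
have g0 x : 0 <= g x.
  by apply: expect_ge0 => t; rewrite mulr_ge0//; have [] := indic_01 E (x + t).
have g1 x : g x <= 1.
  rewrite -tau1; apply: le_expect => // t; have [_ h1] := indic_01 E (x + t).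
  by rewrite ler_piMr.
have iQ' : rint (fun t => tau t * (r2 ^- 2 * Q t)).
  by under eq_fun do rewrite mulrCA; exact: rintZ.
have Qd : expect (fun t => tau t * (r2 ^- 2 * Q t)) <= d'.
  rewrite (eq_expect _ (v := fun t => r2 ^- 2 * (tau t * Q t))) => [|t]; last first.
    by rewrite mulrCA.
  rewrite expectZ// mulrC ler_pdivrMr ?exprn_gt0//.
have near_dist (x t : K) l : nrm (chi l (x + t) - chi l x) = nrm (1 - chi l t).
  by rewrite chiDr -[X in _ - X]mulr1 -mulrBr Normc.normcM nrm_chi mul1r nrmBC.
have gC x : C x -> 1 - g x <= d'.
  move=> Cx; apply: le_trans Qd; rewrite -tau1 -expectB//.
  apply: le_expect => //; first exact: rintB.
  move=> t; rewrite -[X in X - _]mulr1 -mulrBr ler_wpM2l// indicE.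
  case: (boolP (_ \in E)) => [_|xtE]; rewrite ?subrr ?subr0.
    by rewrite mulr_ge0// invr_ge0 exprn_ge0// ltW.
  apply: QL; apply: contrapT => H; move: xtE; rewrite notin_setE; apply.
  exists x => // l lL; rewrite near_dist ltNge; apply/negP => h.
  by apply: H; exists l.
have gU x : ~ U x -> g x <= d'.
  move=> Ux; apply: le_trans Qd; apply: le_expect => // t.
  rewrite ler_wpM2l// indicE.
  case: (boolP (_ \in E)) => [|_]; last first.
    by rewrite mulr_ge0// invr_ge0 exprn_ge0// ltW.
  rewrite inE => -[y Cy Hy].
  apply: QL; apply: contrapT => H; apply: Ux; apply: (HL y) => // l lL.
  rewrite -(subrK (chi l (x + t)) (chi l x)) -addrA (splitr r).
  apply: le_lt_trans (le_normcD _ _) _; rewrite ltrD//; last exact: Hy.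
  rewrite nrmBC near_dist ltNge; apply/negP => h.
  by apply: H; exists l.
have uE x : (\1_U x)%:C - tpoly (convs s (fun x => (\1_E x)%:C)) x = (\1_U x - g x)%:C.
  by rewrite gE rmorphB.
have abs1 x : `|\1_U x - g x| <= 1.
  have [h0 h1] := indic_01 U x; have := g0 x; have := g1 x.
  by rewrite ler_norml; lra.
exists (convs s (fun x => (\1_E x)%:C)); split.
  by move=> x; rewrite uE nrm_real.
have mUC : measurable ((U `\` C) : set B) by apply: measurableD => //; exact: sC.1.
have i1 : rint (fun x => d' + \1_(U `\` C) x).
  apply: (@rint_bounded _ _ _ _ (d' + 1)).
    by apply: rmeasD; [exact: rmeas_cst|exact: rmeas_indic].
  move=> x; have [h0 h1] := indic_01 (U `\` C) x.
  by rewrite ger0_norm ?lerD2l// addr_ge0// ltW.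
apply: (@le_trans _ _ (expect (fun x => d' + \1_(U `\` C) x))).
  apply: le_expect => //.
    apply: (proj2 (@sqint_bounded _ _ _ _ 1 _ _)) => [|x].
      apply: cmeasB; last exact: cmeas_tpoly.
      by apply: cmeas_real; exact: rmeas_indic.
    by rewrite uE nrm_real; exact: abs1.
  move=> x; rewrite uE nrm_real.
  have sqle (w : R) : `|w| <= d' -> `|w| ^+ 2 <= d' + 0.
    move=> wd; rewrite addr0 expr2 (le_trans (ler_pM _ _ wd wd))//.
    by rewrite ler_piMr// ltW.
  case: (pselect (U x)) => Ux.
    case: (pselect (C x)) => Cx.
      rewrite (_ : \1_(U `\` C) x = 0); last first.
        by rewrite indicE memNset// => -[].
      apply: sqle; rewrite indicE mem_set// ger0_norm ?gC//.
      by rewrite subr_ge0.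
    rewrite (_ : \1_(U `\` C) x = 1); last by rewrite indicE mem_set.
    rewrite (@le_trans _ _ 1)//; first by rewrite exprn_ile1.
    by rewrite lerDr ltW.
  rewrite (_ : \1_(U `\` C) x = 0); last by rewrite indicE memNset// => -[].
  apply: sqle; rewrite indicE memNset// sub0r normrN ger0_norm//.
  exact: gU.
rewrite expectD ?expect_cst; [|exact: rint_cst|]; last first.
  have := rintB i1 (rint_cst sigma d').
  by under eq_fun do rewrite addrAC subrr add0r.
have -> : expect (\1_(U `\` C) : K -> R) = fine (sigma (U `\` C)).
  by rewrite /expect /Rintegral integral_indic// setIT.
have := sC.2; lra.
Qed.

End Approximation.

(** * Uniqueness of Fourier coefficients and bounded approximation *)

Section FourierUniqueness.
Variables (R : realType) (G : zmodType).
Variable sigma : probability (borel_dual R G) R.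
Hypothesis haar : is_haar sigma.
Local Notation K := (dual R G).
Local Notation B := (borel_dual R G).
Local Notation rmeas := (@rmeas R G).
Local Notation rint := (rint sigma).
Local Notation expect := (expect sigma).
Local Notation integ := (integ sigma).
Local Notation sqint := (sqint sigma).
Local Notation n2 := (n2 sigma).
Local Notation ip := (ip sigma).
Local Notation cint := (cintegral sigma).
Local Notation fourier := (fourier sigma).
Local Notation convs := (convs sigma).
Implicit Types (l m : G) (x y z t : K) (s : seq (R[i] * G)).
Implicit Types (f g h : K -> R[i]) (u v : K -> R) (A C U : set K).

Lemma cint_mul_small f (e : R) : integ f -> 0 < e -> exists2 d : R, 0 < d &
  forall r, cmeasurable r -> (forall x, nrm (r x) <= 1) -> n2 r <= d ->
    nrm (cint (fun x => f x * r x)) < e.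
Proof.
move=> fi e0.
have [d d0 Hd] := expect_mul_small 1 fi.2 (fun=> nrm_ge0 _) e0.
exists d => // r mr r1 rd.
apply: le_lt_trans (nrm_cint (integM_bounded fi mr r1)) _.
rewrite (eq_expect _ (v := fun x => nrm (r x) * nrm (f x))).
  by apply: Hd => //; exact: nearW.
by move=> x; rewrite Normc.normcM mulrC.
Qed.

Lemma integ_mul_indic f A : measurable (A : set B) -> integ f ->
  integ (fun x => f x * (\1_A x)%:C).
Proof.
move=> mA fi; apply: (integM_bounded (M := 1) fi) => [|x].
  by apply: cmeas_real; exact: rmeas_indic.
by have [? ?] := @indic_01 R G A x; rewrite nrm_real ger0_norm.
Qed.

Lemma cint_mul_tpoly f s : integ f -> (forall l, fourier f l = 0) ->
  cint (fun x => f x * tpoly s x) = 0.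
Proof.
move=> fi f0.
rewrite (eq_cint _ (g := fun x => \sum_(a <- s) a.1 * (f x * conjc (chi (- a.2) x)))).
  rewrite cint_sum => [|a]; last by apply: integZ; exact: integ_mulchi.
  rewrite big1// => a _; rewrite cintZ; last exact: integ_mulchi.
  by rewrite -/(fourier f (- a.2)) f0 mulr0.
move=> x; rewrite /tpoly mulr_sumr; apply: eq_bigr => a _.
by rewrite chiNl conjcK mulrCA.
Qed.

(** Polynomials integrate to 0 against [f], so only the error of [open_approx] remains. As [f] is
    merely in [L^1], that error has to be bounded by 1 as well as small in [L^2]. *)
Lemma fourier0_open f U : integ f -> (forall l, fourier f l = 0) -> open U ->
  cint (fun x => f x * (\1_U x)%:C) = 0.
Proof.
move=> fi f0 oU; have mU : measurable (U : set B) by exact: sub_sigma_algebra.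
apply/eqP; rewrite -nrm_eq0 eq_le nrm_ge0 andbT; apply/ler_addgt0Pr => e e0.
have [d d0 Hd] := cint_mul_small fi e0.
have [s [s1 sd]] := open_approx haar oU d0.
have := Hd (fun x => (\1_U x)%:C - tpoly s x).
rewrite (eq_cint _ (g := fun x => f x * (\1_U x)%:C - f x * tpoly s x)); last first.
  by move=> x; rewrite mulrBr.
rewrite cintB ?cint_mul_tpoly// ?subr0 ?add0r; last 2 first.
- exact: integ_mul_indic.
- apply: (integM_bounded fi (cmeas_tpoly s)) => x; exact: tpoly_bounded.
move=> h; apply/ltW/h => //; apply: cmeasB; last exact: cmeas_tpoly.
by apply: cmeas_real; exact: rmeas_indic.
Qed.

(** Outer regularity puts [A] in an open [U] exceeding it by a small measure; the integral over [U]
    is 0, so the one over [A] is the opposite of the integral over the excess. *)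
Lemma fourier0_borel f A : integ f -> (forall l, fourier f l = 0) ->
  measurable (A : set B) -> cint (fun x => f x * (\1_A x)%:C) = 0.
Proof.
move=> fi f0 mA.
apply/eqP; rewrite -nrm_eq0 eq_le nrm_ge0 andbT; apply/ler_addgt0Pr => e e0.
have [d d0 Hd] := cint_mul_small fi e0.
have [_ /(_ A mA) outerA _] := haar.
have : (ereal_inf [set sigma U | U in [set U : set K | open U /\ A `<=` U]] <
    (fine (sigma A))%:E + d%:E)%E.
  by rewrite -outerA -[ltLHS]fineK ?fin_num_measure// -EFinD lte_fin ltrDl.
move=> /ereal_inf_lt[_ [U [oU AU] <-]] UA.
have mU : measurable (U : set B) by exact: sub_sigma_algebra.
have mUA : measurable ((U `\` A) : set B) by exact: measurableD.
have -> : cint (fun x => f x * (\1_A x)%:C) = - cint (fun x => f x * (\1_(U `\` A) x)%:C).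
  rewrite -[RHS]add0r -(fourier0_open fi f0 oU) -cintB; [|exact: integ_mul_indic..].
  apply: eq_cint => x; rewrite -mulrBr -rmorphB; congr (_ * _%:C).
  rewrite !indicE; have [xA|xA] := pselect (A x).
    rewrite mem_set// mem_set; last exact: AU.
    by rewrite memNset ?subr0// => -[].
  rewrite (memNset xA); have [xU|xU] := pselect (U x).
    by rewrite !mem_set// subrr.
  by rewrite !memNset ?subrr// => -[].
rewrite normcN add0r; apply/ltW/Hd.
- by apply: cmeas_real; exact: rmeas_indic.
- by move=> x; have [? ?] := @indic_01 R G (U `\` A) x; rewrite nrm_real ger0_norm.
rewrite n2_indic// (measureD (mu := sigma))//; last by rewrite ltey_eq fin_num_measure.
rewrite (_ : (U : set B) `&` A = A); last exact/setIidPr.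
move: UA; rewrite fineB ?fin_num_measure//.
by rewrite -[X in (X < _)%E -> _]fineK ?fin_num_measure// -EFinD lte_fin; lra.
Qed.

Lemma fourier_unique f : integ f -> (forall l, fourier f l = 0) ->
  \forall x \ae sigma, f x = 0.
Proof.
move=> fi f0.
have H (T : R[i] -> R) : rint (fun x => T (f x)) ->
    (forall A, measurable (A : set B) -> expect (fun x => T (f x) * \1_A x) = 0) ->
    \forall x \ae sigma, T (f x) = 0.
  move=> iT T0; have m0 : measurable_fun [set: B] (cst 0%E : B -> \bar R).
    exact: measurable_cst.
  have /(_ _)/= := integral_ae_eq (mu := sigma) measurableT iT m0.
  suff HE : forall E, E `<=` [set: B] -> measurable E ->
      (\int[sigma]_(x in E) (T (f x))%:E = \int[sigma]_(x in E) 0)%E.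
    by move=> /(_ HE); apply: filterS => x /(_ Logic.I)[].
  move=> E _ mE; rewrite integral0 integral_mkcond.
  rewrite (eq_integral (fun x : B => (T (f x) * \1_(E : set K) x)%:E)); last first.
    move=> x _; rewrite patchE indicE; case: (_ \in _); rewrite ?mulr1 ?mulr0//.
  rewrite (_ : integral _ _ _ = (expect (fun x => T (f x) * \1_(E : set K) x))%:E).
    by rewrite T0.
  rewrite EFin_expect//; apply: rint_le (rint_norm iT).
    by apply: rmeasM; [exact: rint_meas iT|exact: rmeas_indic].
  move=> x; have [? ?] := @indic_01 R G E x.
  by rewrite normrM ler_piMr// ger0_norm.
have hR : \forall x \ae sigma, complex.Re (f x) = 0.
  apply: H (integ_Re fi) _ => A mA.
  have := congr1 (@complex.Re R) (fourier0_borel fi f0 mA); rewrite /= => <-.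
  by apply: eq_Rintegral => x _; rewrite ReM/= mulr0 subr0.
have hI : \forall x \ae sigma, complex.Im (f x) = 0.
  apply: H (integ_Im fi) _ => A mA.
  have := congr1 (@complex.Im R) (fourier0_borel fi f0 mA); rewrite /= => <-.
  by apply: eq_Rintegral => x _; rewrite ImM/= mulr0 add0r.
by move: hR hI; apply: filterS2 => x; case: (f x) => a b /= -> ->.
Qed.

Definition tpolys (S : set G) : set (K -> R[i]) :=
  [set f | exists2 s, (forall a, a \in s -> S a.2) & f = tpoly s].

Lemma tpolys_sqint S : tpolys S `<=` sqint.
Proof.
move=> _ [s _ ->]; apply: (@sqint_bounded _ _ _ _ (\sum_(a <- s) nrm a.1)).
  exact: cmeas_tpoly.
exact: tpoly_bounded.
Qed.

Lemma tpolys_subspace S : subspace (tpolys S).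
Proof.
split; first by exists [::] => //; apply/funext => x; rewrite /tpoly big_nil.
move=> c _ _ [s hs ->] [s' hs' ->].
exists ([seq (c * a.1, a.2) | a <- s] ++ s').
  by move=> a; rewrite mem_cat => /orP[/mapP[b /hs ? ->]|/hs'].
by apply/funext => x; rewrite tpolyD tpolyZ.
Qed.

Lemma tpolys_chi (S : set G) l : S l -> tpolys S (chi l).
Proof. by move=> Sl; exists [:: (1, l)] => [a|]; rewrite ?inE ?tpoly_chi// => /eqP ->. Qed.

Lemma sqint_chi l : sqint (chi l).
Proof.
by apply: (@sqint_bounded _ _ _ _ 1) => [|x]; rewrite ?nrm_chi//; exact: cmeas_chi.
Qed.

Lemma clos2_ip_eq0 (A : set (K -> R[i])) f g : A `<=` sqint -> sqint g ->
  (forall a, A a -> ip a g = 0) -> clos sigma 2%:E A f -> ip f g = 0.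
Proof.
move=> AL sg A0 /(clos2P _ AL)[sf H].
apply: ip_eq0_ler => // n; have e0 : 0 < 10 / 4 ^+ n :> R by rewrite divr_gt0// exprn_gt0.
have [a Aa fa] := H _ e0; have sa := AL _ Aa.
have -> : ip f g = ip (fun x => f x - a x) g by rewrite ipBl// (A0 _ Aa) subr0.
apply: le_trans (cauchy_schwarz (sqintB sf sa) sg) _.
by rewrite mulrAC ler_wpM2r ?n2_ge0// ltW.
Qed.

(** Orthogonality between frequencies in and out of [S]. It is a condition because [cint_chi] asks
    for a point where the character is not 1; for [S = setT] it is vacuous. *)
Definition full_spectrum (S : set G) :=
  forall l m, S l -> ~ S m -> cint (chi (l - m)) = 0.

Lemma fourier_ip f l : fourier f l = ip f (chi l).
Proof. by []. Qed.

Lemma ip_chi l m : ip (chi l) (chi m) = cint (chi (l - m)).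
Proof. by apply: eq_cint => x; rewrite chiDl chiNl. Qed.

(** Let [a] be the projection of [f] on the closure. The coefficients of [f - a] vanish in [S] by
    orthogonality to [chi l], and outside [S] because those of [f] do by hypothesis and those of [a]
    by [full_spectrum]. Then [fourier_unique] identifies [f] with [a]. *)
Lemma L2_trig_dense (S : set G) f : full_spectrum S -> sqint f ->
  (forall l, ~ S l -> fourier f l = 0) -> clos sigma 2%:E (tpolys S) f.
Proof.
move=> hS sf f0; have TL := @tpolys_sqint S.
have TLp : tpolys S `<=` Lp sigma 2%:E by move=> g /TL /Lp2P.
have p2 : (1 <= 2%:E :> \bar R)%E by rewrite lee1n.
pose A := clos sigma 2%:E (tpolys S).
have AL : A `<=` sqint by move=> g /clos_Lp /Lp2P.
have sA : subspace A by apply: clos_subspace => //; exact: tpolys_subspace.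
have cA : clos sigma 2%:E A `<=` A by exact: clos_idem.
have [a Aa Ha] := L2_projection AL sA cA sf; have sa := AL _ Aa.
have ae0 : \forall x \ae sigma, f x - a x = 0.
  apply: fourier_unique => [|l]; first by apply: sqint_integ; exact: sqintB.
  have [Sl|Sl] := pselect (S l).
    by apply: Ha; apply: sub_clos => //; exact: tpolys_chi.
  rewrite fourier_ip ipBl//; last exact: sqint_chi.
  rewrite -fourier_ip f0// sub0r; apply/eqP; rewrite oppr_eq0; apply/eqP.
  apply: (clos2_ip_eq0 TL _ _ Aa); first exact: sqint_chi.
  move=> _ [s hs ->]; rewrite /ip (eq_cint _ (g := fun x =>
      \sum_(b <- s) b.1 * (chi b.2 x * conjc (chi l x)))); last first.
    by move=> x; rewrite /tpoly mulr_suml; apply: eq_bigr => b _; rewrite mulrA.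
  rewrite cint_sum => [|b]; last by apply: integZ; exact/integ_mulchi/integ_chi.
  rewrite big_seq big1// => b bs; rewrite cintZ; last exact/integ_mulchi/integ_chi.
  by rewrite -/(ip (chi b.2) (chi l)) ip_chi hS ?mulr0//; exact: hs.
apply: (clos_ae p2 TLp Aa sf.1); apply: filterS ae0 => x /eqP.
by rewrite subr_eq0 => /eqP ->.
Qed.

Lemma convsB s f g x : integ f -> integ g ->
  tpoly (convs s (fun x => f x - g x)) x = tpoly (convs s f) x - tpoly (convs s g) x.
Proof.
have i h : integ h -> integ (fun y => tpoly s (x - y) * h y).
  move=> hi; rewrite (_ : (fun y => _) =
      fun y => \sum_(a <- s) (a.1 * chi a.2 x) * (h y * conjc (chi a.2 y))).
    by apply: integ_sum => a; apply: integZ; exact: integ_mulchi.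
  apply/funext => y; rewrite tpoly_sub mulr_suml; apply: eq_bigr => a _.
  by rewrite -mulrA [conjc _ * _]mulrC.
move=> fi gi; rewrite !convsE//; last exact: integB.
rewrite -cintB; [|exact: i|exact: i].
by apply: eq_cint => y; rewrite mulrBr.
Qed.

(* Unlike the partial sums of the Fourier series, the means of [h] against the
   kernels of [trig_kernel] are uniformly bounded. *)
Lemma bounded_approx (S : set G) h (C d : R) : cmeasurable h ->
  (\forall x \ae sigma, nrm (h x) <= C) ->
  (forall l, ~ S l -> fourier h l = 0) -> 0 < d ->
  exists g, [/\ tpolys S g, forall x, nrm (g x) <= C &
    n2 (fun x => g x - h x) <= d].
Proof.
move=> mh hC hS d0.
have sh : sqint h by apply: Lpy_sqint; apply/LpyP; split=> //; exists C.
(* The final error is at most [2 d1 + 2 (2 d1 + 2 d1) = 10 d1]; [d1 <= 1] gives [d1 ^+ 2 <= d1]. *)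
pose d1 := Num.min 1 (d / 10).
have d10 : 0 < d1 by rewrite lt_min ltr01 divr_gt0.
have d11 : d1 <= 1 by rewrite ge_min lexx.
have d1d : d1 <= d / 10 by rewrite ge_min lexx orbT.
have [_ /(_ _ d10)[_ [q _ ->] hq]] :
    sqint h /\ forall e, 0 < e -> exists2 g, tpolys setT g & n2 (fun x => h x - g x) < e.
  apply/clos2P; first exact: tpolys_sqint.
  by apply: L2_trig_dense => // l /(_ Logic.I).
pose M : R := \sum_(b <- q) nrm b.1.
have M0 : 0 <= M by apply: sumr_ge0 => b _; exact: nrm_ge0.
(* If the kernel multiplies each coefficient of [q] by a factor within [eta] of 1, then [tpoly q]
   moves uniformly by at most [eta * M <= d1]. *)
pose eta := d1 / (M + 1); have eta0 : 0 < eta by rewrite divr_gt0// ltr_wpDl.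
have etaM : eta * M <= d1.
  rewrite /eta mulrAC ler_pdivrMr ?ltr_wpDl//; nra.
have e20 : 0 < eta ^+ 2 by rewrite exprn_gt0.
have [s [tau [sE tau0 tau_even tau1 tauL]]] := trig_kernel haar (map snd q) e20.
have itau : rint tau := rint_tau sigma sE tau0.
pose c l := cint (fun t => (tau t)%:C * chi l t).
have itb (u : K -> R) (N : R) : rmeas u -> (forall t, `|u t| <= N) ->
    rint (fun t => tau t * u t).
  move=> mu uN; apply: rint_le (rintZ N itau).
    by apply: rmeasM => //; exact: rint_meas itau.
  by move=> t; rewrite normrM (ger0_norm (tau0 t)) mulrC ler_wpM2r.
have m1 l : cmeasurable (fun t : K => 1 - chi l t).
  by apply: cmeasB; [exact: cmeas_cst|exact: cmeas_chi].
have b1 l t : nrm (1 - chi l t) <= 2.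
  by rewrite (le_trans (le_normcD _ _))// normcN nrm_chi Normc.normc1.
have cnear b : b \in q -> nrm (1 - c b.2) <= eta.
  move=> bq; apply: le_trans (tau_chi_near1 sE tau0 tau1 b.2) _.
  have i1 : rint (fun t => tau t * nrm (1 - chi b.2 t)).
    apply: (itb _ 2) => [|t]; first exact: rmeas_nrm (m1 _).
    by rewrite ger0_norm ?nrm_ge0.
  have i2 : rint (fun t => tau t * nrm (1 - chi b.2 t) ^+ 2).
    apply: (itb _ 4) => [|t]; first exact: rmeas_nrm2 (m1 _).
    rewrite ger0_norm ?sqr_ge0//; have -> : 4 = 2 ^+ 2 :> R by rewrite -natrX.
    by rewrite ler_sqr ?nnegrE ?nrm_ge0.
  have i3 : rint (fun t => eta / 2 * tau t) by exact: rintZ.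
  have i4 : rint (fun t => (2 * eta)^-1 * (tau t * nrm (1 - chi b.2 t) ^+ 2)).
    exact: rintZ.
  (* The kernel controls the second moment of [w = |1 - chi|] by [eta ^+ 2]; the inequality
     [w <= eta / 2 + w ^+ 2 / (2 eta)] converts this into a first moment of at most [eta]. *)
  apply: (@le_trans _ _ (expect (fun t => eta / 2 * tau t +
      (2 * eta)^-1 * (tau t * nrm (1 - chi b.2 t) ^+ 2)))).
    apply: le_expect => //; first exact: rintD.
    move=> t; set w := nrm _; rewrite -subr_ge0.
    rewrite (_ : _ - _ = tau t * ((2 * eta)^-1 * (w - eta) ^+ 2)).
      apply: mulr_ge0 => //; apply: mulr_ge0; last exact: sqr_ge0.
      by rewrite invr_ge0 mulr_ge0// ltW.
    by field; rewrite gt_eqF.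
  rewrite expectD// !expectZ// tau1.
  have : expect (fun t => tau t * nrm (1 - chi b.2 t) ^+ 2) <= eta ^+ 2.
    apply: le_trans tauL; apply: le_expect => //.
      have -> : (fun t => tau t * \sum_(l <- map snd q) nrm (1 - chi l t) ^+ 2) =
          fun t => \sum_(l <- map snd q) tau t * nrm (1 - chi l t) ^+ 2.
        by apply/funext => t; rewrite mulr_sumr.
      elim: (map snd q) => [|l L ih].
        by under eq_fun do rewrite big_nil; exact: rint_cst.
      under eq_fun do rewrite big_cons; apply: rintD => //.
      apply: (itb _ 4) => [|t]; first exact: rmeas_nrm2 (m1 _).
      rewrite ger0_norm ?sqr_ge0//; have -> : 4 = 2 ^+ 2 :> R by rewrite -natrX.
      by rewrite ler_sqr ?nnegrE ?nrm_ge0.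
    move=> t; rewrite ler_wpM2l// (big_rem b.2)/=; last exact: map_f.
    by rewrite lerDl sumr_ge0// => l _; exact: sqr_ge0.
  move=> h2; have : (2 * eta)^-1 * expect (fun t => tau t * nrm (1 - chi b.2 t) ^+ 2) <=
      (2 * eta)^-1 * eta ^+ 2.
    by rewrite ler_wpM2l// invr_ge0 mulr_ge0// ltW.
  have -> : (2 * eta)^-1 * eta ^+ 2 = eta / 2 by field; rewrite gt_eqF.
  lra.
have iq : integ (tpoly q) by apply: sqint_integ; apply: (@tpolys_sqint setT); exists q.
have convq x : tpoly (convs s (tpoly q)) x = \sum_(b <- q) b.1 * (chi b.2 x * c b.2).
  rewrite (convs_tau sE)// (eq_cint _ (g := fun y =>
      \sum_(b <- q) b.1 * ((tau (x - y))%:C * chi b.2 y))); last first.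
    by move=> y; rewrite /tpoly mulr_sumr; apply: eq_bigr => b _; rewrite mulrCA.
  have ic b : integ (fun y => (tau (x - y))%:C * chi b y).
    exact: (integ_tauM sE tau0 tau_even x (integ_chi sigma b)).
  rewrite cint_sum => [|b]; last exact: integZ.
  apply: eq_bigr => b _; rewrite cintZ//; congr (_ * _).
  rewrite -(convs_chi haar sE tau0 tau_even) (convs_tau sE)//.
  exact: integ_chi.
have near_q x : nrm (tpoly q x - tpoly (convs s (tpoly q)) x) <= d1.
  rewrite convq /tpoly -sumrB; apply: le_trans etaM; rewrite /M mulr_sumr !big_seq.
  elim/big_ind2: _ => [|a1 a2 a3 a4 h1 h2|b bq]; first by rewrite Normc.normc0.
    by rewrite (le_trans (le_normcD _ _))// lerD.
  rewrite -mulrBr -[X in X - _ * c _]mulr1 -mulrBr !Normc.normcM nrm_chi mul1r.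
  by rewrite mulrC ler_wpM2r ?nrm_ge0// cnear.
pose g := tpoly (convs s h).
have sg : sqint g by apply: (@tpolys_sqint setT); exists (convs s h).
have sgq : sqint (tpoly (convs s (tpoly q))).
  by apply: (@tpolys_sqint setT); exists (convs s (tpoly q)).
have sq : sqint (tpoly q) by apply: (@tpolys_sqint setT); exists q.
have shq := sqintB sh sq.
exists g; split.
(* The coefficients of the convolution outside [S] vanish along with those of [h], so dropping them
   leaves the same function. *)
- exists [seq a <- convs s h | `[< S a.2 >]].
    by move=> a; rewrite mem_filter => /andP[/asboolP].
  apply/funext => x; rewrite /g /tpoly big_filter [LHS](bigID (fun a => `[< S a.2 >]))/=.
  rewrite [X in _ + X]big1_seq ?addr0// => a /andP[/asboolP Sa /mapP[b _ ab]].
  by rewrite ab/= hS ?mulr0 ?mul0r//; move: Sa; rewrite ab.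
- by move=> x; exact: (convs_bounded haar sE tau0 tau_even tau1).
rewrite (_ : (fun x => _) = fun x => (tpoly (convs s (fun x => h x - tpoly q x)) x) +
    ((tpoly q x - h x) - (tpoly q x - tpoly (convs s (tpoly q)) x))); last first.
  by apply/funext => x; rewrite convsB//; [rewrite /g; ring|exact: sqint_integ].
have s1 : sqint (tpoly (convs s (fun x => h x - tpoly q x))).
  by apply: (@tpolys_sqint setT); eexists.
have s2 : sqint (fun x => tpoly q x - tpoly (convs s (tpoly q)) x) by exact: sqintB.
apply: le_trans (n2D_le s1 _) _; first by apply: sqintB => //; exact: sqintB.
have h1 := convs_contract haar sE tau0 tau_even tau1 shq.
have h2 : n2 (fun x => (tpoly q x - h x) - (tpoly q x - tpoly (convs s (tpoly q)) x))
    <= 2 * n2 (fun x => h x - tpoly q x) + 2 * d1.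
  apply: le_trans (n2D_le (sqintB sq sh) (sqintN s2)) _.
  rewrite n2BC lerD2l ler_wpM2l// -[leRHS](expect_cst sigma).
  apply: le_expect; [exact: (sqintN s2).2|exact: rint_cst|move=> x].
  rewrite normcN (@le_trans _ _ (d1 ^+ 2))//.
    by rewrite ler_sqr ?nnegrE ?nrm_ge0// ltW.
  by rewrite expr2 ler_piMr// ltW.
move: hq h1 h2 => /ltW; lra.
Qed.

End FourierUniqueness.

Lemma conj_conjc (R : realType) (z : R[i]) : Num.conj z = conjc z.
Proof. by []. Qed.

Lemma conjc_realM (R : realType) (r : R) (z : R[i]) :
  conjc (r%:C * z) = r%:C * conjc z.
Proof. by case: z => a b; simpc. Qed.

Lemma conjcJM (R : realType) (z w : R[i]) : conjc (conjc z * w) = z * conjc w.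
Proof. by rewrite rmorphM/= conjcK. Qed.

(** * Invariant subspaces and Beurling's theorem in [L^2] *)

Section InvariantSubspaces.
Variables (R : realType) (G : zmodType).
Variable sigma : probability (borel_dual R G) R.
Hypothesis haar : is_haar sigma.
Variable P : set G.
Hypothesis orderP : group_order P.
Local Notation K := (dual R G).
Local Notation integ := (integ sigma).
Local Notation sqint := (sqint sigma).
Local Notation n2 := (n2 sigma).
Local Notation ip := (ip sigma).
Local Notation cint := (cintegral sigma).
Local Notation fourier := (fourier sigma).
Local Notation Lp := (Lp sigma).
Local Notation Hp := (Hp sigma P).
Local Notation clos := (clos sigma).
Local Notation Pn := (nonneg P).
Implicit Types (l m : G) (x y z t : K) (s : seq (R[i] * G)).
Implicit Types (f g h : K -> R[i]) (A N M : set (K -> R[i])) (p : \bar R).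

Lemma posD l m : P l -> P m -> P (l + m).
Proof. by have [H _ _ _ _] := orderP; exact: H. Qed.

Lemma nonneg0 : Pn 0. Proof. by right. Qed.

Lemma nonneg_pos l : P l -> Pn l. Proof. by left. Qed.

Lemma nonnegD l m : Pn l -> Pn m -> Pn (l + m).
Proof.
by move=> [Pl|->] [Pm|->]; rewrite ?addr0 ?add0r; [left; exact: posD|left|left|right].
Qed.

Lemma posD_nonneg l m : P l -> Pn m -> P (l + m).
Proof. by move=> Pl [Pm|->]; [exact: posD|rewrite addr0]. Qed.

Lemma nonnegNP l : ~ Pn l <-> P (- l).
Proof.
have [_ tot d0 dN _] := orderP; split=> [nl|Pl [Pl'|l0]].
- have : [set: G] l by []. rewrite -tot => -[[Pl|l0]|[m Pm <-]].
  + by case: nl; left.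
  + by case: nl; right.
  + by rewrite opprK.
- have : (P `&` [set - l | l in P]) l by split=> //; exists (- l); rewrite ?opprK.
  by rewrite dN.
- have : (P `&` [set 0]) (- l) by split=> //; rewrite l0 /= oppr0.
  by rewrite d0.
Qed.

Definition chi_stable N := forall l f, Pn l -> N f -> N (fun x => chi l x * f x).

Definition invariant p N := closed_subspace sigma p N /\ chi_stable N.

Lemma subspaceD N f g : subspace N -> N f -> N g -> N (fun x => f x + g x).
Proof.
move=> [_ H] Nf Ng; have := H 1 _ _ Nf Ng.
by rewrite (_ : (fun x => _) = fun x => f x + g x)//; apply/funext => x; rewrite mul1r.
Qed.

Lemma subspaceZ N (a : R[i]) f : subspace N -> N f -> N (fun x => a * f x).
Proof.
move=> [N0 H] Nf; have := H a _ _ Nf N0.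
by rewrite (_ : (fun x => _) = fun x => a * f x)//; apply/funext => x; rewrite addr0.
Qed.

Lemma subspaceB N f g : subspace N -> N f -> N g -> N (fun x => f x - g x).
Proof.
move=> sN Nf Ng; rewrite (_ : (fun x => _) = fun x => f x + (-1) * g x).
  by apply: subspaceD => //; exact: subspaceZ.
by apply/funext => x; rewrite mulN1r.
Qed.

Lemma chi_stable_tpoly N f g : subspace N -> chi_stable N -> N f ->
  tpolys Pn g -> N (fun x => g x * f x).
Proof.
move=> sN cN Nf [s hs ->] {g}; rewrite /tpoly; elim: s hs => [|a s ih] hs.
  rewrite (_ : (fun x => _) = 0); first exact: sN.1.
  by apply/funext => x; rewrite big_nil mul0r.
rewrite (_ : (fun x => _) = fun x => a.1 * (chi a.2 x * f x) +
    (\sum_(a <- s) a.1 * chi a.2 x) * f x); last first.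
  by apply/funext => x; rewrite big_cons mulrDl mulrA.
apply: subspaceD => //; last by apply: ih => b bs; apply: hs; rewrite inE bs orbT.
by apply: subspaceZ => //; apply: cN => //; apply: hs; rewrite mem_head.
Qed.

Lemma mulset_Lp p N l : (1 <= p)%E -> N `<=` Lp p -> mulset sigma (chi l) N `<=` Lp p.
Proof.
move=> p1 NL g [mg [f Nf gf]].
have fp : Lp p (fun x => chi l x * f x).
  apply: (LpM (c := 1) p1 (NL _ Nf) (cmeas_chi R l)).
  by apply: nearW => x; rewrite nrm_chi.
by apply: (Lp_ae p1 mg fp); apply: filterS gf => x ->.
Qed.

Lemma span_subspace A : subspace (span A).
Proof.
split; first by move=> E [[E0 _] _].
by move=> a f g Af Ag E [sE AE]; apply: sE.2; [apply: Af|apply: Ag].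
Qed.

Lemma sub_span A : A `<=` span A.
Proof. exact: sub_gen_smallest. Qed.

Lemma span_sub A E : subspace E -> A `<=` E -> span A `<=` E.
Proof. exact: smallest_sub. Qed.

Lemma Lp_subspace p : (1 <= p)%E -> subspace (Lp p).
Proof.
by move=> p1; split; [exact: Lp_cst|move=> a f g ? ?; apply: LpD => //; exact: LpZ].
Qed.

(** The common form of [tilde], for [S = nonneg P], and [minus], for [S = P]. *)
Definition shifts (S : set G) p N :=
  clos p (span (\bigcup_(l in S) mulset sigma (chi l) N)).

Lemma span_shifts_Lp (S : set G) p N : (1 <= p)%E -> N `<=` Lp p ->
  span (\bigcup_(l in S) mulset sigma (chi l) N) `<=` Lp p.
Proof.
move=> p1 NL; apply: span_sub; first exact: Lp_subspace.
by move=> g [l _]; exact: mulset_Lp.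
Qed.

Lemma clos_closed_subspace p A : (1 <= p)%E -> A `<=` Lp p -> subspace A ->
  closed_subspace sigma p (clos p A).
Proof.
move=> p1 AL sA; split; [by move=> f; exact: clos_Lp|exact: clos_subspace|].
exact: clos_idem.
Qed.

Lemma shifts_invariant (S : set G) p N : (1 <= p)%E -> N `<=` Lp p ->
  (forall l m, S l -> Pn m -> S (l + m)) -> invariant p (shifts S p N).
Proof.
move=> p1 NL SD; have sL := span_shifts_Lp (S := S) p1 NL.
split; first by apply: clos_closed_subspace => //; exact: span_subspace.
move=> m f Pm; apply: (clos_bounded_mul (c := 1) p1 sL sL (cmeas_chi R m)).
  by apply: nearW => x; rewrite nrm_chi.
move=> g; apply: (span_sub (E := fun g => span (\bigcup_(l in S)
    mulset sigma (chi l) N) (fun x => chi m x * g x))).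
  split.
    rewrite (_ : (fun x => _) = 0); first exact: (span_subspace _).1.
    by apply/funext => x; rewrite mulr0.
  move=> a g1 g2 h1 h2; have := (span_subspace _).2 a _ _ h1 h2.
  by congr (span _ _); apply/funext => x; ring.
move=> {}g [l Sl [mg [u Nu gu]]]; apply: sub_span; exists (l + m); first exact: SD.
split; first by apply: cmeasM => //; exact: cmeas_chi.
by exists u => //; apply: filterS gu => x ->; rewrite chiDl; ring.
Qed.

Lemma shifts_chi (S : set G) p N l f : (1 <= p)%E -> N `<=` Lp p -> S l -> N f ->
  shifts S p N (fun x => chi l x * f x).
Proof.
move=> p1 NL Sl Nf; apply: sub_clos => //; first exact: span_shifts_Lp.
apply: sub_span; exists l => //; split.
  by apply: cmeasM; [exact: cmeas_chi|exact: (NL _ Nf).1].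
by exists f => //; exact: nearW.
Qed.

Lemma closed_ae p N f g : (1 <= p)%E -> closed_subspace sigma p N -> N f ->
  cmeasurable g -> (\forall x \ae sigma, f x = g x) -> N g.
Proof.
move=> p1 [NL sN cN] Nf mg fg; apply: cN; apply: (clos_ae p1 NL _ mg fg).
exact: sub_clos.
Qed.

Lemma shifts_sub (S : set G) p N E : (1 <= p)%E -> closed_subspace sigma p E ->
  (forall l f, S l -> N f -> E (fun x => chi l x * f x)) -> shifts S p N `<=` E.
Proof.
move=> p1 cE H; have [EL sE EE] := cE; apply: subset_trans EE.
apply: clos_sub; apply: span_sub => // g [l Sl [mg [f Nf gf]]].
by apply: (closed_ae p1 cE (H _ _ Sl Nf) mg); apply: filterS gf => x ->.
Qed.

Lemma minus_invariant p N : (1 <= p)%E -> N `<=` Lp p ->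
  invariant p (minus sigma P p N).
Proof. by move=> p1 NL; apply: shifts_invariant => // l m; exact: posD_nonneg. Qed.

Lemma minus_sub p N : (1 <= p)%E -> invariant p N -> minus sigma P p N `<=` N.
Proof. by move=> p1 [cN sN]; apply: shifts_sub => // l f /nonneg_pos; exact: sN. Qed.

Lemma minus_chi p N l f : (1 <= p)%E -> N `<=` Lp p -> P l -> N f ->
  minus sigma P p N (fun x => chi l x * f x).
Proof. exact: shifts_chi. Qed.

Lemma p2_ge1 : (1 <= 2%:E :> \bar R)%E.
Proof. by rewrite lee1n. Qed.

(* [H^oo] acts on every closed invariant subspace, by approximating with uniformly
   bounded analytic polynomials. *)
Lemma Hy_mul p N f h : (1 <= p)%E -> invariant p N -> Hp +oo h -> N f ->
  N (fun x => h x * f x).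
Proof.
move=> p1 [[NL sN cN] iN] [hy h0] Nf; have [mh [C hC]] := iffLR (LpyP _ _) hy.
apply: cN; apply: (clos_small (C := C + C) p1 NL _ (NL _ Nf)).
  exact: (LpM p1 (NL _ Nf) mh hC).
move=> d d0.
have [|g [tg gC gd]] := bounded_approx (S := Pn) haar mh hC _ d0.
  by move=> l /nonnegNP; exact: h0.
have mg : cmeasurable g by have [s _ ->] := tg; exact: cmeas_tpoly.
exists (fun x => g x - h x); split=> //; first exact: cmeasB.
  apply: filterS hC => x hC; rewrite (le_trans (le_normcD _ _))// normcN.
  by rewrite lerD.
rewrite (_ : (fun x => _) = fun x => g x * f x); first exact: chi_stable_tpoly.
by apply/funext => x; ring.
Qed.

Lemma fourier_linear (a : R[i]) f g l : integ f -> integ g ->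
  fourier (fun x => a * f x + g x) l = a * fourier f l + fourier g l.
Proof.
move=> fi gi; rewrite /Defs.fourier -cintZ; last exact: integ_mulchi.
rewrite -cintD; [|by apply: integZ; exact: integ_mulchi|exact: integ_mulchi].
by apply: eq_cint => x; rewrite mulrDl mulrA.
Qed.

Lemma clos_fourier p A f l : (1 <= p)%E -> A `<=` Lp p ->
  (forall g, A g -> fourier g l = 0) -> clos p A f -> fourier f l = 0.
Proof.
move=> p1 AL A0; apply: (clos_functional (c := 1) p1 AL _ _ A0).
  exact/cmeasJ/cmeas_chi.
by apply: nearW => x; rewrite nrm_conj nrm_chi.
Qed.

(** Each condition [fourier f l = 0] is the vanishing of the functional given by a bounded function,
    hence is closed for the norm and weak-star topologies alike; multiplication by [chi l] shifts
    the coefficients by [l >= 0]. *)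
Lemma Hp_invariant p : (1 <= p)%E -> invariant p (Hp p).
Proof.
move=> p1; have HL : Hp p `<=` Lp p by move=> f [].
split; last first.
  move=> l f Pl [fp f0]; split.
    apply: (LpM (c := 1) p1 fp (cmeas_chi R l)).
    by apply: nearW => x; rewrite nrm_chi.
  move=> m Pm; rewrite -(f0 (m - l)); last first.
    by rewrite opprB addrC; exact: posD_nonneg.
  apply: eq_cint => x; cbn beta.
  by rewrite !conj_conjc -!chiNl opprB chiDl; ring.
split=> //.
- split; last first.
    move=> a f g [fp f0] [gp g0]; split; first by apply: LpD => //; exact: LpZ.
    move=> l Pl; rewrite fourier_linear ?f0 ?g0 ?mulr0 ?addr0//; exact: (Lp_integ p1).
  split; first exact: (Lp_subspace p1).1.
  move=> l _; transitivity (cint (fun=> 0)); last exact: cint_cst.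
  by apply: eq_cint => x; exact: mul0r.
- move=> f cf; split; first exact: clos_Lp cf.
  by move=> l Pl; apply: clos_fourier cf => // g [_]; apply.
Qed.

(** This makes the constant 1, and with it every element of [tpolys Pn], analytic. It is discharged
    by [minus_proper_chi_mean0]. *)
Hypothesis chi_mean0 : forall l, P l -> cint (chi l) = 0.

Lemma chi_mean0N l : P l -> cint (chi (- l)) = 0.
Proof.
move=> Pl; rewrite (_ : cint _ = cint (fun x => (chi l x)^*)).
  by rewrite cintJ ?chi_mean0 ?conjc0//; exact: integ_chi.
by apply: eq_cint => x; rewrite chiNl.
Qed.

Lemma full_spectrum_nonneg : full_spectrum sigma Pn.
Proof.
move=> l m Pl /nonnegNP Pm; apply: chi_mean0; rewrite addrC.
exact: posD_nonneg.
Qed.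

Lemma tpolys_Hy : tpolys Pn `<=` Hp +oo.
Proof.
have c1 : Hp +oo (fun=> 1).
  split; first exact/Lp_cst/leey.
  move=> l Pl; rewrite -(chi_mean0 Pl).
  by apply: eq_cint => x; rewrite mul1r chiNl.
have [[HL sH _] iH] := Hp_invariant (leey 1).
move=> g tg; have := chi_stable_tpoly sH iH c1 tg.
by under eq_fun do rewrite mulr1.
Qed.

Lemma Hy_Hp p f : (1 <= p)%E -> Hp +oo f -> Hp p f.
Proof. by move=> p1 [fy f0]; split=> //; exact: Lpy_Lp. Qed.

Lemma Hp_Hy p f : Hp p f -> Lp +oo f -> Hp +oo f.
Proof. by move=> [_ f0] fy; split. Qed.

Lemma H2_dense f : Hp 2%:E f -> clos 2%:E (tpolys Pn) f.
Proof.
move=> [/Lp2P sf f0]; apply: L2_trig_dense => //; first exact: full_spectrum_nonneg.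
by move=> l /nonnegNP; exact: f0.
Qed.

Lemma unimodular_nrm f : unimodular sigma f -> \forall x \ae sigma, nrm (f x) <= 1.
Proof. by apply: filterS => x /norm1P ->. Qed.

Lemma unimodularK f : unimodular sigma f ->
  \forall x \ae sigma, f x * (f x)^* = 1.
Proof. by apply: filterS => x /norm1P h; rewrite mulcJ h expr1n. Qed.

(* Beurling's theorem in [L2]: [phi] spans the orthogonal complement of [minus N]
   in [N], and orthogonality of [phi] and [chi l * phi] makes [|phi|^2] constant. *)
Theorem beurling_L2 N f0 : invariant 2%:E N -> N f0 ->
  ~ minus sigma P 2%:E N f0 -> exists phi,
  [/\ cmeasurable phi, unimodular sigma phi,
      forall u, Hp 2%:E u -> N (fun x => phi x * u x) &
      forall f, N f -> Hp 2%:E (fun x => (phi x)^* * f x)].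
Proof.
move=> iN Nf0 Ef0; have [[NL sN cN] chiN] := iN.
have NS : N `<=` sqint by move=> f /NL /Lp2P.
have [[EL sE cE] _] := minus_invariant p2_ge1 NL.
set E := minus _ _ _ _ in Ef0 EL sE cE.
have ES : E `<=` sqint by move=> f /EL /Lp2P.
have EN : E `<=` N by exact: minus_sub p2_ge1 iN.
have [a Ea Ha] := L2_projection ES sE cE (NS _ Nf0).
pose psi x := f0 x - a x.
have Npsi : N psi by apply: subspaceB => //; exact: EN.
have spsi : sqint psi := NS _ Npsi.
have c0 : 0 < n2 psi.
  rewrite lt_def n2_ge0 andbT; apply/eqP => /(n2_eq0 spsi) p0.
  apply: Ef0; apply: (closed_ae p2_ge1 (And3 EL sE cE) Ea (NS _ Nf0).1).
  by apply: filterS p0 => x /eqP; rewrite subr_eq0 => /eqP ->.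
set c := n2 psi in c0.
have sqpsi : integ (fun x => (nrm (psi x) ^+ 2)%:C) by exact: integ_real spsi.2.
pose F x : R[i] := (nrm (psi x) ^+ 2)%:C.
have FP l : P l -> fourier F l = 0.
  move=> Pl; rewrite -(Ha _ (minus_chi p2_ge1 NL Pl Npsi)); apply: eq_cint => x.
  by rewrite /F -mulcJ rmorphM/= -mulrA [(psi x)^* * _]mulrC.
have FN l : P l -> fourier F (- l) = 0.
  move=> Pl; rewrite -conjc0 -(FP _ Pl) /Defs.fourier -cintJ; last exact: integ_mulchi.
  apply: eq_cint => x; rewrite !conj_conjc chiNl [RHS](rmorphM (@conjc R)).
  by congr (_ * _); exact/esym/conjc_real.
(* The coefficients of [F] at positive and negative frequencies vanish and the one at 0 is [c]: they
   are those of the constant [c]. *)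
have ae_c : \forall x \ae sigma, F x - c%:C = 0.
  apply: (fourier_unique haar) => [|l].
    by apply: integB => //; exact: integ_cst.
  have -> : fourier (fun x => F x - c%:C) l = fourier F l - c%:C * cint (chi (- l)).
    rewrite -cintZ; last exact: integ_chi.
    rewrite -cintB; [|exact: integ_mulchi|by apply: integZ; exact: integ_chi].
    by apply: eq_cint => x; rewrite mulrBl chiNl.
  have [Pl|/nonnegNP Pl] := pselect (Pn l); last first.
    by rewrite -[l]opprK FN// opprK chi_mean0// mulr0 subr0.
  case: Pl => [Pl|->]; first by rewrite FP// chi_mean0N// mulr0 subr0.
  have -> : cint (chi (- 0)) = 1 :> R[i].
    rewrite -[RHS](cint_cst sigma); apply: eq_cint => x.
    by rewrite oppr0 chi0l.
  rewrite mulr1 /Defs.fourier (eq_cint _ (g := F)) ?cint_real ?subrr// => x.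
  by rewrite chi0l -[RHS]mulr1; congr (_ * _); exact: conjc1.
pose r := (Num.sqrt c)^-1.
pose phi x := r%:C * psi x.
have mphi : cmeasurable phi by apply: cmeasZ; exact: spsi.1.
have uphi : unimodular sigma phi.
  apply: filterS ae_c => x /eqP; rewrite subr_eq0 => /eqP /complexI Fc.
  apply/norm1P; rewrite Normc.normcM nrm_real ger0_norm ?invr_ge0 ?sqrtr_ge0//.
  rewrite -[nrm (psi x)]ger0_norm ?nrm_ge0// -sqrtr_sqr Fc mulVf//.
  by rewrite gt_eqF// sqrtr_gt0.
have Nphi : N phi by exact: subspaceZ.
have phi1 := unimodular_nrm uphi.
exists phi; split=> //.
  move=> u /H2_dense Hu; apply: cN.
  have TL : tpolys Pn `<=` Lp 2%:E by move=> g /tpolys_sqint /Lp2P.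
  apply: (clos_bounded_mul p2_ge1 TL NL mphi phi1 _ Hu) => g tg.
  rewrite (_ : (fun x => _) = fun x => g x * phi x); first exact: chi_stable_tpoly.
  by apply/funext => x; rewrite mulrC.
move=> f Nf; split.
  apply: (LpM p2_ge1 (NL _ Nf) (cmeasJ mphi) (c := 1)).
  by apply: filterS phi1 => x; rewrite nrm_conj.
(* As [- l > 0], the product [chi (- l) * f] lies in [minus N], to which [psi] is orthogonal; up to
   the factor [r] this is the vanishing of the coefficient at [l]. *)
move=> l Pl; have Ef := minus_chi p2_ge1 NL Pl Nf.
have : ip (fun x => chi (- l) x * f x) psi = 0.
  by rewrite ipC ?Ha ?conjc0//; exact: ES.
move=> h; have sfE := sqint_mulJ (ES _ Ef) spsi.
transitivity (r%:C * ip (fun x => chi (- l) x * f x) psi); last by rewrite h mulr0.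
rewrite /ip -cintZ//; apply: eq_cint => x.
by rewrite !conj_conjc /phi conjc_realM chiNl; ring.
Qed.

End InvariantSubspaces.

Arguments p2_ge1 {R}.

(** * Outer functions and Beurling's theorem in [L^p] *)

Section LpBeurling.
Variables (R : realType) (G : zmodType).
Variable sigma : probability (borel_dual R G) R.
Hypothesis haar : is_haar sigma.
Variable P : set G.
Hypothesis orderP : group_order P.
Local Notation K := (dual R G).
Local Notation rmeas := (@rmeas R G).
Local Notation rint := (rint sigma).
Local Notation expect := (expect sigma).
Local Notation sqint := (sqint sigma).
Local Notation n2 := (n2 sigma).
Local Notation ip := (ip sigma).
Local Notation cint := (cintegral sigma).
Local Notation fourier := (fourier sigma).
Local Notation Lp := (Lp sigma).
Local Notation Hp := (Hp sigma P).
Local Notation clos := (clos sigma).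
Local Notation Pn := (nonneg P).
Local Notation invariant := (invariant sigma P).
Hypothesis chi_mean0 : forall l, P l -> cint (chi l) = 0.
Implicit Types (l m : G) (x y z t : K).
Implicit Types (f g h : K -> R[i]) (A N M : set (K -> R[i])) (p : \bar R).

(** With its mean [c] removed, [f] has only strictly positive frequencies, so it integrates to 0
    against [chi l] for all [l >= 0], and by density of the analytic polynomials against [h]. *)
Lemma Hy_mul_mean h f : Hp +oo h -> Hp 2%:E f ->
  cint (fun x => h x * f x) = cint h * cint f.
Proof.
move=> Hh [/Lp2P sf f0]; set c := cint f.
have sh : sqint h := Lpy_sqint Hh.1.
have sc := sqint_cst sigma c.
pose v x := f x - c; have sv : sqint v by exact: sqintB.
have H2h : Hp 2%:E h := Hy_Hp p2_ge1 Hh.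
have TL := @tpolys_sqint R G sigma Pn.
have : ip h (fun x => (v x)^*) = 0.
  apply: (clos2_ip_eq0 TL (sqintJ sv) _ (H2_dense haar orderP chi_mean0 H2h)).
  move=> _ [s hs ->]; rewrite /ip (eq_cint _ (g := fun x =>
      \sum_(a <- s) a.1 * (v x * conjc (chi (- a.2) x)))); last first.
    move=> x; rewrite !conj_conjc conjcK /tpoly mulr_suml; apply: eq_bigr => a _.
    by rewrite chiNl conjcK mulrAC mulrA.
  have iv := sqint_integ sv.
  rewrite cint_sum => [|a]; last by apply: integZ; exact: integ_mulchi.
  rewrite big_seq big1// => a /hs Pa; rewrite cintZ; last exact: integ_mulchi.
  rewrite -[cint _]/(fourier v (- a.2)).
  have -> : fourier v (- a.2) = fourier f (- a.2) - c * cint (chi a.2).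
    rewrite -cintZ; last exact: integ_chi.
    rewrite -cintB; [|exact: integ_mulchi (sqint_integ sf)|
      by apply: integZ; exact: integ_chi].
    by apply: eq_cint => x; rewrite !conj_conjc mulrBl chiNl conjcK.
  case: Pa => [Pa|->].
    by rewrite chi_mean0// mulr0 subr0 (f0 _ _) ?mulr0// opprK.
  have -> : cint (chi 0) = 1 :> R[i].
    by rewrite -[RHS](cint_cst sigma); apply: eq_cint => x; rewrite chi0l.
  have -> : fourier f (- 0) = c.
    apply: eq_cint => x; rewrite oppr0 !conj_conjc chi0l -[RHS]mulr1.
    by congr (_ * _); exact: conjc1.
  by rewrite mulr1 subrr mulr0.
rewrite /ip (eq_cint _ (g := fun x => h x * f x - c * h x)); last first.
  by move=> x; rewrite !conj_conjc conjcK /v mulrBr [c * _]mulrC.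
rewrite cintB; [|exact: sqint_mul|by apply: integZ; exact: sqint_integ].
rewrite cintZ; last exact: sqint_integ.
by move/eqP; rewrite subr_eq0 => /eqP ->; rewrite mulrC.
Qed.

(* [k = (1 + a)^-1/2] belongs to the [L2]-closed invariant subspace it generates
   but not to its [minus], as [f |-> \int f / k] is bounded on [L2], vanishes on
   the latter and maps [k] to 1. Beurling's theorem then writes [k] as an outer
   function times a unimodular one. *)
Lemma outer_function (a : K -> R) : rint a -> (forall x, 0 <= a x) ->
  exists h, [/\ Hp +oo h, \forall x \ae sigma, nrm (h x) ^+ 2 * (1 + a x) = 1 &
    n2 (fun x => h x - 1) <= expect a].
Proof.
move=> ia a0.
have a1 x : 0 < 1 + a x by rewrite ltr_pwDl.
pose w x := Num.sqrt (1 + a x).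
have w1 x : 1 <= w x by rewrite -[leLHS]sqrtr1 ler_sqrt ?lerDl// ltW.
have w0 x : 0 < w x by rewrite (lt_le_trans _ (w1 x)).
have wn x : w x != 0 by rewrite gt_eqF.
have w2 x : w x ^+ 2 = 1 + a x by rewrite sqr_sqrtr// ltW.
have i1a : rint (fun x => 1 + a x) by apply: rintD => //; exact: rint_cst.
have mw : rmeas w by apply: rmeas_sqrt; exact: rint_meas i1a.
pose wc x : R[i] := (w x)%:C; pose k x : R[i] := ((w x)^-1)%:C.
have mwc : cmeasurable wc by exact: cmeas_real.
have mk : cmeasurable k by apply: cmeas_real; exact: rmeasV.
have nwc x : nrm (wc x) = w x by rewrite nrm_real ger0_norm// ltW.
have nk x : nrm (k x) = (w x)^-1 by rewrite nrm_real ger0_norm// invr_ge0 ltW.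
have k1 x : nrm (k x) <= 1 by rewrite nk invf_le1.
have kw x : k x * wc x = 1 by rewrite -rmorphM/= mulVf.
have sw : sqint wc.
  by apply: sqint_le i1a _ => // x; rewrite nwc w2.
have sk : sqint k := sqint_bounded sigma mk k1.
pose A : set (K -> R[i]) := [set f | exists2 g, tpolys Pn g & f = fun x => k x * g x].
have TL := @tpolys_sqint R G sigma Pn.
have AS : A `<=` sqint.
  by move=> _ [g /TL sg ->]; exact: (sqintM_bounded sg mk k1).
have AL : A `<=` Lp 2%:E by move=> f /AS /Lp2P.
have sA : subspace A.
  split; first by exists 0; [exact: (tpolys_subspace _ _).1|
    apply/funext => x; rewrite mulr0].
  move=> c _ _ [g tg ->] [g' tg' ->].
  exists (fun x => c * g x + g' x); first exact: (tpolys_subspace _ _).2.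
  by apply/funext => x; ring.
pose N := clos 2%:E A.
have NL : N `<=` Lp 2%:E by move=> f; exact: clos_Lp.
have NS : N `<=` sqint by move=> f /NL /Lp2P.
have AN : A `<=` N by exact: sub_clos p2_ge1 _ AL.
have iN : invariant 2%:E N.
  split; first exact: clos_closed_subspace p2_ge1 AL sA.
  move=> l f Pl; apply: (clos_bounded_mul (c := 1) p2_ge1 AL AL (cmeas_chi R l)).
    by apply: nearW => x; rewrite nrm_chi.
  move=> _ [g [s hs ->] ->]; exists (fun x => chi l x * tpoly s x).
    exists [seq (b.1, l + b.2) | b <- s].
      move=> _ /mapP[b /hs Pb ->] /=; exact: (nonnegD orderP).
    by apply/funext => x; rewrite tpoly_mulchi.
  by apply/funext => x; rewrite mulrCA.
have Ak : A k.
  exists (chi 0); first exact/tpolys_chi/nonneg0.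
  by apply/funext => x; rewrite chi0l mulr1.
have Nk : N k := AN _ Ak.
have schiw l : sqint (fun x => conjc (chi l x) * wc x).
  apply: (sqintM_bounded (M := 1) sw) => [|x]; first exact/cmeasJ/cmeas_chi.
  by rewrite nrm_conj nrm_chi.
have cwJ x : conjc (wc x) = wc x by exact: conjc_real.
(* On [A] the weight cancels, as [k * wc = 1]; what is left is a polynomial with strictly positive
   frequencies, of mean 0. *)
have ip0 l f : P l -> N f -> ip f (fun x => conjc (chi l x) * wc x) = 0.
  move=> Pl; apply: (clos2_ip_eq0 AS (schiw l)) => _ [g [s hs ->] ->].
  rewrite /ip (eq_cint _ (g := fun x => \sum_(b <- s) b.1 * chi (l + b.2) x)).
    rewrite cint_sum => [|b]; last by apply: integZ; exact: integ_chi.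
    rewrite big_seq big1// => b /hs Pb; rewrite cintZ; last exact: integ_chi.
    by rewrite chi_mean0 ?mulr0//; exact: (posD_nonneg orderP).
  move=> x; rewrite conj_conjc conjcJM cwJ.
  rewrite (_ : _ * _ = (k x * wc x) * (chi l x * tpoly s x)); last by ring.
  rewrite kw mul1r /tpoly mulr_sumr; apply: eq_bigr => b _.
  by rewrite chiDl mulrCA.
have nEk : ~ minus sigma P 2%:E N k.
  move=> Ek; have k0 : ip k wc = 0.
    have SL := span_shifts_Lp (S := P) p2_ge1 NL.
    apply: (clos2_ip_eq0 _ sw _ Ek) => [f /SL /Lp2P//|].
    move=> f sf; have : sqint f /\ ip f wc = 0; last by case.
    apply: (span_sub (E := fun f => sqint f /\ ip f wc = 0)) sf.
      split; first split; first exact: sqint0.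
        rewrite /ip -[RHS](cint_cst sigma); apply: eq_cint => x; exact: mul0r.
      move=> c f1 f2 [s1 e1] [s2 e2]; split; first by apply: sqintD => //; exact: sqintZ.
      by rewrite ipDl ?ipZl ?e1 ?e2 ?mulr0 ?addr0//; exact: sqintZ.
    move=> g [l Pl [mg [u Nu gu]]].
    have scu : sqint (fun x => chi l x * u x).
      apply: (sqintM_bounded (M := 1) (NS _ Nu)) => [|x]; first exact: cmeas_chi.
      by rewrite nrm_chi.
    have sg : sqint g.
      by apply: (ae_sqint mg _ scu); apply: filterS gu => x ->.
    split=> //; rewrite -(ip0 _ _ Pl Nu); apply: ae_cint.
    - by apply: cmeasM => //; exact: cmeasJ.
    - by apply: cmeasM; [exact: (NS _ Nu).1|apply: cmeasJ; exact: (schiw l).1].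
    apply: filterS gu => x ->; rewrite !conj_conjc.
    by rewrite conjcJM; ring.
  move: k0; rewrite /ip (eq_cint _ (g := fun=> 1)) ?cint_cst.
    by move/eqP; rewrite oner_eq0.
  by move=> x; rewrite conj_conjc cwJ kw.
have [phi [mphi uphi phiN Nphi]] := beurling_L2 haar orderP chi_mean0 iN Nk nEk.
have phi1 := unimodular_nrm uphi.
pose h x := conjc (phi x) * k x.
have hk x : nrm (phi x) = 1 -> nrm (h x) = (w x)^-1.
  by move=> e; rewrite Normc.normcM nrm_conj e mul1r nk.
have w1V x : (w x)^-1 <= 1 by rewrite invf_le1.
have mh : cmeasurable h by apply: cmeasM => //; exact: cmeasJ.
have Hh : Hp +oo h.
  apply: (Hp_Hy (Nphi _ Nk)); apply/LpyP; split=> //; exists 1.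
  by apply: filterS uphi => x /norm1P /hk ->.
have Nphi1 : N phi.
  have := phiN _ (Hy_Hp p2_ge1 (tpolys_Hy orderP chi_mean0
    (tpolys_chi R (nonneg0 P)))).
  by under eq_fun do rewrite chi0l mulr1.
(* [v] is the inverse of [h] almost everywhere, and it belongs to [H^2] by [ip0] applied to [phi].
   Multiplicativity of the mean gives [cint h * cint v = 1], whence the lower bound [1 / expect w]
   on the modulus of [cint h]. *)
pose v x := wc x * phi x.
have sv : sqint v.
  have : sqint (fun x => phi x * wc x) := sqintM_ae_bounded sw mphi phi1.
  by under eq_fun do rewrite mulrC.
have Hv : Hp 2%:E v.
  split; first exact/Lp2P.
  move=> l Pl; rewrite -(ip0 _ _ Pl Nphi1); apply: eq_cint => x.
  by rewrite !conj_conjc conjcJM cwJ /v -chiNl; ring.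
have hv : \forall x \ae sigma, h x * v x = 1.
  apply: filterS (unimodularK uphi) => x; rewrite conj_conjc => e.
  rewrite (_ : h x * v x = (phi x * conjc (phi x)) * (k x * wc x)).
    by rewrite e kw mulr1.
  by rewrite /h /v; ring.
have chv : cint h * cint v = 1.
  rewrite -(Hy_mul_mean Hh Hv) -[RHS](cint_cst sigma); apply: ae_cint => //.
  by apply: cmeasM => //; exact: sv.1.
have nv : nrm (cint v) <= expect w.
  apply: le_trans (nrm_cint (sqint_integ sv)) _; apply: ae_le_expect.
  - exact: (sqint_integ sv).2.
  - by have := (sqint_integ sw).2; under eq_fun do rewrite nwc.
  apply: filterS phi1 => x e; rewrite Normc.normcM nwc ler_piMr// ltW//.
have iw : rint w by have := (sqint_integ sw).2; under eq_fun do rewrite nwc.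
have nh : nrm (cint h) * nrm (cint v) = 1 by rewrite -Normc.normcM chv Normc.normc1.
set b := nrm (cint h) in nh.
have b0 : 0 < b.
  rewrite lt_def nrm_ge0 andbT; apply/eqP => e.
  by move: nh; rewrite e mul0r => /eqP; rewrite eq_sym oner_eq0.
have bw : 1 <= b * expect w by rewrite -nh ler_wpM2l// ltW.
have wa : 2 * expect w <= 2 + expect a.
  rewrite -[2 in X in _ <= X](expect_cst sigma) -expectD//; last exact: rint_cst.
  rewrite -expectZ//; apply: le_expect; [exact: rintZ|by apply: rintD => //; exact: rint_cst|].
  move=> x; have := w2 x; have := sqr_ge0 (w x - 1); nra.
(* A rotation that makes the mean of [h] the positive number [b], since [h] is to be compared with
   1. *)
pose c : R[i] := conjc (cint h) * (b^-1)%:C.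
have c1 : nrm c = 1.
  by rewrite Normc.normcM nrm_conj nrm_real ger0_norm ?invr_ge0 ?ltW// mulfV// gt_eqF.
have [HyC iHy] := Hp_invariant sigma orderP (leey 1).
have Hch : Hp +oo (fun x => c * h x) by apply: subspaceZ => //; have [] := HyC.
have sh : sqint h := Lpy_sqint Hh.1.
exists (fun x => c * h x); split => //.
  apply: filterS uphi => x /norm1P /hk e; rewrite Normc.normcM c1 mul1r e.
  by rewrite exprVn w2 mulVf// gt_eqF.
have s1 := sqint_cst sigma 1.
have -> : n2 (fun x => c * h x - 1) = n2 h - 2 * b + 1.
  have := n2_subZ 1 (sqintZ c sh) s1.
  rewrite (_ : (fun x => c * h x - 1 * 1) = fun x => c * h x - 1); last first.
    by apply/funext => x; rewrite mulr1.
  move=> ->; rewrite n2Z// c1 expr1n mul1r Normc.normc1 expr1n mul1r.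
  have -> : n2 (fun=> 1 : R[i]) = 1.
    by rewrite /n2 Normc.normc1 expr1n expect_cst.
  congr (_ - 2 * _ + _); rewrite ipZl//.
  have -> : ip h (fun=> 1) = cint h.
    by apply: eq_cint => x; rewrite conj_conjc conjc1 mulr1.
  rewrite conj_conjc conjc1 mul1r /c mulrAC [_ * cint h]mulrC mulcJ -rmorphM/= -/b.
  by rewrite expr2 -mulrA mulfV ?mulr1// gt_eqF.
have h1 : n2 h <= 1.
  rewrite -[leRHS](expect_cst sigma); apply: ae_le_expect; [exact: sh.2|exact: rint_cst|].
  apply: filterS uphi => x /norm1P /hk ->.
  by rewrite exprn_ile1// invr_ge0 ltW.
(* Since [n2 h <= 1], the quantity to bound is at most [2 - 2 b]. From [expect w <= s] follows
   [1 <= b * s], and then [b + s >= 2] by the arithmetic-geometric inequality. *)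
suff : 2 <= b + (1 + expect a / 2) by lra.
set s := 1 + _; have bs : 1 <= b * s.
  by apply: le_trans bw _; rewrite ler_wpM2l ?(ltW b0)// /s; lra.
have s0 : 0 < s by rewrite -(pmulr_rgt0 _ b0); lra.
rewrite -ler_sqr ?nnegrE ?(addr_ge0 (ltW b0) (ltW s0))//.
rewrite (_ : (b + s) ^+ 2 = (b - s) ^+ 2 + 4 * (b * s)); last by ring.
have -> : 2 ^+ 2 = 4 :> R by ring.
have := sqr_ge0 (b - s); lra.
Qed.

Lemma Lpy_bound f : Lp +oo f -> exists2 C : R, 0 <= C & \forall x \ae sigma, nrm (f x) <= C.
Proof.
move=> /LpyP[_ [C fC]]; exists `|C| => //.
by apply: filterS fC => x /le_trans; apply; exact: ler_norm.
Qed.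

Lemma bounded_dense p N f : (1 <= p)%E -> invariant p N -> N f ->
  clos p (N `&` Lp +oo) f.
Proof.
move=> p1 iN Nf; have [[NL _ _] _] := iN; have fp := NL _ Nf.
have fi := Lp_integ p1 fp.
have NyL : N `&` Lp +oo `<=` Lp p by move=> g [/NL].
apply: (clos_small (F := f) (C := 2) p1 NyL fp fp) => d d0.
set I := expect (fun x => nrm (f x)).
have I0 : 0 <= I by apply: expect_ge0 => x; exact: nrm_ge0.
(* Chosen so that [4 * expect a = 4 * I / t <= d]; the summand 1 keeps [t] positive when [I = 0]. *)
pose t := (4 * I + 1) / d; have t0 : 0 < t by rewrite divr_gt0// ltr_wpDl// mulr_ge0.
pose a x := t^-1 * nrm (f x).
have ia : rint a by apply: rintZ; exact: fi.2.
have a0 x : 0 <= a x by rewrite mulr_ge0 ?nrm_ge0// invr_ge0 ltW.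
have [h [Hh ha hd]] := outer_function ia a0.
have mh := Hh.1.1.
have h1 : \forall x \ae sigma, nrm (h x) <= 1.
  apply: filterS ha => x e; have := nrm_ge0 (h x); have := a0 x.
  have := sqr_ge0 (nrm (h x)); nra.
have sh1 : sqint (fun x => h x - 1).
  by apply: sqintB; [exact: Lpy_sqint Hh.1|exact: sqint_cst].
(* The multiplier is [h ^+ 2 - 1]: the outer function is applied twice because it is [|h| ^+ 2] that
   equals [1 / (1 + a)], which yields [|h ^+ 2 * f| <= t]. The factor [h + 1] is at most 2 in
   modulus, hence the 4 in the estimate. *)
exists (fun x => (h x + 1) * (h x - 1)); split.
- apply: cmeasM; [apply: cmeasD|apply: cmeasB] => //; exact: cmeas_cst.
- apply: filterS h1 => x h1.
  rewrite (_ : _ * _ = h x * h x - 1); last by ring.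
  rewrite (le_trans (le_normcD _ _))// normcN Normc.normc1 Normc.normcM.
  have := nrm_ge0 (h x); nra.
- apply: (@le_trans _ _ (4 * n2 (fun x => h x - 1))); last first.
    apply: (@le_trans _ _ (4 * expect a)); first by rewrite ler_wpM2l.
    have ea : t * expect a = I.
      by rewrite expectZ; [rewrite mulrA mulfV ?mul1r// gt_eqF|exact: fi.2].
    have td : t * d = 4 * I + 1 by rewrite divfK// gt_eqF.
    rewrite -(ler_pM2l t0) mulrCA ea td; lra.
  rewrite -expectZ ?sh1.2//; apply: ae_le_expect.
  + apply: (sqintM_ae_bounded (M := 2) sh1 _ _).2.
      by apply: cmeasD => //; exact: cmeas_cst.
    apply: filterS h1 => x h1; rewrite (le_trans (le_normcD _ _))// Normc.normc1.
    lra.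
  + by apply: rintZ; exact: sh1.2.
  apply: filterS h1 => x h1; rewrite Normc.normcM exprMn ler_wpM2r ?sqr_ge0//.
  have := le_normcD (h x) 1; rewrite Normc.normc1; have := nrm_ge0 (h x + 1); nra.
rewrite (_ : (fun x => _) = fun x => h x * (h x * f x)); last first.
  by apply/funext => x; ring.
have Nhf := Hy_mul haar orderP p1 iN Hh (Hy_mul haar orderP p1 iN Hh Nf).
split=> //; apply/LpyP; split; first exact: (NL _ Nhf).1.
exists t; apply: filterS ha => x e; rewrite !Normc.normcM mulrA -expr2.
have n0 := nrm_ge0 (f x); have h0 := sqr_ge0 (nrm (h x)).
have fE : nrm (f x) = t * a x by rewrite /a mulrA mulfV ?mul1r// gt_eqF.
rewrite {1}fE; have := a0 x; nra.
Qed.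

(** The approximants [g] have no common bound. The outer function for [a = |g - f| ^+ 2] repairs
    this: in [h g - f = h (g - f) + f (h - 1)] the first term is at most 1 and the second at most
    [2 C], and both are small in [L^2] because [n2 (h - 1) <= n2 (g - f)]. So the [h g], which stay
    in [N], tend to [f] in the topology of [L^p]. *)
Lemma bounded_L2_closed p N f : (1 <= p)%E -> invariant p N -> Lp +oo f ->
  clos 2%:E (N `&` Lp +oo) f -> N f.
Proof.
move=> p1 iN fy cf; have [[NL _ cN] _] := iN; have [C C0 fC] := Lpy_bound fy.
have NyS : N `&` Lp +oo `<=` sqint by move=> g [_ /Lpy_sqint].
have [sf H] := iffLR (clos2P _ NyS) cf.
apply: cN; apply: (clos_small (F := fun=> 1) (C := 1 + 2 * C) p1 NL).
- exact: Lpy_Lp.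
- exact: Lp_cst.
(* The two terms of the error together cost at most [(2 + 2 C ^+ 2) * d']. *)
move=> d d0; pose d' := d / (2 + 2 * C ^+ 2 + 1).
have D0 : 0 < 2 + 2 * C ^+ 2 + 1 by rewrite ltr_wpDl// addr_ge0// mulr_ge0// sqr_ge0.
have d'0 : 0 < d' by rewrite divr_gt0.
have [g [Ng gy] fg] := H _ d'0; have sg := Lpy_sqint gy.
have sgf : sqint (fun x => g x - f x) by exact: sqintB.
rewrite n2BC in fg.
have [h [Hh ha hd]] := outer_function sgf.2 (fun=> sqr_ge0 _).
have mh := Hh.1.1.
have h1 : \forall x \ae sigma, nrm (h x) <= 1.
  apply: filterS ha => x; set u := _ ^+ 2; set v := nrm _ ^+ 2 => e.
  have v0 : 0 <= v := sqr_ge0 _.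
  by rewrite -ler_sqr ?nnegrE ?nrm_ge0// expr1n -/u; have u0 : 0 <= u := sqr_ge0 _; nra.
have sh1 : sqint (fun x => h x - 1).
  by apply: sqintB; [exact: Lpy_sqint Hh.1|exact: sqint_cst].
have shgf : sqint (fun x => h x * (g x - f x)) := sqintM_ae_bounded sgf mh h1.
have shf : sqint (fun x => f x * (h x - 1)) := sqintM_ae_bounded sh1 fy.1 fC.
have rE x : h x * g x - f x = h x * (g x - f x) + f x * (h x - 1) by ring.
exists (fun x => h x * g x - f x); split.
- by apply: cmeasB; [apply: cmeasM => //; exact: gy.1|exact: fy.1].
- move: fC h1 ha; apply: filterS3 => x fC h1 e; rewrite rE.
  apply: le_trans (le_normcD _ _) _; rewrite !Normc.normcM lerD//.
    rewrite -ler_sqr ?nnegrE ?mulr_ge0 ?nrm_ge0// exprMn expr1n.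
    set u := nrm (h x) ^+ 2 in e *; have u0 : 0 <= u := sqr_ge0 _.
    by move: e; rewrite mulrDr mulr1; lra.
  rewrite mulrC ler_pM ?nrm_ge0//; rewrite (le_trans (le_normcD _ _))//.
  by rewrite normcN Normc.normc1; lra.
- rewrite (_ : (fun x => _) = fun x => h x * (g x - f x) + f x * (h x - 1)); last first.
    by apply/funext => x; exact: rE.
  apply: le_trans (n2D_le shgf shf) _.
  have e1 : n2 (fun x => h x * (g x - f x)) <= n2 (fun x => g x - f x).
    apply: ae_le_expect; [exact: shgf.2|exact: sgf.2|].
    apply: filterS h1 => x h1; rewrite Normc.normcM exprMn ler_piMl ?sqr_ge0//.
    by rewrite exprn_ile1// nrm_ge0.
  have e2 : n2 (fun x => f x * (h x - 1)) <= C ^+ 2 * n2 (fun x => h x - 1).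
    rewrite -expectZ ?sh1.2//; apply: ae_le_expect; [exact: shf.2|apply: rintZ; exact: sh1.2|].
    apply: filterS fC => x fC; rewrite Normc.normcM exprMn ler_wpM2r ?sqr_ge0//.
    by rewrite ler_sqr ?nnegrE ?nrm_ge0.
  have e3 : C ^+ 2 * n2 (fun x => h x - 1) <= C ^+ 2 * d'.
    by rewrite ler_wpM2l ?sqr_ge0//; apply: le_trans hd _; exact: ltW.
  have e4 : (2 + 2 * C ^+ 2 + 1) * d' = d by rewrite /d' mulrC divfK// gt_eqF.
  have := ltW fg; lra.
rewrite (_ : (fun x => _) = fun x => h x * g x); last first.
  by apply/funext => x; ring.
exact: (Hy_mul haar orderP p1 iN).
Qed.

(* The passage to [L2] goes through the bounded functions, which are dense in [N]
   and are recovered from their [L2] closure. *)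
Theorem beurling_Lp p N f0 : (1 <= p)%E -> invariant p N -> N f0 ->
  ~ minus sigma P p N f0 -> exists phi,
  [/\ cmeasurable phi, unimodular sigma phi,
      forall u, Hp p u -> N (fun x => phi x * u x) &
      forall f, N f -> Hp p (fun x => conjc (phi x) * f x)].
Proof.
move=> p1 iN Nf0 nEf0; have [[NL sN cN] chiN] := iN.
have iE := minus_invariant orderP p1 NL.
set E := minus _ _ _ _ in nEf0 iE; have [cE _] := iE; have [EL sE EE] := cE.
have bS M : M `&` Lp +oo `<=` sqint by move=> g [_ /Lpy_sqint].
have bL M : M `&` Lp +oo `<=` Lp 2%:E by move=> g /bS /Lp2P.
have bsub M : subspace M -> subspace (M `&` Lp +oo).
  move=> sM; have sy := Lp_subspace sigma (leey 1).
  split; first by split; [exact: sM.1|exact: sy.1].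
  by move=> a f g [? ?] [? ?]; split; [exact: sM.2|exact: sy.2].
have chiy l f : Lp +oo f -> Lp +oo (fun x => chi l x * f x).
  move=> fy; apply: (LpM (c := 1) (leey 1) fy (cmeas_chi R l)).
  by apply: nearW => x; rewrite nrm_chi.
(* If every bounded function of [N] were in [E], which is closed, density of the bounded functions
   would put all of [N] in [E]. *)
have [f1 [[Nf1 f1y] nEf1]] : exists f1, (N `&` Lp +oo) f1 /\ ~ E f1.
  apply: contrapT => H; apply: nEf0; apply: EE.
  apply: (clos_sub (A := N `&` Lp +oo)); last exact: bounded_dense.
  by move=> g Ng; apply: contrapT => nEg; apply: H; exists g.
pose N2 := clos 2%:E (N `&` Lp +oo).
have N2L : N2 `<=` Lp 2%:E by move=> f; exact: clos_Lp.
have chi1 l : \forall x \ae sigma, nrm (chi l (x : K)) <= 1 :> R.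
  by apply: nearW => x; rewrite nrm_chi.
have iN2 : invariant 2%:E N2.
  split; first by apply: clos_closed_subspace; [exact: p2_ge1|exact: bL|exact: bsub].
  move=> l f Pl; apply: (clos_bounded_mul p2_ge1 (bL _) (bL _) (cmeas_chi R l) (chi1 l)).
  by move=> g [Ng gy]; split; [exact: chiN|exact: chiy].
have N2f1 : N2 f1 by exact: (sub_clos p2_ge1 (bL _)).
(* [minus N2] lies in the [L^2] closure of the bounded functions of [E], and [bounded_L2_closed]
   brings any bounded element of that closure back into [E]. *)
have nE2f1 : ~ minus sigma P 2%:E N2 f1.
  move=> E2f1; apply: nEf1; apply: (bounded_L2_closed p1 iE f1y).
  have cE2 : closed_subspace sigma 2%:E (clos 2%:E (E `&` Lp +oo)).
    by apply: clos_closed_subspace; [exact: p2_ge1|exact: bL|exact: bsub].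
  apply: (shifts_sub p2_ge1 cE2) E2f1 => l f Pl.
  apply: (clos_bounded_mul p2_ge1 (bL _) (bL _) (cmeas_chi R l) (chi1 l)).
  by move=> g [Ng gy]; split; [exact: (minus_chi p1 NL)|exact: chiy].
have [phi [mphi uphi phiN2 N2phi]] := beurling_L2 haar orderP chi_mean0 iN2 N2f1 nE2f1.
have phi1 := unimodular_nrm uphi.
have phiJ1 : \forall x \ae sigma, nrm (conjc (phi x)) <= 1.
  by apply: filterS phi1 => x; rewrite nrm_conj.
have iH := Hp_invariant sigma orderP p1; have [[HL sH cH] _] := iH.
(* Both claims are checked on bounded functions, for which membership in [N] and in [N2] agree, and
   extended by density since [phi] and its conjugate are bounded multipliers. *)
exists phi; split=> // [u Hu|f Nf].
  apply: cN; have bHL : Hp p `&` Lp +oo `<=` Lp p by move=> g [[]].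
  apply: (clos_bounded_mul p1 bHL NL mphi phi1 _ (bounded_dense p1 iH Hu)).
  move=> g [Hg gy]; have Hgy := Hp_Hy Hg gy.
  apply: (bounded_L2_closed p1 iN); first exact: (LpM (leey 1) gy mphi phi1).
  exact/phiN2/(Hy_Hp p2_ge1).
apply: cH; have bNL : N `&` Lp +oo `<=` Lp p by move=> g [/NL].
apply: (clos_bounded_mul p1 bNL HL (cmeasJ mphi) phiJ1 _ (bounded_dense p1 iN Nf)).
move=> g [Ng gy]; apply: (Hy_Hp p1); apply: Hp_Hy.
  by apply: N2phi; exact: (sub_clos p2_ge1 (bL _)).
exact: (LpM (leey 1) gy (cmeasJ mphi) phiJ1).
Qed.

End LpBeurling.

(** * Multiplication by the inner function, and the theorem *)

Section InnerMultiples.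
Variables (R : realType) (G : zmodType).
Variable sigma : probability (borel_dual R G) R.
Hypothesis haar : is_haar sigma.
Variable P : set G.
Hypothesis orderP : group_order P.
Local Notation K := (dual R G).
Local Notation sqint := (sqint sigma).
Local Notation ip := (ip sigma).
Local Notation cint := (cintegral sigma).
Local Notation Lp := (Lp sigma).
Local Notation Hp := (Hp sigma P).
Local Notation tilde := (tilde sigma P).
Local Notation minus := (minus sigma P).
Local Notation mulset := (mulset sigma).
Implicit Types (l : G) (x : K) (f g h u v w phi : K -> R[i]).
Implicit Types (M N W : set (K -> R[i])) (p : \bar R).

(* [cint (chi l) = 0] as soon as [chi l] is not constant, and rather than proving
   that [dual R G] separates [G] we use that [chi l = 1] for some positive [l]
   would give [minus N = N]. *)
Lemma minus_proper_chi_mean0 p N : (1 <= p)%E -> N `<=` Lp p ->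
  ~ N `<=` minus p N -> forall l, P l -> cint (chi l) = 0.
Proof.
move=> p1 NL nN l Pl; apply: (cint_chi haar); apply: contrapT => H; apply: nN => f Nf.
rewrite (_ : f = fun x => chi l x * f x); first exact: minus_chi.
apply/funext => x; suff -> : chi l x = 1 by rewrite mul1r.
by apply: contrapT => lx; apply: H; exists x.
Qed.

(** Multiplication by the bounded [I] is continuous, and it sends each generator [chi l * u] of
    [tilde M] into the closed subspace [M] by hypothesis. *)
Lemma inner_mul_tilde p M I f : (1 <= p)%E -> closed_subspace sigma p M ->
  inner_function sigma P I ->
  (forall l, nonneg P l -> mulset (fun x => chi l x * I x) M `<=` M) ->
  tilde p M f -> M (fun x => I x * f x).
Proof.
move=> p1 [ML sM cM] [HI uI] IM tf; have mI := HI.1.1.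
apply: cM; have SL := span_shifts_Lp (S := nonneg P) p1 ML.
apply: (clos_bounded_mul p1 SL ML mI (unimodular_nrm uI) _ tf).
move=> g; apply: (span_sub (E := fun g => M (fun x => I x * g x))).
  split.
    rewrite (_ : (fun x => _) = 0); first exact: sM.1.
    by apply/funext => x; rewrite mulr0.
  move=> a g1 g2 h1 h2; have := sM.2 a _ _ h1 h2.
  by congr M; apply/funext => x; ring.
move=> {}g [l Pl [mg [u Mu gu]]]; apply: (IM l Pl); split; first exact: cmeasM.
by exists u => //; apply: filterS gu => x ->; ring.
Qed.

(* [W] consists of the differences [f / phi - I * q], where [q] is the
   orthogonal projection of [conj I * f / phi] onto [H^2]. *)
Lemma inner_decomposition M I phi : closed_subspace sigma 2%:E M ->
  inner_function sigma P I -> cmeasurable phi -> unimodular sigma phi ->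
  (forall u, Hp 2%:E u -> M (fun x => I x * (phi x * u x))) ->
  (forall f, M f -> Hp 2%:E (fun x => conjc (phi x) * f x)) ->
  exists W, [/\ subspace W, W `<=` Hp 2%:E,
    orthogonal sigma W (mulset I (Hp 2%:E)) &
    M = mulset phi (sumset W (mulset I (Hp 2%:E)))].
Proof.
move=> cM [HI uI] mphi uphi IH MH; have [ML sM _] := cM; have mI := HI.1.1.
have iH := Hp_invariant sigma orderP (@p2_ge1 R); have [[HL sH cH] _] := iH.
have HS : Hp 2%:E `<=` sqint by move=> f /HL /Lp2P.
have IHH u : Hp 2%:E u -> Hp 2%:E (fun x => I x * u x) := Hy_mul haar orderP p2_ge1 iH HI.
pose W : set (K -> R[i]) := [set w | [/\ Hp 2%:E w, M (fun x => phi x * w x) &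
  forall g, Hp 2%:E g -> ip w (fun x => I x * g x) = 0]].
exists W; split.
- split.
    split; first exact: sH.1.
      rewrite (_ : (fun x => _) = 0); first exact: sM.1.
      by apply/funext => x; rewrite mulr0.
    move=> g _; rewrite -[RHS](cint_cst sigma); apply: eq_cint => x; exact: mul0r.
  move=> a f g [Hf Mf fI] [Hg Mg gI]; split; first exact: sH.2.
    have := sM.2 a _ _ Mf Mg.
    by congr M; apply/funext => x; ring.
  move=> h Hh; have sIh := HS _ (IHH _ Hh).
  rewrite ipDl//; [|exact: (sqintZ _ (HS _ Hf))|exact: HS].
  by rewrite ipZl ?fI ?gI ?mulr0 ?addr0//; exact: HS.
- by move=> w [].
- move=> w g [Hw _ wI] [mg [h Hh gh]]; rewrite -[RHS](wI _ Hh).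
  apply: ae_cint.
  + by apply: cmeasM; [exact: Hw.1.1|exact: cmeasJ].
  + by apply: cmeasM; [exact: Hw.1.1|apply: cmeasJ; exact: (IHH _ Hh).1.1].
  by apply: filterS gh => x ->.
apply/seteqP; split=> [f Mf|g [mg [_ [w Ww [v [mv [h Hh vh]] <-]] gwv]]].
  have mf := (ML _ Mf).1; have Hu := MH _ Mf; set u := (fun x => _) in Hu.
  have IJ1 : \forall x \ae sigma, nrm (conjc (I x)) <= 1.
    by apply: filterS (unimodular_nrm uI) => x; rewrite nrm_conj.
  have sIu := sqintM_ae_bounded (HS _ Hu) (cmeasJ mI) IJ1.
  have [q Hq qP] := L2_projection HS sH cH sIu.
  have HIq := IHH _ Hq; have Hw := subspaceB sH Hu HIq.
  split=> //; exists (fun x => u x); last first.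
    apply: filterS (unimodularK uphi) => x; rewrite conj_conjc => e.
    by rewrite /u mulrA e mul1r.
  exists (fun x => u x - I x * q x); last first.
    exists (fun x => I x * q x); last by apply/funext => x; rewrite subrK.
    by split; [exact: HIq.1.1|exists q => //; exact: nearW].
  split=> //.
    (* Almost everywhere [phi * (u - I * q) = f - I * phi * q], a difference of two elements of
       [M]. *)
    apply: (closed_ae p2_ge1 cM (subspaceB sM Mf (IH _ Hq))).
      by apply: cmeasM => //; exact: Hw.1.1.
    apply: filterS (unimodularK uphi) => x; rewrite conj_conjc => e.
    by rewrite /u mulrBr [phi x * (_ * f x)]mulrA e mul1r; ring.
  (* As [|I| = 1] almost everywhere, the inner product of [u - I * q] with [I * g] is that of
     [conjc I * u - q] with [g], which vanishes by the choice of [q]. *)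
  move=> g Hg; rewrite -[RHS](qP _ Hg); apply: ae_cint.
  - by apply: cmeasM; [exact: Hw.1.1|apply: cmeasJ; exact: (IHH _ Hg).1.1].
  - apply: cmeasM; last by apply: cmeasJ; exact: Hg.1.1.
    by apply: cmeasB; [exact: sIu.1|exact: Hq.1.1].
  apply: filterS (unimodularK uI) => x; rewrite rmorphM !conj_conjc => e.
  rewrite -[q x in RHS]mul1r -e; ring.
have [Hw Mw _] := Ww.
apply: (closed_ae p2_ge1 cM (subspaceD sM Mw (IH _ Hh)) mg).
by move: gwv vh; apply: filterS2 => x -> ->; ring.
Qed.

End InnerMultiples.

Theorem theorem4p4 (R : realType) (G : zmodType) (P : set G)
    (sigma : probability (borel_dual R G) R) (p : \bar R)
    (M : set (dual R G -> R[i])) (I : dual R G -> R[i]) :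
  group_order P -> is_haar sigma -> (1 <= p)%E ->
  closed_subspace sigma p M ->
  minus sigma P p (tilde sigma P p M) `<` tilde sigma P p M ->
  inner_function sigma P I ->
  (forall l, nonneg P l -> mulset sigma (fun x => chi l x * I x) M `<=` M) ->
  exists phi : dual R G -> R[i],
    [/\ cmeasurable phi, unimodular sigma phi,
        mulset sigma (fun x => I x * phi x) (Hp sigma P p) `<=` M,
        M `<=` mulset sigma phi (Hp sigma P p)
      & p = 2%:E ->
        exists W : set (dual R G -> R[i]),
          [/\ subspace W, W `<=` Hp sigma P 2%:E,
              orthogonal sigma W (mulset sigma I (Hp sigma P 2%:E))
            & M = mulset sigma phi
                    (sumset W (mulset sigma I (Hp sigma P 2%:E)))]].
Proof.
move=> orderP haar p1 cM [_ ntilde] innerI IM; have [ML sM _] := cM.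
have iN : invariant sigma P p (tilde sigma P p M).
  by apply: shifts_invariant => // l m; exact: nonnegD.
have [[NL _ _] _] := iN.
have chi_mean0 := minus_proper_chi_mean0 haar p1 NL ntilde.
have [f0 Nf0 nEf0] : exists2 f0, tilde sigma P p M f0 &
    ~ minus sigma P p (tilde sigma P p M) f0.
  by apply: contrapT => H; apply: ntilde => f Nf; apply: contrapT => nf; apply: H; exists f.
have [phi [mphi uphi phiN Nphi]] := beurling_Lp haar orderP chi_mean0 p1 iN Nf0 nEf0.
have MN : M `<=` tilde sigma P p M.
  move=> f Mf; rewrite (_ : f = fun x => chi 0 x * f x).
    exact: (shifts_chi p1 ML (nonneg0 P) Mf).
  by apply/funext => x; rewrite chi0l mul1r.
have IH u : Hp sigma P p u -> M (fun x => I x * (phi x * u x)).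
  by move=> /phiN; exact: inner_mul_tilde.
have MH f : M f -> Hp sigma P p (fun x => conjc (phi x) * f x) by move=> /MN /Nphi.
exists phi; split=> //.
- move=> g [mg [u Hu gu]]; apply: (closed_ae p1 cM (IH _ Hu) mg).
  by apply: filterS gu => x ->; rewrite mulrA.
- move=> f Mf; split; first exact: (ML _ Mf).1.
  exists (fun x => conjc (phi x) * f x); first exact: MH.
  apply: filterS (unimodularK uphi) => x; rewrite conj_conjc => e.
  by rewrite mulrA e mul1r.
- by move=> p2; rewrite p2 in cM IH MH; exact: inner_decomposition.
Qed.
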